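(* Let $\Omega\subseteq\mathbb{C}$ be a compact infinite set such that $\Omega^c$ is a simply connected domain in $\widehat{\mathbb{C}}$, with exterior Riemann map $\mathcal{R}_\Omega$ and $d_1=\mathcal{R}_\Omega'(\infty)>0$. Let $P_n(z)=\sum_{j=0}^n p_jz^j$ be a polynomial of degree $n$ such that $E=P_n^{-1}(\Omega)$ consists of two components $E_1,E_2$, and let $z_*$ be the critical point of $P_n$ in $\mathbb{C}\setminus E$. For $j=1,2$ let $n_j$ be the number of zeros (with multiplicity) of $P_n(z)-\omega$ in $E_j$, which is the same for all $\omega\in\Omega$. Then the centers $a_1,a_2$ of the set $L$ associated with $E$ by Walsh's theorem satisfy $$\left(a_2+\frac{p_{n-1}}{np_n}\right)^n=\frac{(-1)^{n_2}n_1^{n_2}}{d_1p_nn_2^{n_2}}\,(\mathcal{R}_\Omega\circ P_n)(z_* ),$$ $$a_1=-\frac{1}{n_1}\left(\frac{p_{n-1}}{p_n}+n_2a_2\right).$$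
   Context: $\widehat{\mathbb{C}}=\mathbb{C}\cup\{\infty\}$, $K^c=\widehat{\mathbb{C}}\setminus K$, $\mathbb{D}$ is the open unit disk. A compact set $K\subseteq\mathbb{C}$ is called simply connected if $K$ and $K^c$ are both connected. $\operatorname{cap}(K)$ is the logarithmic capacity. The exterior Riemann map of $\Omega$ is the conformal map $\mathcal{R}_\Omega:\Omega^c\to\overline{\mathbb{D}}^c$ with $\mathcal{R}_\Omega(z)=d_1z+d_0+\sum_{k\ge1}d_{-k}z^{-k}$ near $\infty$ and $d_1=\mathcal{R}_\Omega'(\infty)=1/\operatorname{cap}(\Omega)>0$. The preimage $E=P_n^{-1}(\Omega)=\{z\in\mathbb{C}:P_n(z)\in\Omega\}$ is compact and its components are infinite simply connected compact sets. If $E$ has exactly two components, then $P_n$ has exactly one critical point (counted with multiplicity) in $\mathbb{C}\setminus E$. Walsh's theorem (known): if $E_1,\ldots,E_\ell\subseteq\mathbb{C}$ are disjoint simply connected, infinite compact sets and $E=\bigcup_j E_j$, then there exist a unique compact set of the form $L=\{w\in\mathbb{C}:|U(w)|\le\operatorname{cap}(E)\}$, $|U(w)|=\prod_{j=1}^\ell|w-a_j|^{m_j}$, with distinct $a_1,\ldots,a_\ell\in\mathbb{C}$ (centers) and real $m_1,\ldots,m_\ell>0$ (exponents), $\sum_{j=1}^\ell m_j=1$, and a unique conformal (i.e. bijective holomorphic) map $\Phi:E^c\to L^c$ with $\Phi(z)=z+\mathcal{O}(1/z)$ at $\infty$ (the Walsh map). The $a_j$ and $m_j$ are uniquely determined.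 $L$ has $\ell$ disjoint compact components $L_1,\ldots,L_\ell$ with $a_j\in L_j$, labeled such that a Jordan curve in $\mathbb{C}\setminus E$ surrounding $E_j$ (and no other $E_k$) is mapped by $\Phi$ onto a Jordan curve surrounding $L_j$ (and no other $L_k$). *)

(* Defs.v *)
From mathcomp Require Import all_boot all_order all_algebra complex.
From mathcomp Require Import all_classical all_reals all_analysis.
Import Order.TTheory GRing.Theory Num.Theory numFieldNormedType.Exports.

Set Implicit Arguments.
Unset Strict Implicit.
Unset Printing Implicit Defensive.

Local Open Scope classical_set_scope.
Local Open Scope ring_scope.
Local Open Scope complex_scope.

(* The analytic structures on R[i] are only declared on the alias (R[i])^o. *)
Notation cplx R := ((R[i])^o).

Notation sphere R := (one_point_compactification (cplx R)).

Section Sphere.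
Variable R : realType.
Local Notation C := (cplx R).
Local Notation Chat := (sphere R).

(* K^c is always taken in the sphere, so it contains the point at infinity. *)
Definition sphere_compl (K : set C) : set Chat := ~` (Some @` K).

Definition sphere_inv (x : Chat) : Chat :=
  if x is Some z then if z == 0 then None else Some z^-1 else Some 0.

(* A chart around x: the identity if x is finite, inversion if x is infinity.
   It is an involution, hence its own inverse. *)
Definition sphere_chart (x : Chat) : Chat -> Chat :=
  if x is Some _ then id else sphere_inv.

(* f is holomorphic on an open set when this holds at each of its points; by
   continuity the value 0 that odflt assigns to infinity is irrelevant. *)
Definition complex_diff_at (f : Chat -> Chat) (x : Chat) : Prop :=
  {for x, continuous f} /\
  derivable
    (odflt 0 \o sphere_chart (f x) \o f \o sphere_chart x \o Some : C -> C)
    (odflt 0 (sphere_chart x x)) 1.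

Definition conformal_map (A B : set Chat) (f : Chat -> Chat) : Prop :=
  set_bij A B f /\ forall x, A x -> complex_diff_at f x.

Definition simply_connected_domain (T : topologicalType) (A : set T) : Prop :=
  [/\ A !=set0, open A, connected A &
    forall gamma : R -> T, {within `[0, 1], continuous gamma} ->
      gamma 0 = gamma 1 -> (forall t, t \in `[0, 1] -> A (gamma t)) ->
    exists H : R * R -> T,
    [/\ {within `[0, 1] `*` `[0, 1], continuous H},
        forall s t, s \in `[0, 1] -> t \in `[0, 1] -> A (H (s, t)),
        forall t, t \in `[0, 1] -> H (0, t) = gamma t,
        forall t, t \in `[0, 1] -> H (1, t) = gamma 0 &
        forall s, s \in `[0, 1] -> H (s, 0) = gamma 0 /\ H (s, 1) = gamma 0]].

(* The coefficients are d_1 = d1 and d_(-k) = d k for k >= 0.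
   Note that 0 < d1 in R[i] means that d1 is real and positive. *)
Definition exterior_riemann_map (Omega : set C) (f : Chat -> Chat) (d1 : R[i]) :
    Prop :=
  [/\ conformal_map (sphere_compl Omega) (sphere_compl [set w | `|w| <= 1]) f,
      0 < d1 &
      exists (d : nat -> C) (rho : R), forall z : C, rho%:C < `|z| ->
      exists2 w : C, f (Some z) = Some w &
        series (fun k => d k * z ^- k) @ \oo --> w - d1 * z].

End Sphere.

Section Capacity.
Variable R : realType.
Local Notation C := (cplx R).
Local Notation normc := ComplexField.Normc.normc.

Definition borelC := g_sigma_algebraType (@open C).

Definition log_energy (mu : probability borelC R) : \bar R :=
  (\int[mu]_z \int[mu]_w lne (normc ((z : C) - (w : C)))%:E)%E.

(* cap(K) = sup exp(I(mu)) over the Borel probability measures mu on K, where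
   I(mu) is the double integral of log|z - w|; lne 0 = -oo, expeR -oo = 0. *)
Definition capacity (K : set C) : R :=
  fine (ereal_sup [set expeR (log_energy mu) |
                    mu in [set mu : probability borelC R | mu K = 1%E]]).

End Capacity.

Section Walsh.
Variable R : realType.
Local Notation C := (cplx R).
Local Notation Chat := (sphere R).
Local Notation normc := ComplexField.Normc.normc.

Definition jordan_curve (J : set C) : Prop :=
  exists gamma : R -> C,
  [/\ {within `[0, 1], continuous gamma}, {in `[0, 1[ &, injective gamma},
      gamma 0 = gamma 1 & J = gamma @` `[0, 1]].

(* S lies in the bounded part of the complement of J. *)
Definition surrounds (J S : set C) : Prop :=
  forall z, S z -> ~ J z /\ bounded_set (connected_component (~` J) z).

Definition surrounds_only (I : Type) (J : set C) (S_ : I -> set C) (j : I) :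
    Prop :=
  forall k, surrounds J (S_ k) <-> k = j.

Definition lemniscate (l : nat) (a : 'I_l -> C) (m : 'I_l -> R) (c : R) :
    set C :=
  [set w | \prod_j normc (w - a j) `^ m j <= c].

(* The centers a, the exponents m and the map Phi that Walsh's theorem
   attaches to E = \bigcup_j E_ j. The component L_j is the one of a j, and
   the last clause is the labeling. *)
Definition walsh_data (l : nat) (E_ : 'I_l -> set C) (a : 'I_l -> C)
    (m : 'I_l -> R) (Phi : Chat -> Chat) : Prop :=
  let E := \bigcup_j E_ j in
  let L := lemniscate a m (capacity E) in
  let L_ j := connected_component L (a j) in
  [/\ injective a /\ (forall j, 0 < m j) /\ \sum_j m j = 1,
      conformal_map (sphere_compl E) (sphere_compl L) Phi,
      exists rho M : R, forall z : C, rho%:C < `|z| ->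
        exists2 w : C, Phi (Some z) = Some w & `|z * (w - z)| <= M%:C,
      [/\ L = \bigcup_j L_ j, trivIset setT L_ & forall j, compact (L_ j)] &
      forall (j : 'I_l) (J : set C), jordan_curve J -> J `<=` ~` E ->
        surrounds_only J E_ j ->
      exists J' : set C,
        [/\ Phi @` (Some @` J) = Some @` J', jordan_curve J' &
            surrounds_only J' L_ j]].

End Walsh.

Definition components_are (T : topologicalType) (I : Type) (E : set T)
    (E_ : I -> set T) : Prop :=
  injective E_ /\ range E_ = [set connected_component E x | x in E].

(* Number of zeros of q in A, with multiplicity; the sum has finite support
   when q != 0. *)
Definition zeros_in (R : realType) (A : set (cplx R)) (q : {poly R[i]}) : nat :=
  \sum_(z \in A) @mup R[i] z q.

(* Main.v *)
(* Let phi be the Walsh map, rho the exterior Riemann map, N = deg P and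
   |U(w)| = |w - a1|^m1 |w - a2|^m2. Both ln |rho o P| and N (ln |U o phi| - ln c)
   are harmonic off E, vanish on the boundary of E and grow like N ln |z|, so they
   agree. Winding around a1 shows that N m1 and N m2 are integers, and then
   rho o P = d1 p_N Q o phi with Q(w) = (w - a1)^(N m1) (w - a2)^(N m2), because
   the quotient has constant modulus. Hence phi maps the critical point z* to the
   only critical point of Q other than a1 and a2, and the expansion at infinity
   gives the center of mass of the zeros of Q; these two equations are the claim,
   once N m_j = n_j. For the latter, the preimages under phi of the two parts of
   a thin shell around L are connected and surround one component of E each; by
   continuity of roots, E_k contains at most as many zeros of P - omega as Q has
   zeros in the corresponding part, and both counts add up to N. The labeling
   clause, applied to the preimage of the circle |w - a1| = m1 |a1 - a2|, shows
   that the part around a_j corresponds to E_j. *)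

Require Import Defs.
From mathcomp Require Import all_boot all_order all_algebra complex.
From mathcomp Require Import all_classical all_reals all_analysis.
From mathcomp Require Import ring lra zify.
Import Order.TTheory GRing.Theory Num.Theory numFieldNormedType.Exports.

Set Implicit Arguments.
Unset Strict Implicit.
Unset Printing Implicit Defensive.

Local Open Scope classical_set_scope.
Local Open Scope ring_scope.
Local Open Scope complex_scope.

(** * Complex differentiability *)

Section ComplexPlane.
Variable R : realType.
Local Notation C := (cplx R).
Local Notation normc := ComplexField.Normc.normc.

(** The analysis is built without integration. Trapezoid sums around squares yield a Cauchy estimate
    with constant 2 instead of 1; the loss disappears when the estimate is applied to high powers,
    and the open mapping argument leaves room for it. Harmonic functions occur only as real
    combinations of ln |f_i| with f_i holomorphic and free of zeros, which makes such powers
    accessible. The exponents N m_j have to be integers before rho o P can be compared with a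
    product of powers, as (w - a1)^(N m1) is otherwise multivalued off L. Critical points are
    recognised by the failure of local injectivity, a property that passes through conformal maps.
    Roots are counted by lower semicontinuity alone: an open set loses no root under a small
    perturbation, and lower bounds for disjoint sets that add up to the degree are exact. The
    definition ties a_j to E_j only through Jordan curves, so an explicit curve with a computable
    inside is needed. The chosen circle passes through the critical point of |U|, and |U| is at
    least its critical value everywhere on it, so that it avoids L. *)

Lemma normrC (z : R[i]) : `|z| = (normc z)%:C.
Proof. by []. Qed.

Lemma normc_ge0 (z : R[i]) : 0 <= normc z.
Proof. by case: z => a b /=; exact: sqrtr_ge0. Qed.

Lemma normc_gt0 (z : R[i]) : (0 < normc z) = (z != 0).
Proof.
have := normr_gt0 z; rewrite normrC => <-.
by rewrite -(ltcR 0).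
Qed.

Lemma normc_eq0 (z : R[i]) : (normc z == 0) = (z == 0).
Proof.
apply/idP/idP => [|/eqP->]; last by rewrite ComplexField.Normc.normc0.
by rewrite -[z == 0]negbK -normc_gt0 lt_def normc_ge0 andbT negbK.
Qed.

Lemma normcD (x y : R[i]) : normc (x + y) <= normc x + normc y.
Proof. exact: le_normcD. Qed.

Lemma normcB (x y : R[i]) : normc (x - y) = normc (y - x).
Proof. by rewrite -normcN opprB. Qed.

Lemma normcMM (x y : R[i]) : normc (x * y) = normc x * normc y.
Proof. exact: ComplexField.Normc.normcM. Qed.

Lemma normcVV (x : R[i]) : normc x^-1 = (normc x)^-1.
Proof. exact: ComplexField.Normc.normcV. Qed.

Lemma normcX (x : R[i]) n : normc (x ^+ n) = normc x ^+ n.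
Proof.
by elim: n => [|n IH]; rewrite ?expr0 ?ComplexField.Normc.normc1 // !exprS normcMM IH.
Qed.

Lemma normc_real (x : R) : normc x%:C = `|x|.
Proof. by rewrite /= expr0n /= addr0 sqrtr_sqr. Qed.

Lemma normc_Re (z : R[i]) : `|complex.Re z| <= normc z.
Proof. by rewrite -lecR -normrC normc_ge_Re. Qed.

Lemma normc_Im (z : R[i]) : `|complex.Im z| <= normc z.
Proof.
case: z => a b /=; rewrite -sqrtr_sqr ler_wsqrtr // lerDr sqr_ge0 //.
Qed.

Lemma nbhs_cplx (x : C) (U : set C) :
  nbhs x U <-> exists2 e : R, 0 < e & forall y : C, normc (y - x) < e -> U y.
Proof.
split=> [/nbhs_ballP[e /= e0 eU]|[e e0 eU]].
  have e0' : (0 : R) < complex.Re e by move: e0; rewrite ltcE /= => /andP[].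
  have ee : e = (complex.Re e)%:C by move: e0; case: (e) => a b; rewrite ltcE /= => /andP[/eqP->].
  exists (complex.Re e) => // y yx; apply: eU.
  by rewrite -ball_normE /= ee distrC normrC ltcR.
apply/nbhs_ballP; exists e%:C; first by rewrite /= ltcR.
move=> y; rewrite -ball_normE /= distrC normrC ltcR => yx; exact: eU.
Qed.

Lemma normc_bd (z : R[i]) : normc z <= `|complex.Re z| + `|complex.Im z|.
Proof.
rewrite [z in leLHS]complexE (le_trans (normcD _ _)) // lerD ?normc_real //.
by rewrite normcMM normc_real /= expr0n expr1n add0r sqrtr1 mul1r.
Qed.

Local Notation K := R[i].

(* The operations of the statements below are those of R[i]: continuity is
   wrapped in a constant to keep unification away from the alias (R[i])^o. *)
Definition contc (T : topologicalType) (f : T -> K) (x : T) : Prop :=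
  {for x, continuous (f : T -> C)}.

Lemma contM (T : topologicalType) (f g : T -> K) (x : T) :
  contc f x -> contc g x -> contc (fun z => f z * g z) x.
Proof. move=> cf cg; exact: (@continuousM R[i] T f g x cf cg). Qed.

Lemma contD (T : topologicalType) (f g : T -> K) (x : T) :
  contc f x -> contc g x -> contc (fun z => f z + g z) x.
Proof. move=> cf cg; exact: (@continuousD R[i] C T f g x cf cg). Qed.

Lemma contN (T : topologicalType) (f : T -> K) (x : T) :
  contc f x -> contc (fun z => - f z) x.
Proof. move=> cf; exact: (@continuousN R[i] C T f x cf). Qed.

Lemma contB (T : topologicalType) (f g : T -> K) (x : T) :
  contc f x -> contc g x -> contc (fun z => f z - g z) x.
Proof. by move=> cf cg; apply: contD; [exact: cf|exact: contN]. Qed.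

Lemma contV (T : topologicalType) (f : T -> K) (x : T) : f x != 0 ->
  contc f x -> contc (fun z => (f z)^-1) x.
Proof. move=> n0 cf; exact: (@continuousV R[i] T f x n0 cf). Qed.

Lemma contcst (T : topologicalType) (c : K) (x : T) : contc (fun=> c) x.
Proof. exact: (@cst_continuous T C). Qed.

Lemma contid (x : C) : @contc C (fun z => z) x.
Proof. by move=> U. Qed.

Lemma cont_eps (f : K -> K) (x : K) : @contc C f x <->
  forall e : R, 0 < e -> exists2 d : R, 0 < d &
    forall y, normc (y - x) < d -> normc (f y - f x) < e.
Proof.
split=> [cf e e0|H U].
  have /cf/nbhs_cplx[d d0 dP] : nbhs (f x : C) [set w : C | normc (w - f x) < e].
    by apply/nbhs_cplx; exists e.
  by exists d.
move=> /nbhs_cplx[e e0 eU]; have [d d0 dP] := H _ e0.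
by apply/nbhs_cplx; exists d => // y /dP; exact: eU.
Qed.

Lemma contT_eps (T : topologicalType) (f : T -> K) (x : T) : contc f x <->
  forall e : R, 0 < e -> \forall y \near x, normc (f y - f x) < e.
Proof.
split=> [cf e e0|H U].
  by apply: (cf [set w : C | normc (w - f x) < e]); apply/nbhs_cplx; exists e.
move=> /nbhs_cplx[e e0 eU]; have := H _ e0.
by apply: filterS => y; exact: eU.
Qed.

Lemma contc_comp (T : topologicalType) (f : T -> K) (g : K -> K) (x : T) :
  contc f x -> @contc C g (f x) -> contc (fun z => g (f z)) x.
Proof.
move=> /contT_eps cf /cont_eps cg; apply/contT_eps => e e0.
have [d d0 dP] := cg _ e0; have := cf _ d0.
by apply: filterS => y; exact: dP.
Qed.

Lemma contc_near (T : topologicalType) (f g : T -> K) (x : T) :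
  (\forall z \near x, f z = g z) -> contc f x -> contc g x.
Proof.
move=> fg /contT_eps cf; apply/contT_eps => e e0.
have <- := nbhs_singleton fg.
by move: fg (cf _ e0); apply: filterS2 => z ->.
Qed.

Lemma cont_normc (T : topologicalType) (f : T -> K) (x : T) : contc f x ->
  {for x, continuous (fun z => normc (f z) : R)}.
Proof.
move=> /contT_eps H; apply/cvgrPdist_lt => e e0.
have := H _ e0; apply: filterS => y; apply: le_lt_trans.
rewrite distrC ler_norml lerBrDl lerBlDl.
have h1 := normcD (f y - f x) (f x); have h2 := normcD (f x - f y) (f y).
move: h1 h2; rewrite !subrK (normcB (f x)) => h1 h2.
by apply/andP; split; lra.
Qed.

Lemma cont_Re (T : topologicalType) (f : T -> K) (x : T) : contc f x ->
  {for x, continuous (fun z => complex.Re (f z) : R)}.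
Proof.
move=> /contT_eps H; apply/cvgrPdist_lt => e e0.
have := H _ e0; apply: filterS => y; apply: le_lt_trans.
rewrite distrC; apply: le_trans (normc_Re _).
by case: (f y) (f x) => [a b] [a' b'].
Qed.

Lemma cont_Im (T : topologicalType) (f : T -> K) (x : T) : contc f x ->
  {for x, continuous (fun z => complex.Im (f z) : R)}.
Proof.
move=> /contT_eps H; apply/cvgrPdist_lt => e e0.
have := H _ e0; apply: filterS => y; apply: le_lt_trans.
rewrite distrC; apply: le_trans (normc_Im _).
by case: (f y) (f x) => [a b] [a' b'].
Qed.

Lemma cont_complex (T : topologicalType) (f g : T -> R) (x : T) :
  {for x, continuous f} -> {for x, continuous g} ->
  contc (fun t => f t +i* g t) x.
Proof.
move=> cf cg; apply/contT_eps => e e0.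
have e20 : 0 < e / 2 by rewrite divr_gt0.
move/cvgrPdist_lt/(_ _ e20) : cf => cf; move/cvgrPdist_lt/(_ _ e20) : cg => cg.
near=> y; rewrite (le_lt_trans (normc_bd _)) //= [e]splitr.
by rewrite ltrD // distrC; near: y.
Unshelve. all: by end_near. Qed.

(* Caratheodory's form of complex differentiability at x. *)
Definition cdiff (f : K -> K) (x : K) :=
  exists2 k : K -> K, @contc C k x & forall z, f z - f x = k z * (z - x).

Lemma cdiff_cont f x : cdiff f x -> @contc C f x.
Proof.
move=> [k ck kE]; rewrite (_ : f = fun z => f x + k z * (z - x)); last first.
  by apply/funext => z; rewrite -kE; ring.
apply: contD; first exact: contcst.
apply: contM; first exact: ck.
by apply: contB; [exact: contid|exact: contcst].
Qed.

Lemma cdiff_cst (c : C) x : cdiff (fun=> c) x.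
Proof. by exists (fun=> 0); [exact: contcst|move=> z; rewrite subrr mul0r]. Qed.

Lemma cdiff_id x : cdiff (fun z => z) x.
Proof. by exists (fun=> 1); [exact: contcst|move=> z; rewrite mul1r]. Qed.

Lemma cdiffD f g x : cdiff f x -> cdiff g x -> cdiff (fun z => f z + g z) x.
Proof.
move=> [k ck kE] [l cl lE]; exists (fun z => k z + l z); first exact: contD.
by move=> z; rewrite mulrDl -kE -lE; ring.
Qed.

Lemma cdiffM f g x : cdiff f x -> cdiff g x -> cdiff (fun z => f z * g z) x.
Proof.
move=> df dg; have := cdiff_cont df.
move: df dg => [k ck kE] [l cl lE] cf.
exists (fun z => k z * g x + f z * l z).
  by apply: contD; apply: contM; [exact: ck|exact: contcst|exact: cf|exact: cl].
by move=> z; rewrite mulrDl mulrAC -kE -mulrA -lE; ring.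
Qed.

Lemma cdiffN f x : cdiff f x -> cdiff (fun z => - f z) x.
Proof.
move=> [k ck kE]; exists (fun z => - k z); first exact: contN.
by move=> z; rewrite mulNr -kE; ring.
Qed.

Lemma cdiffB f g x : cdiff f x -> cdiff g x -> cdiff (fun z => f z - g z) x.
Proof. by move=> df dg; apply: cdiffD; [exact: df|exact: cdiffN]. Qed.

Lemma cdiffX f n x : cdiff f x -> cdiff (fun z => f z ^+ n) x.
Proof.
move=> df; elim: n => [|n IH].
  rewrite (_ : (fun z => _) = fun=> 1); first exact: cdiff_cst.
  by apply/funext => z; rewrite expr0.
rewrite (_ : (fun z => _) = fun z : K => f z * f z ^+ n).
  by apply: cdiffM; [exact: df|exact: IH].
by apply/funext => z; rewrite exprS.
Qed.

Lemma near_neq0 (T : topologicalType) (f : T -> K) x : contc f x -> f x != 0 ->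
  \forall z \near x, f z != 0.
Proof.
move=> /contT_eps cf fx0.
have := cf (normc (f x)); rewrite normc_gt0 => /(_ fx0).
apply: filterS => z; apply: contraTneq => ->.
by rewrite sub0r normcN ltxx.
Qed.

Lemma cdiffV f x : f x != 0 -> cdiff f x -> cdiff (fun z => (f z)^-1) x.
Proof.
move=> fx0 df; have cf := cdiff_cont df; have [k ck kE] := df.
(* Where [f z] is 0 its inverse is 0 by convention and the quotient formula fails; the plain
   difference quotient replaces it there, away from x. *)
exists (fun z => if f z == 0 then ((f z)^-1 - (f x)^-1) / (z - x) else - k z / (f z * f x)).
  have c1 : @contc C (fun z => - k z * (f z * f x)^-1) x.
    apply: contM; first exact: contN.
    apply: contV; first by rewrite mulf_neq0.
    by apply: contM; [exact: cf|exact: contcst].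
  apply: contc_near c1; have := near_neq0 cf fx0; apply: filterS => z.
  by move=> /negbTE->.
move=> z; have [fz0|fz0] := eqVneq (f z) 0.
  have zx : z - x != 0.
    by apply: contra fx0; rewrite subr_eq0 => /eqP<-; rewrite fz0.
  by rewrite divfK.
rewrite mulrAC mulNr -kE; field.
by rewrite fx0 fz0.
Qed.

Lemma cdiffXz f (n : int) x : f x != 0 -> cdiff f x -> cdiff (fun z => f z ^ n) x.
Proof.
move=> fx0 df; case: n => n; first exact: cdiffX.
apply: (@cdiffV (fun z => f z ^+ n.+1)); first by rewrite expf_neq0.
exact: cdiffX.
Qed.

Lemma cdiff_comp f g x : cdiff f x -> cdiff g (f x) -> cdiff (fun z => g (f z)) x.
Proof.
move=> df; have := cdiff_cont df; move: df => [k ck kE] cf [l cl lE].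
exists (fun z => l (f z) * k z).
  by apply: contM; [exact: contc_comp cf cl|exact: ck].
by move=> z; rewrite lE kE mulrA.
Qed.

Lemma cdiff_poly (p : {poly R[i]}) x : cdiff (fun z : K => p.[z]) x.
Proof.
elim/poly_ind: p => [|p c IH].
  rewrite (_ : (fun z => _) = fun=> 0); first exact: cdiff_cst.
  by apply/funext => z; rewrite horner0.
rewrite (_ : (fun z => _) = fun z : K => p.[z] * z + c).
  by apply: cdiffD; [apply: cdiffM; [exact: IH|exact: cdiff_id]|exact: cdiff_cst].
by apply/funext => z; rewrite hornerMXaddC.
Qed.

Lemma cdiff_prod (I : Type) (s : seq I) (f : I -> K -> K) x :
  (forall i, cdiff (f i) x) -> cdiff (fun z => \prod_(i <- s) f i z) x.
Proof.
move=> df; elim: s => [|i s IH].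
  rewrite (_ : (fun z => _) = fun=> 1); first exact: cdiff_cst.
  by apply/funext => z; rewrite big_nil.
rewrite (_ : (fun z => _) = fun z : K => f i z * \prod_(i <- s) f i z).
  by apply: cdiffM; [exact: df|exact: IH].
by apply/funext => z; rewrite big_cons.
Qed.

(** The slope equation is required at every z, so wherever the two functions differ the slope is
    replaced by the difference quotient of [g]. *)
Lemma cdiff_near f g x : (\forall z \near (x : C), f z = g z) -> cdiff f x -> cdiff g x.
Proof.
move=> fg [k ck kE]; have fgx := nbhs_singleton fg.
exists (fun z => if f z == g z then k z else (g z - g x) / (z - x)).
  by apply: contc_near ck; move: fg; apply: filterS => z /eqP->.
move=> z; have [fgz|fgz] := eqVneq (f z) (g z); first by rewrite -fgz -fgx kE.
have zx : z - x != 0 by rewrite subr_eq0; apply: contra fgz => /eqP->; rewrite fgx.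
by rewrite divfK.
Qed.

(** The increment of [derivable] runs through the scalars [R[i]], so direction 1 already means a
    complex derivative. *)
Lemma derivable_cdiff (f : C -> C) (x : C) : derivable f x 1 -> cdiff f x.
Proof.
move=> /cvg_ex[l /= H].
exists (fun z => if z == x then l else (f z - f x) / (z - x)); last first.
  move=> z; have [->|zx] := eqVneq z x; first by rewrite !subrr mulr0.
  by rewrite divfK // subr_eq0.
apply/cont_eps => e e0; rewrite eqxx.
have /H : nbhs (l : C) [set w : C | normc (w - l) < e] by apply/nbhs_cplx; exists e.
move=> /nbhs_cplx[d d0 dP]; exists d => // y yx.
have [_|yx0] := eqVneq y x; first by rewrite subrr ComplexField.Normc.normc0.
have := dP (y - x); rewrite subr0 => /(_ yx); rewrite subr_eq0 => /(_ yx0) /=.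
by rewrite /GRing.scale /= mulr1 subrK mulrC.
Qed.
End ComplexPlane.

(** * Goursat's theorem on squares *)

Section Goursat.
Variable R : realType.
Local Notation C := (cplx R).
Local Notation K := R[i].
Local Notation normc := ComplexField.Normc.normc.

(* Path integrals are replaced by trapezoid sums over 2^N equal pieces: Goursat's
   bisection only needs that they are additive and exact on affine functions. *)
Fixpoint trap (N : nat) (f : K -> K) (a b : K) : K :=
  if N is N'.+1 then
    trap N' f a ((a + b) / 2) + trap N' f ((a + b) / 2) b
  else (f a + f b) / 2 * (b - a).

Lemma trap_anti N f a b : trap N f b a = - trap N f a b.
Proof.
elim: N a b => [|N IH] a b /=; first by ring.
by rewrite IH [X in _ + X]IH [b + a]addrC; ring.
Qed.

Lemma trapD N f g a b : trap N (fun z => f z + g z) a b = trap N f a b + trap N g a b.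
Proof. by elim: N a b => [|N IH] a b /=; [field|rewrite !IH; ring]. Qed.

Lemma trapZ N c f a b : trap N (fun z => c * f z) a b = c * trap N f a b.
Proof. by elim: N a b => [|N IH] a b /=; [field|rewrite !IH; ring]. Qed.

Lemma trap_affine N c d a b :
  trap N (fun z => c + d * z) a b = c * (b - a) + d * (b ^+ 2 - a ^+ 2) / 2.
Proof. by elim: N a b => [|N IH] a b /=; [field|rewrite !IH; field]. Qed.

Lemma trap_le N f a b B :
  (forall t : R, 0 <= t <= 1 -> normc (f (a + t%:C * (b - a))) <= B) ->
  normc (trap N f a b) <= B * normc (b - a).
Proof.
elim: N a b => [|N IH] a b /= H.
  rewrite normcMM ler_wpM2r ?normc_ge0 // normcMM normcVV.
  have -> : normc (2 : K) = 2.
    by rewrite (_ : 2 = (2 : R)%:C) ?normc_real ?ger0_norm // rmorph_nat.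
  rewrite ler_pdivrMr // (le_trans (normcD _ _)) // mulr_natr mulr2n lerD //.
    by have := H 0; rewrite lexx ler01 mul0r addr0; apply.
  by have := H 1; rewrite lexx ler01 mul1r [a + _]addrC subrK; apply.
have -> : B * normc (b - a) = B * normc ((a + b) / 2 - a) + B * normc (b - (a + b) / 2).
  have -> : (a + b) / 2 - a = (2^-1)%:C * (b - a) by rewrite fmorphV rmorph_nat; field.
  have -> : b - (a + b) / 2 = (2^-1)%:C * (b - a) by rewrite fmorphV rmorph_nat; field.
  by rewrite normcMM normc_real ger0_norm ?invr_ge0 //; field.
rewrite (le_trans (normcD _ _)) // lerD //; apply: IH => t /andP[t0 t1].
  rewrite (_ : _ + _ = a + (t / 2)%:C * (b - a)); first by apply: H; apply/andP; split; lra.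
  by rewrite rmorphM fmorphV rmorph_nat; field.
rewrite (_ : _ + _ = a + ((1 + t) / 2)%:C * (b - a)); first by apply: H; apply/andP; split; lra.
by rewrite rmorphM rmorphD rmorph1 fmorphV rmorph_nat; field.
Qed.

(** * Sums around squares *)

Definition quad N f (a b c d : K) : K :=
  trap N f a b + trap N f b c + trap N f c d + trap N f d a.

Definition pt (z : K) (a b : R) : K := z + a%:C + 'i * b%:C.

Definition squ N f z s := quad N f (pt z 0 0) (pt z s 0) (pt z s s) (pt z 0 s).

Lemma pt_pt z a b c d : pt (pt z a b) c d = pt z (a + c) (b + d).
Proof. by rewrite /pt !rmorphD; ring. Qed.

Lemma pt00 z : pt z 0 0 = z.
Proof. by rewrite /pt rmorph0; ring. Qed.

Lemma pt_mid z a b c d : (pt z a b + pt z c d) / 2 = pt z ((a + c) / 2) ((b + d) / 2).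
Proof. by rewrite /pt !rmorphM !rmorphD fmorphV rmorph_nat; field. Qed.

(** One unit of [N] pays for one bisection: the halves of the outer sides fit the subdivision
    exactly, and the inner sides cancel by [trap_anti]. *)
Lemma squ_split N f z s : squ N.+1 f z (s + s) =
  squ N f z s + squ N f (pt z s 0) s + squ N f (pt z 0 s) s + squ N f (pt z s s) s.
Proof.
rewrite /squ /quad /= !pt_pt !pt_mid.
rewrite !addr0 !add0r mul0r.
have -> : (s + s) / 2 = s by field.
have -> : (s + s + (s + s)) / 2 = s + s by field.
rewrite (trap_anti N f (pt z s 0) (pt z s s)) (trap_anti N f (pt z 0 s) (pt z s s)).
rewrite (trap_anti N f (pt z s s) (pt z s (s + s))).
rewrite (trap_anti N f (pt z s s) (pt z (s + s) s)).
by ring.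
Qed.

Lemma squD N f g z s : squ N (fun w => f w + g w) z s = squ N f z s + squ N g z s.
Proof. by rewrite /squ /quad !trapD; ring. Qed.

Lemma squZ N c f z s : squ N (fun w => c * f w) z s = c * squ N f z s.
Proof. by rewrite /squ /quad !trapZ; ring. Qed.

Lemma squ_affine N c d z s : squ N (fun w => c + d * w) z s = 0.
Proof. by rewrite /squ /quad !trap_affine; field. Qed.

(* Sup norm: its balls are the squares with sides parallel to the axes. *)
Definition qn (z : K) : R := Num.max `|complex.Re z| `|complex.Im z|.

Lemma qn_le_normc z : qn z <= normc z.
Proof. by rewrite /qn ge_max normc_Re normc_Im. Qed.

Lemma normc_le_qn z : normc z <= 2 * qn z.
Proof.
rewrite (le_trans (normc_bd _)) // mulr_natl mulr2n lerD // /qn le_max lexx ?orbT //.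
Qed.

Lemma Re_pt z a b : complex.Re (pt z a b) = complex.Re z + a.
Proof. by case: z => x y /=; ring. Qed.

Lemma Im_pt z a b : complex.Im (pt z a b) = complex.Im z + b.
Proof. by case: z => x y /=; ring. Qed.

Lemma ReB (z w : K) : complex.Re (z - w) = complex.Re z - complex.Re w.
Proof. by case: z w => [a b] [c d]. Qed.

Lemma ImB (z w : K) : complex.Im (z - w) = complex.Im z - complex.Im w.
Proof. by case: z w => [a b] [c d]. Qed.

Lemma complex_ext (z w : K) : complex.Re z = complex.Re w ->
  complex.Im z = complex.Im w -> z = w.
Proof. by case: z w => [a b] [c d] /= -> ->. Qed.

(* The boundary of the square with lower left corner z and side s, seen from
   its center. *)
Lemma squ_le N f z s B : 0 <= s ->
  (forall w, qn (w - pt z (s / 2) (s / 2)) = s / 2 -> normc (f w) <= B) ->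
  normc (squ N f z s) <= 4 * s * B.
Proof.
move=> s0 H; rewrite /squ /quad.
have side a b c d : `|a - c| + `|b - d| = s ->
   (forall t : R, 0 <= t <= 1 -> qn (pt z a b + t%:C * (pt z c d - pt z a b) - pt z (s / 2) (s / 2)) = s / 2) ->
   normc (trap N f (pt z a b) (pt z c d)) <= s * B.
  move=> abcd Hq.
  have B0 : 0 <= B.
    by apply: le_trans (H (pt z a b) _); [exact: normc_ge0|have := Hq 0; rewrite lexx ler01 mul0r addr0 => ->].
  apply: le_trans (trap_le _ (B := B) _) _ => [t t01|]; first by apply: H; exact: Hq.
  rewrite mulrC ler_wpM2r //; apply: le_trans (normc_bd _) _.
  rewrite ReB ImB !Re_pt !Im_pt.
  rewrite (_ : complex.Re z + c - _ = c - a); last by ring.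
  rewrite (_ : complex.Im z + d - _ = d - b); last by ring.
  by rewrite distrC [`|d - b|]distrC abcd.
have qnE (t : R) a b c d : qn (pt z a b + t%:C * (pt z c d - pt z a b) - pt z (s / 2) (s / 2)) =
   Num.max `|a - s / 2 + t * (c - a)| `|b - s / 2 + t * (d - b)|.
  by rewrite /qn; congr Order.max; congr Num.norm; case: z {H side} => x y /=; ring.
have nn : forall x : R, 0 <= x -> `|x| = x by move=> x; exact: ger0_norm.
have mx1 (x y : R) : `|x| = s / 2 -> `|y| <= s / 2 -> Num.max `|x| `|y| = s / 2.
  by move=> -> ?; apply/max_idPl.
have mx2 (x y : R) : `|x| <= s / 2 -> `|y| = s / 2 -> Num.max `|x| `|y| = s / 2.
  by move=> ? ->; apply/max_idPr.
have e1 : `|s| = s by exact: nn.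
have e2 : `|s / 2| = s / 2 by rewrite nn // divr_ge0.
have b (t : R) : 0 <= t <= 1 -> `|- (s / 2) + t * s| <= s / 2.
  by move=> /andP[t0 t1]; rewrite ler_norml; apply/andP; split; nra.
have b' (t : R) : 0 <= t <= 1 -> `|s / 2 - t * s| <= s / 2.
  by move=> /andP[t0 t1]; rewrite ler_norml; apply/andP; split; nra.
have -> : 4 * s * B = s * B + s * B + s * B + s * B by ring.
apply: le_trans (normcD _ _) _; apply: lerD.
  apply: le_trans (normcD _ _) _; apply: lerD.
    apply: le_trans (normcD _ _) _; apply: lerD.
      apply: side => [|t t01]; first by rewrite !sub0r normrN e1 oppr0 normr0 addr0.
      rewrite qnE; apply: mx2; first by rewrite sub0r subr0; exact: b.
      by rewrite sub0r subr0 mulr0 addr0 normrN.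
    apply: side => [|t t01]; first by rewrite subrr sub0r normrN e1 normr0 add0r.
    rewrite qnE; apply: mx1; last by rewrite sub0r subr0; exact: b.
    by rewrite subrr mulr0 addr0 (_ : s - s / 2 = s / 2) //; field.
  apply: side => [|t t01]; first by rewrite subrr subr0 e1 normr0 addr0.
  rewrite qnE; apply: mx2.
    by rewrite sub0r mulrN (_ : s - s / 2 = s / 2); [exact: b'|field].
  by rewrite subrr mulr0 addr0 (_ : s - s / 2 = s / 2) //; field.
apply: side => [|t t01]; first by rewrite subrr subr0 e1 normr0 add0r.
rewrite qnE; apply: mx1.
  by rewrite sub0r subr0 mulr0 addr0 normrN.
by rewrite sub0r mulrN (_ : s - s / 2 = s / 2); [exact: b'|field].
Qed.

Lemma nested_intervals (a s : nat -> R) : (forall k, 0 <= s k) ->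
  (forall k, a k <= a k.+1 /\ a k.+1 + s k.+1 <= a k + s k) ->
  exists x, forall k, a k <= x <= a k + s k.
Proof.
move=> s0 H.
have ai m n : (m <= n)%N -> a m <= a n /\ a n + s n <= a m + s m.
  move=> /subnK <-; elim: (n - m)%N => [|k [I1 I2]]; first by rewrite add0n.
  by have [H1 H2] := H (k + m)%N; split; [exact: le_trans H1|exact: le_trans I2].
have ub m n : a m <= a n + s n.
  have [mn|/ltnW nm] := leqP m n.
    by have [h _] := ai _ _ mn; rewrite (le_trans h) // lerDl.
  by have [_ h] := ai _ _ nm; rewrite (le_trans _ h) // lerDl.
have hs : has_sup (range a).
  by split; [exists (a 0%N); exists 0%N|exists (a 0%N + s 0%N) => _ [m _ <-]].
exists (sup (range a)) => k; apply/andP; split.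
  by apply: (sup_upper_bound hs); exists k.
by apply: ge_sup; [by case: hs|move=> _ [m _ <-]].
Qed.

Definition insq (z : K) (s : R) (w : K) :=
  complex.Re z <= complex.Re w <= complex.Re z + s /\
  complex.Im z <= complex.Im w <= complex.Im z + s.

Lemma insq_center z s w : insq z s w <-> qn (w - pt z (s / 2) (s / 2)) <= s / 2.
Proof.
rewrite /insq /qn ReB ImB Re_pt Im_pt ge_max !ler_norml.
split=> [[/andP[? ?] /andP[? ?]]|/andP[/andP[? ?] /andP[? ?]]].
  by apply/andP; split; apply/andP; split; lra.
by split; apply/andP; split; lra.
Qed.

(** Stands in for a bound on the contour integral: the sums are bounded for all fine enough
    subdivisions, without asking that they converge. *)
Definition vanishes (f : K -> K) (z : K) (s : R) (B : R) :=
  exists N0, forall N, (N0 <= N)%N -> normc (squ N f z s) <= B.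

Lemma vanishes_split f z s B1 B2 B3 B4 :
  vanishes f z s B1 -> vanishes f (pt z s 0) s B2 ->
  vanishes f (pt z 0 s) s B3 -> vanishes f (pt z s s) s B4 ->
  vanishes f z (s + s) (B1 + B2 + B3 + B4).
Proof.
move=> [n1 h1] [n2 h2] [n3 h3] [n4 h4].
exists (n1 + n2 + n3 + n4).+1 => -[//|N] nN; rewrite squ_split.
apply: le_trans (normcD _ _) _; apply: lerD; last by apply: h4; lia.
apply: le_trans (normcD _ _) _; apply: lerD; last by apply: h3; lia.
apply: le_trans (normcD _ _) _; apply: lerD; last by apply: h2; lia.
by apply: h1; lia.
Qed.

(* A function that is differentiable at x is affine up to e * |z - x|, and
   squ vanishes on affine functions. *)
Lemma vanishes_local f x e : 0 < e -> cdiff f x -> exists2 d, 0 < d &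
  forall z s, 0 <= s < d -> insq z s x -> vanishes f z s (e * s ^+ 2).
Proof.
move=> e0 [k /cont_eps ck kE].
(* On the square |w - x| <= 2 s, so [squ_le] yields 4 s (e / 8) (2 s) = e s^2. *)
have e80 : 0 < e / 8 by rewrite divr_gt0.
have [d d0 dP] := ck _ e80.
exists (d / 2); first by rewrite divr_gt0.
move=> z s /andP[s0 sd] zsx; exists 0%N => N _.
have -> : squ N f z s = squ N (fun w => (k w - k x) * (w - x)) z s.
  rewrite (_ : f = fun w => (f x - k x * x + k x * w) + (k w - k x) * (w - x)).
    by rewrite squD squ_affine add0r.
  by apply/funext => w; rewrite mulrBl -kE; ring.
apply: le_trans (squ_le (B := e / 8 * (2 * s)) _ s0 _) _; last by rewrite expr2; nra.
move=> w wq; have /insq_center wz : qn (w - pt z (s / 2) (s / 2)) <= s / 2 by rewrite wq.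
have wx : normc (w - x) <= 2 * s.
  apply: le_trans (normc_le_qn _) _; rewrite ler_pM2l // /qn ReB ImB ge_max !ler_norml.
  case: wz => /andP[? ?] /andP[? ?]; case: zsx => /andP[? ?] /andP[? ?].
  by apply/andP; split; apply/andP; split; lra.
rewrite normcMM ler_pM ?normc_ge0 //; apply/ltW/dP/(le_lt_trans wx); lra.
Qed.

(** An error of the form e s^2 is additive over the four quarters, so a bad square has a bad
    quarter; the nested squares shrink to a point that contradicts [vanishes_local]. *)
Lemma goursat f z s : 0 < s -> (forall w, insq z s w -> cdiff f w) ->
  forall e, 0 < e -> vanishes f z s e.
Proof.
move=> s0 df e1 e10; pose e := e1 / s ^+ 2.
have e0 : 0 < e by rewrite divr_gt0 // exprn_gt0.
rewrite (_ : e1 = e * s ^+ 2); last by rewrite /e divfK // gt_eqF // exprn_gt0.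
apply: contrapT => bad0.
(* The disjunct [p.2 < 0] makes the step total, so that [choice] yields a function to iterate; along
   the sequence it is excluded. *)
have step p : exists q, ~ vanishes f p.1 p.2 (e * p.2 ^+ 2) ->
    [/\ ~ vanishes f q.1 q.2 (e * q.2 ^+ 2), q.2 = p.2 / 2 &
     complex.Re p.1 <= complex.Re q.1 /\ complex.Re q.1 + q.2 <= complex.Re p.1 + p.2 /\
     complex.Im p.1 <= complex.Im q.1 /\ complex.Im q.1 + q.2 <= complex.Im p.1 + p.2] \/ p.2 < 0.
  case: p => w t /=; have [t0|t0] := ltP t 0; first by exists (w, t); right.
  apply: contrapT => H.
  have good q : q = w \/ q = pt w (t / 2) 0 \/ q = pt w 0 (t / 2) \/ q = pt w (t / 2) (t / 2) ->
      vanishes f q (t / 2) (e * (t / 2) ^+ 2).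
    move=> qE; apply: contrapT => badq; apply: H; exists (q, t / 2) => bw; left; split => //=.
    by case: qE => [|[|[|]]] ->; rewrite ?Re_pt ?Im_pt; split; [|split; [|split]| |split; [|split]| |split; [|split]| |split; [|split]]; lra.
  apply: H; exists (w, t) => bw; exfalso; apply: bw.
  have := @vanishes_split f w (t / 2) _ _ _ _ (good w _) (good (pt w (t / 2) 0) _) (good (pt w 0 (t / 2)) _) (good (pt w (t / 2) (t / 2)) _).
  rewrite (_ : t / 2 + t / 2 = t); last by field.
  rewrite (_ : _ + _ + _ + _ = e * t ^+ 2); last by field.
  by apply; tauto.
have [F FP] := choice step.
pose p k := iter k F (z, s).
have pP k : ~ vanishes f (p k).1 (p k).2 (e * (p k).2 ^+ 2) /\ (p k).2 = s / 2 ^+ k.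
  elim: k => [|k [IH1 IH2]]; first by rewrite /p /= expr0 divr1.
  have := FP _ IH1; rewrite -/(p k.+1) => -[[h1 h2 _]|]; last first.
    by rewrite IH2 ltNge divr_ge0 ?ltW // exprn_gt0.
  split; first exact: h1.
  by rewrite h2 IH2 exprSr invfM mulrA.
have p0 k : 0 <= (p k).2 by have [_ ->] := pP k; rewrite divr_ge0 ?ltW // exprn_gt0.
have pS k : complex.Re (p k).1 <= complex.Re (p k.+1).1 /\ complex.Re (p k.+1).1 + (p k.+1).2 <= complex.Re (p k).1 + (p k).2 /\
     complex.Im (p k).1 <= complex.Im (p k.+1).1 /\ complex.Im (p k.+1).1 + (p k.+1).2 <= complex.Im (p k).1 + (p k).2.
  have [h1 h2] := pP k; have := FP _ h1; rewrite -/(p k.+1) => -[[_ _ h]|]; first exact: h.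
  by move/lt_geF; rewrite p0.
have [a aP] := @nested_intervals (fun k => complex.Re (p k).1) (fun k => (p k).2) p0 (fun k => conj (pS k).1 (pS k).2.1).
have [b bP] := @nested_intervals (fun k => complex.Im (p k).1) (fun k => (p k).2) p0 (fun k => (pS k).2.2).
have xin k : insq (p k).1 (p k).2 (a +i* b) by split; [exact: aP|exact: bP].
have [d d0 dP] := vanishes_local e0 (df _ (xin 0%N)).
have [k kP] : exists k : nat, s / d < k%:R.
  by exists (Num.bound (s / d)); apply: archi_boundP; rewrite divr_ge0 // ltW.
have [bad pk] := pP k; apply: bad; apply: dP; last exact: xin.
rewrite p0 pk ltr_pdivrMr ?exprn_gt0 //.
move: kP; rewrite ltr_pdivrMr // => /lt_le_trans; apply; rewrite mulrC ler_pM2l //.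
by rewrite -natrX ler_nat ltnW // ltn_expl.
Qed.

Lemma trap_sub N f x a b : trap N (fun z => f (z - x)) (x + a) (x + b) = trap N f a b.
Proof.
elim: N a b => [|N IH] a b /=.
  by rewrite ![x + _]addrC !addrK; ring.
rewrite (_ : (x + a + (x + b)) / 2 = x + (a + b) / 2); last by field.
by rewrite !IH.
Qed.

(** Invariance of dz / z under multiplication; it carries the four sides of a centred square to a
    single one. *)
Lemma trap_invM N u a b : u != 0 -> trap N GRing.inv (u * a) (u * b) = trap N (@GRing.inv K) a b.
Proof.
move=> u0; elim: N a b => [|N IH] a b /=.
  rewrite !invfM; move: a^-1 b^-1 => x y; field.
  exact: u0.
rewrite (_ : (u * a + u * b) / 2 = u * ((a + b) / 2)); last by field.
by rewrite !IH.
Qed.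

(** On the line with real part r, Im (dz / z) = r / (r^2 + t^2) dt, which is at least dt / (2 r) for
    |t| <= r. *)
Lemma trap_inv_ge N (r a b : R) : 0 < r -> - r <= a -> a <= b -> b <= r ->
  (b - a) / (2 * r) <= complex.Im (trap N GRing.inv (r +i* a) (r +i* b)).
Proof.
move=> r0; elim: N a b => [|N IH] a b ra ab br /=.
  have h (t : R) : - r <= t -> t <= r -> (2 * r)^-1 <= r / (r ^+ 2 + t ^+ 2).
    move=> h1 h2; have : 0 < r ^+ 2 + t ^+ 2 by rewrite ltr_pwDl ?exprn_gt0 ?sqr_ge0.
    move=> h3; rewrite ler_pdivlMr // mulrC ler_pdivrMr ?mulr_gt0 // !expr2; nra.
  have h1 := h a ra (le_trans ab br); have h2 := h b (le_trans ra ab) br.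
  have ba : 0 <= b - a by rewrite subr_ge0.
  move: h1 h2; move: (r / (r ^+ 2 + a ^+ 2)) (r / (r ^+ 2 + b ^+ 2)) => A B h1 h2.
  move: (a / _) (b / _) => A' B'; set X := (X in _ <= X).
  have -> : X = (A + B) / 2 * (b - a) by rewrite /X; field.
  rewrite [leLHS]mulrC ler_wpM2r // ler_pdivlMr //.
  by apply: le_trans (lerD h1 h2); rewrite mulr_natr mulr2n.
have -> : ((r +i* a) + (r +i* b)) / 2 = r +i* ((a + b) / 2) :> K.
  apply: (@mulIf K 2); first by rewrite pnatr_eq0.
  rewrite divfK ?pnatr_eq0 // mulr_natr mulr2n.
  by apply: complex_ext => /=; field.
have -> : (b - a) / (2 * r) = ((a + b) / 2 - a) / (2 * r) + (b - (a + b) / 2) / (2 * r).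
  by field; rewrite gt_eqF.
have imD (z w : K) : complex.Im (z + w) = complex.Im z + complex.Im w by case: z w => [??] [??].
by rewrite imD; apply: lerD; apply: IH; lra.
Qed.

(** Substitute for the value 2 pi i of the integral of 1 / (z - x): each side contributes an
    imaginary part of at least 1. *)
Lemma squ_inv_ge N x r : 0 < r ->
  4 <= normc (squ N (fun z => (z - x)^-1) (pt x (- r) (- r)) (r + r)).
Proof.
move=> r0; set S := squ _ _ _ _.
pose T := trap N GRing.inv (r +i* (- r)) (r +i* r).
suff -> : S = 4 * T.
  have T1 := @trap_inv_ge N r (- r) r r0 (lexx _) (ltac:(lra)) (lexx _).
  apply: le_trans (normc_Im _); apply: le_trans (ler_norm _).
  rewrite (_ : complex.Im (4 * T) = 4 * complex.Im T).
    have : (r - - r) / (2 * r) = 1 by field; rewrite gt_eqF.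
    by move: T1; rewrite -/T => T1 h; rewrite h in T1; lra.
  by rewrite (_ : 4 = (4 : R)%:C) ?rmorph_nat //; case: (T) => u v /=; ring.
have ptE z a b : pt z a b = z + (a +i* b) by rewrite /pt; apply: complex_ext; case: z => ? ? /=; ring.
rewrite /S /squ /quad !pt_pt !ptE !(@trap_sub N GRing.inv).
have i0 : 'i != 0 :> K by rewrite eq_complex /= oner_eq0 andbF.
have i1 : (- 'i) != 0 :> K by rewrite oppr_eq0.
have i2 : -1 != 0 :> K by rewrite oppr_eq0 oner_eq0.
rewrite (_ : - r + 0 = - r) ?addr0 // (_ : - r + (r + r) = r); last by ring.
have -> : trap N GRing.inv (r +i* r) ((- r) +i* r) = T.
  rewrite /T -[LHS](@trap_invM N (- 'i) _ _ i1).
  by congr trap; apply: complex_ext => /=; ring.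
have -> : trap N GRing.inv ((- r) +i* r) ((- r) +i* (- r)) = T.
  rewrite /T -[LHS](@trap_invM N (-1) _ _ i2).
  by congr trap; apply: complex_ext => /=; ring.
have -> : trap N GRing.inv ((- r) +i* (- r)) (r +i* (- r)) = T.
  rewrite /T -[LHS](@trap_invM N ('i) _ _ i0).
  by congr trap; apply: complex_ext => /=; ring.
by rewrite -/T; ring.
Qed.

Lemma vanishes_le f z s B B' : B <= B' -> vanishes f z s B -> vanishes f z s B'.
Proof. by move=> BB' [N0 H]; exists N0 => N /H h; exact: le_trans BB'. Qed.

(* The twelve outer squares of a 4x4 subdivision do not contribute. *)
Lemma vanishes_ring f x h B e : 0 < h -> 0 < e ->
  (forall w, qn (w - x) <= h + h -> w != x -> cdiff f w) ->
  vanishes f (pt x (- h) (- h)) (h + h) B ->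
  vanishes f (pt x (- (h + h)) (- (h + h))) ((h + h) + (h + h)) (B + e).
Proof.
move=> h0 e0 df [N0 HB].
have G i j : - (h + h) <= i <= h -> - (h + h) <= j <= h ->
   [|| i == - (h + h), j == - (h + h), i == h | j == h] ->
   vanishes f (pt x i j) h (e / 12).
  move=> /andP[i1 i2] /andP[j1 j2] ij; apply: goursat => //; last by rewrite divr_gt0.
  move=> w [/andP[]]; rewrite Re_pt Im_pt => a1 a2 /andP[a3 a4]; apply: df.
    by rewrite /qn ReB ImB ge_max !ler_norml; apply/andP; split; apply/andP; split; lra.
  by apply/eqP => wx; subst w; case/or4P: ij => /eqP ?; lra.
pose m := - (h + h); have m1 : m <= m <= h by rewrite /m; apply/andP; split; lra.
have m2 : m <= - h <= h by rewrite /m; apply/andP; split; lra.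
have m3 : m <= 0 <= h by rewrite /m; apply/andP; split; lra.
have m4 : m <= h <= h by rewrite /m; apply/andP; split; lra.
have [n1 g1] := G m m m1 m1 (ltac:(by rewrite eqxx ?orbT)).
have [n2 g2] := G (-h) m m2 m1 (ltac:(by rewrite eqxx ?orbT)).
have [n3 g3] := G 0 m m3 m1 (ltac:(by rewrite eqxx ?orbT)).
have [n4 g4] := G h m m4 m1 (ltac:(by rewrite eqxx ?orbT)).
have [n5 g5] := G m (-h) m1 m2 (ltac:(by rewrite eqxx ?orbT)).
have [n6 g6] := G h (-h) m4 m2 (ltac:(by rewrite eqxx ?orbT)).
have [n7 g7] := G m 0 m1 m3 (ltac:(by rewrite eqxx ?orbT)).
have [n8 g8] := G h 0 m4 m3 (ltac:(by rewrite eqxx ?orbT)).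
have [n9 g9] := G m h m1 m4 (ltac:(by rewrite eqxx ?orbT)).
have [n10 g10] := G (-h) h m2 m4 (ltac:(by rewrite eqxx ?orbT)).
have [n11 g11] := G 0 h m3 m4 (ltac:(by rewrite eqxx ?orbT)).
have [n12 g12] := G h h m4 m4 (ltac:(by rewrite eqxx ?orbT)).
exists (N0 + (n1 + n2 + n3 + n4 + n5 + n6 + n7 + n8 + n9 + n10 + n11 + n12)).+2.
move=> -[//|[//|N]] nN.
have HN : (N0 + (n1 + n2 + n3 + n4 + n5 + n6 + n7 + n8 + n9 + n10 + n11 + n12) <= N)%N by [].
have := HB N.+1 (ltac:(clear -HN; lia)); rewrite -/m.
have a1 : m + h = - h by rewrite /m; lra.
have a2 : m + (h + h) = 0 by rewrite /m; lra.
have a3 : - h + h = 0 by lra.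
rewrite !squ_split !pt_pt ?addr0 ?add0r ?a2 ?a1 ?add0r ?addr0 ?a3 ?add0r ?a1 ?a3.
move: (g1 N (ltac:(clear -HN; lia))) (g2 N (ltac:(clear -HN; lia))) (g3 N (ltac:(clear -HN; lia))) (g4 N (ltac:(clear -HN; lia))).
move: (g5 N (ltac:(clear -HN; lia))) (g6 N (ltac:(clear -HN; lia))) (g7 N (ltac:(clear -HN; lia))) (g8 N (ltac:(clear -HN; lia))).
move: (g9 N (ltac:(clear -HN; lia))) (g10 N (ltac:(clear -HN; lia))) (g11 N (ltac:(clear -HN; lia))) (g12 N (ltac:(clear -HN; lia))).
set b1 := squ _ _ (pt x m h) _; set b2 := squ _ _ (pt x (- h) h) _.
set b3 := squ _ _ (pt x 0 h) _; set b4 := squ _ _ (pt x h h) _.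
set b5 := squ _ _ (pt x m (-h)) _; set b6 := squ _ _ (pt x h (- h)) _.
set b7 := squ _ _ (pt x m 0) _; set b8 := squ _ _ (pt x h 0) _.
set b9 := squ _ _ (pt x m m) _; set b10 := squ _ _ (pt x (- h) m) _.
set b11 := squ _ _ (pt x 0 m) _; set b12 := squ _ _ (pt x h m) _.
set c := (X in normc X <= B) => l1 l2 l3 l4 l5 l6 l7 l8 l9 l10 l11 l12 lc.
set S := (X in normc X <= _).
have -> : S = c + b1 + b2 + b3 + b4 + b5 + b6 + b7 + b8 + b9 + b10 + b11 + b12 by rewrite /S /c; ring.
have -> : B + e = B + e / 12 + e / 12 + e / 12 + e / 12 + e / 12 + e / 12 + e / 12 + e / 12 + e / 12 + e / 12 + e / 12 + e / 12 by field.
by do 12 (apply: le_trans (normcD _ _) _; apply: lerD; last by []).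
Qed.

(* Discrete Cauchy formula for (F - F x) / (z - x) on a square centered at x. *)
Lemma square_bound2 (F : K -> K) (x : K) (r B : R) : 0 < r -> @contc R C F x ->
  (forall w, qn (w - x) <= r -> w != x -> cdiff F w) ->
  (forall w, qn (w - x) = r -> normc (F w) <= B) -> normc (F x) <= 2 * B.
Proof.
move=> r0 cF dF HB; pose g w := (F w - F x) / (w - x).
have dg w : qn (w - x) <= r -> w != x -> cdiff g w.
  move=> wr wx; apply: cdiffM.
    by apply: cdiffB; [exact: dF|exact: cdiff_cst].
  apply: (@cdiffV _ (fun w => w - x)); first by rewrite subr_eq0.
  by apply: cdiffB; [exact: cdiff_id|exact: cdiff_cst].
(* At x only continuity of F is known. On a square of half side t, |F - F x| <= e / 8 bounds g by (e
   / 8) / t, and the perimeter is 8 t. *)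
have small e : 0 < e -> exists k : nat,
    vanishes g (pt x (- (r / 2 ^+ k)) (- (r / 2 ^+ k))) (r / 2 ^+ k + r / 2 ^+ k) e.
  move=> e0; have e80 : 0 < e / 8 by rewrite divr_gt0.
  have [d d0 dP] := (cont_eps F x).1 cF _ e80.
  have [k kP] : exists k : nat, 2 * r / d < k%:R.
    by exists (Num.bound (2 * r / d)); apply: archi_boundP; rewrite divr_ge0 ?mulr_ge0 // ltW.
  have k20 : 0 < 2 ^+ k :> R by rewrite exprn_gt0.
  exists k; set t := r / 2 ^+ k; have t0 : 0 < t by rewrite divr_gt0.
  have td : 2 * t < d.
    rewrite /t mulrA ltr_pdivrMr // [d * _]mulrC -ltr_pdivrMr //.
    by apply: (lt_le_trans kP); rewrite -natrX ler_nat ltnW // ltn_expl.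
  exists 0%N => N _; apply: le_trans (squ_le (B := e / 8 / t) _ _ _) _.
  - by rewrite addr_ge0 // ltW.
  - rewrite pt_pt (_ : - t + (t + t) / 2 = 0); last by field.
    rewrite (_ : (t + t) / 2 = t); last by field.
    move=> w; rewrite pt00 => wt.
    have wn : t <= normc (w - x) by rewrite -wt qn_le_normc.
    rewrite /g normcMM normcVV ler_pM ?invr_ge0 ?normc_ge0 //.
      apply/ltW/dP; apply: le_lt_trans (normc_le_qn _) _; by rewrite wt.
    by rewrite lef_pV2 // posrE // (lt_le_trans t0).
  - rewrite le_eqVlt; apply/orP; left; apply/eqP; field.
    by rewrite gt_eqF.
(* The small square is doubled k times, up to half side r; each ring costs e / (k + 1), together at
   most e. *)
have van e : 0 < e -> vanishes g (pt x (- r) (- r)) (r + r) (e + e).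
  move=> e0; have [k] := small _ e0.
  suff: forall j, (j <= k)%N -> vanishes g (pt x (- (r / 2 ^+ k)) (- (r / 2 ^+ k))) (r / 2 ^+ k + r / 2 ^+ k) e ->
     vanishes g (pt x (- (r / 2 ^+ (k - j))) (- (r / 2 ^+ (k - j)))) (r / 2 ^+ (k - j) + r / 2 ^+ (k - j)) (e + (e / k.+1%:R) *+ j).
    move=> /(_ k (leqnn _)) H /H; rewrite subnn expr0 divr1; apply: vanishes_le.
    by rewrite lerD2l -mulr_natr mulrAC ler_pdivrMr ?ltr0n // ler_pM2l // ler_nat.
  elim=> [_|j IH jk H]; first by rewrite subn0 mulr0n addr0.
  have := IH (ltnW jk) H.
  have -> : (k - j = (k - j.+1).+1)%N by lia.
  move: (k - j.+1)%N => i; set t := r / 2 ^+ i.+1.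
  have t0 : 0 < t by rewrite divr_gt0 ?exprn_gt0.
  have -> : r / 2 ^+ i = t + t by rewrite /t exprS; field; rewrite expf_neq0.
  rewrite [_ *+ j.+1]mulrSr [e + (_ + _)]addrA => Ht.
  have ek0 : 0 < e / k.+1%:R by rewrite divr_gt0 ?ltr0n.
  apply: (vanishes_ring t0 ek0 _ Ht).
  move=> w wt; apply: dg; apply: (le_trans wt).
  have -> : t + t = r / 2 ^+ i by rewrite /t exprS; field; rewrite expf_neq0.
  rewrite ler_pdivrMr ?exprn_gt0 //; apply: ler_peMr; [exact: ltW|by apply: exprn_ege1; lra].
apply/ler_addgt0Pl => e e0; have [N0 HN] := van e e0.
have gE : squ N0 g (pt x (- r) (- r)) (r + r) =
  squ N0 (fun w => F w / (w - x)) (pt x (- r) (- r)) (r + r) -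
  F x * squ N0 (fun w => (w - x)^-1) (pt x (- r) (- r)) (r + r).
  rewrite -mulNr -squZ -squD; congr squ; apply/funext => w.
  by rewrite /g mulrBl mulNr.
have h1 := HN N0 (leqnn _).
have h2 : normc (squ N0 (fun w => F w / (w - x)) (pt x (- r) (- r)) (r + r)) <= 4 * (r + r) * (B / r).
  apply: squ_le; first by rewrite addr_ge0 // ltW.
  rewrite pt_pt (_ : - r + (r + r) / 2 = 0); last by field.
  rewrite (_ : (r + r) / 2 = r); last by field.
  move=> w; rewrite pt00 => wr.
  have wn : r <= normc (w - x) by rewrite -wr qn_le_normc.
  rewrite normcMM normcVV ler_pM ?invr_ge0 ?normc_ge0 ?HB //.
  by rewrite lef_pV2 // posrE // (lt_le_trans r0).
have h3 := squ_inv_ge N0 x r0.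
(* The factor 2 of the conclusion is 8 / 4: the perimeter bound 4 (2 r) (B / r) against the 4 of
   [squ_inv_ge]. *)
have h4 : 4 * normc (F x) <= 8 * B + (e + e).
  have -> : 8 * B = 4 * (r + r) * (B / r) by field; rewrite gt_eqF.
  apply: le_trans (lerD h2 h1).
  apply: le_trans (_ : normc (F x * squ N0 (fun w => (w - x)^-1) (pt x (- r) (- r)) (r + r)) <= _).
    by rewrite normcMM mulrC ler_wpM2l ?normc_ge0.
  rewrite (_ : F x * _ = squ N0 (fun w => F w / (w - x)) (pt x (- r) (- r)) (r + r) - squ N0 g (pt x (- r) (- r)) (r + r)).
    by apply: le_trans (normcD _ _) _; rewrite normcN.
  by rewrite gE; ring.
lra.
Qed.

End Goursat.

(** * Maximum principle and open mapping *)

Section MaximumPrinciple.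
Variable R : realType.
Local Notation C := (cplx R).
Local Notation K := R[i].
Local Notation normc := ComplexField.Normc.normc.

Definition contr (T : topologicalType) (g : T -> R) (x : T) : Prop :=
  {for x, continuous g}.

Lemma contRe (T : topologicalType) (g : T -> R) x : {for x, continuous g} <->
  forall e, 0 < e -> \forall y \near x, `|g y - g x| < e.
Proof.
split=> [/cvgrPdist_lt H e e0|H].
  by have := H _ e0; apply: filterS => y; rewrite distrC.
by apply/cvgrPdist_lt => e /H; apply: filterS => y; rewrite distrC.
Qed.

Lemma contRM (T : topologicalType) (f g : T -> R) x : {for x, continuous f} ->
  {for x, continuous g} -> {for x, continuous (fun z => f z * g z : R)}.
Proof. move=> cf cg; exact: (@continuousM R T f g x cf cg). Qed.

Lemma contRD (T : topologicalType) (f g : T -> R) x : {for x, continuous f} ->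
  {for x, continuous g} -> {for x, continuous (fun z => f z + g z : R)}.
Proof. move=> cf cg; exact: (@continuousD R R T f g x cf cg). Qed.

Lemma cont_sumR (T : topologicalType) n (f : 'I_n -> T -> R) x :
  (forall i, {for x, continuous (f i)}) ->
  {for x, continuous (fun z => \sum_i f i z : R)}.
Proof.
move=> cf; elim: n f cf => [|n IH] f cf.
  rewrite (_ : (fun z => _) = fun=> 0); first exact: cst_continuous.
  by apply/funext => z; rewrite big_ord0.
rewrite (_ : (fun z => _) = fun z => f ord0 z + \sum_i f (lift ord0 i) z).
  by apply: contRD; [exact: cf|exact: IH].
by apply/funext => z; rewrite big_ord_recl.
Qed.

Lemma closed_bounded_compact (A : set C) (M : R) : closed A ->
  (forall z, A z -> normc z <= M) -> compact A.
Proof.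
move=> cA AM; pose f (p : R * R) : C := p.1 +i* p.2.
have cB : compact (f @` (`[-M, M] `*` `[-M, M])).
  apply: continuous_compact; last by apply: compact_setX; exact: segment_compact.
  apply: continuous_in_subspaceT => p _.
  apply: (@cont_complex R _ (fun p : R * R => p.1) (fun p => p.2)).
    exact: (@cvg_fst R R).
  exact: (@cvg_snd R R).
apply: subclosed_compact cA cB _ => z Az.
exists (complex.Re z, complex.Im z); last by case: z {Az}.
by split; rewrite /= in_itv /= -ler_norml (le_trans _ (AM _ Az)) // (normc_Re, normc_Im).
Qed.

Lemma closed_le_cont (T : topologicalType) (g : T -> R) (B : R) :
  (forall z, contr g z) -> closed [set z | g z <= B].
Proof.
move=> cg; apply: (@preimage_closed _ _ g [set y | y <= B]) => [z _|].
  exact: cg.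
exact: closed_le.
Qed.

Lemma closed_eq_cont (T : topologicalType) (g : T -> R) (B : R) :
  (forall z, contr g z) -> closed [set z | g z = B].
Proof.
move=> cg; apply: (@preimage_closed _ _ g [set y | y = B]) => [z _|].
  exact: cg.
exact: closed_eq.
Qed.

Lemma contBid (x z : K) : @contc R C (fun w => w - x) z.
Proof. by apply: contB; [exact: contid|exact: contcst]. Qed.

Lemma cont_qn (x z : K) : @contr C (fun w : K => qn (w - x)) z.
Proof.
apply/contRe => e e0.
have := (@contT_eps R C _ z).1 (@contBid x z) e e0.
apply: filterS => w; apply: le_lt_trans; apply: le_trans (qn_le_normc _).
have tri (a b : K) : qn (a + b) <= qn a + qn b.
  have hl (c d : K) : `|complex.Re (c + d)| <= `|complex.Re c| + `|complex.Re d|.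
    by case: c d => [? ?] [? ?]; exact: ler_normD.
  have hi (c d : K) : `|complex.Im (c + d)| <= `|complex.Im c| + `|complex.Im d|.
    by case: c d => [? ?] [? ?]; exact: ler_normD.
  rewrite {1}/qn ge_max; apply/andP; split.
    by apply: le_trans (hl _ _) _; apply: lerD; rewrite /qn le_max lexx.
  by apply: le_trans (hi _ _) _; apply: lerD; rewrite /qn le_max lexx orbT.
have qnN (a : K) : qn (- a) = qn a by rewrite /qn; case: a => u v /=; rewrite !normrN.
have h1 := tri (w - x - (z - x)) (z - x); have h2 := tri (z - x - (w - x)) (w - x).
move: h1 h2; rewrite !subrK -[z - x - _]opprB qnN => h1 h2.
by rewrite ler_norml; apply/andP; split; lra.
Qed.

Lemma compact_square (x : K) r : compact ([set w : K | qn (w - x) <= r] : set C).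
Proof.
apply: (@closed_bounded_compact _ (2 * r + normc x)).
  by apply: closed_le_cont => z; exact: cont_qn.
move=> z /= zr; rewrite -[z](subrK x) (le_trans (normcD _ _)) // lerD2r.
by rewrite (le_trans (normc_le_qn _)) // ler_pM2l.
Qed.

Lemma compact_bsquare (x : K) r : compact ([set w : K | qn (w - x) = r] : set C).
Proof.
apply: subclosed_compact (@compact_square x r) _ => [|z /= ->//].
by apply: closed_eq_cont => z; exact: cont_qn.
Qed.

Lemma EVTc_max (A : set C) (g : K -> R) : compact A -> A !=set0 ->
  (forall z : C, A z -> @contr C g z) ->
  exists2 z : K, A z & forall w : K, A w -> g w <= g z.
Proof.
move=> cA A0 cg; have [|z zA zP] := @compact_EVT_max C R g A A0 cA.
  by apply: continuous_in_subspaceT => z /set_mem; exact: cg.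
by exists z; [exact: set_mem|move=> w wA; apply: zP; exact: mem_set].
Qed.

Lemma EVTc_min (A : set C) (g : K -> R) : compact A -> A !=set0 ->
  (forall z : C, A z -> @contr C g z) ->
  exists2 z : K, A z & forall w : K, A w -> g z <= g w.
Proof.
move=> cA A0 cg; have [|z zA zP] := @compact_EVT_min C R g A A0 cA.
  by apply: continuous_in_subspaceT => z /set_mem; exact: cg.
by exists z; [exact: set_mem|move=> w wA; apply: zP; exact: mem_set].
Qed.

(** * Logarithms of moduli and the maximum principle *)

Definition lnc (z : K) : R := ln (normc z).

Lemma lncM z w : z != 0 -> w != 0 -> lnc (z * w) = lnc z + lnc w.
Proof. by move=> z0 w0; rewrite /lnc normcMM lnM // posrE normc_gt0. Qed.

Lemma lncV z : z != 0 -> lnc z^-1 = - lnc z.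
Proof. by move=> z0; rewrite /lnc normcVV lnV // posrE normc_gt0. Qed.

Lemma lncX z n : z != 0 -> lnc (z ^+ n) = n%:R * lnc z.
Proof. by move=> z0; rewrite /lnc normcX lnXn ?normc_gt0 // mulr_natl. Qed.

Lemma lncXz z (k : int) : z != 0 -> lnc (z ^ k) = k%:~R * lnc z.
Proof.
move=> z0; case: k => k; first by rewrite -exprnP lncX.
rewrite NegzE -exprnN lncV ?expf_neq0 // lncX //.
by rewrite mulrNz mulNr.
Qed.

Lemma lnc_prod n (g : 'I_n -> K) : (forall i, g i != 0) ->
  \prod_i g i != 0 /\ lnc (\prod_i g i) = \sum_i lnc (g i).
Proof.
elim: n g => [|n IH] g g0.
  by rewrite !big_ord0 oner_neq0 /lnc ComplexField.Normc.normc1 ln1.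
have [h1 h2] := IH (fun i => g (lift ord0 i)) (fun i => g0 _).
by rewrite !big_ord_recl mulf_neq0 // lncM // h2.
Qed.

Lemma cont_lnc (T : topologicalType) (f : T -> K) x : contc f x -> f x != 0 ->
  {for x, continuous (fun z => lnc (f z))}.
Proof.
move=> cf f0; apply: (@continuous_comp _ _ _ (fun z => normc (f z)) (@ln R)).
  exact: cont_normc.
by apply: continuous_ln; rewrite normc_gt0.
Qed.

(** The harmonic functions of the proof have this form, with [f i] holomorphic and free of zeros.
    The form is stable under adding one more term, which [max_principle] exploits. *)
Definition logsum n (al : 'I_n -> R) (f : 'I_n -> K -> K) (z : K) : R :=
  \sum_i al i * lnc (f i z).

Lemma cont_logsum n al (f : 'I_n -> K -> K) (x : C) :
  (forall i, cdiff (f i) x /\ f i x != 0) ->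
  @contr C (logsum al f) x.
Proof.
move=> df; apply: cont_sumR => i; apply: contRM; first exact: cst_continuous.
by apply: cont_lnc; [apply: cdiff_cont; exact: (df i).1|exact: (df i).2].
Qed.

Lemma natR_unbounded (a b : R) : (forall N : nat, N%:R * a <= b) -> a <= 0.
Proof.
move=> H; rewrite leNgt; apply/negP => a0.
have b0 : 0 <= b by have := H 0%N; rewrite mul0r.
have := archi_boundP (divr_ge0 b0 (ltW a0)).
by rewrite ltr_pdivrMr // ltNge H.
Qed.

(* Replace N * al by integers and let N tend to infinity: this absorbs both the
   factor 2 of square_bound2 and the rounding error. *)
Lemma square_max_logsum n al (f : 'I_n -> K -> K) (x : K) r B : 0 < r ->
  (forall i w, qn (w - x) <= r -> cdiff (f i) w /\ f i w != 0) ->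
  (forall w, qn (w - x) = r -> logsum al f w <= B) -> logsum al f x <= B.
Proof.
move=> r0 df HB.
have xx : qn (x - x) <= r by rewrite subrr /qn /= normr0 maxxx ltW.
have HD (i : 'I_n) : exists D : R, forall w, qn (w - x) <= r -> `|lnc (f i w)| <= D.
  have [|z zr zP] := @EVTc_max _ (fun w => `|lnc (f i w)|) (@compact_square x r) (ex_intro _ x xx).
    move=> z zr; have [dz z0] := df i z zr.
    apply: (@continuous_comp _ _ _ (fun w : C => lnc (f i w)) (fun y : R => `|y|)).
      by apply: cont_lnc => //; exact: cdiff_cont.
    exact: norm_continuous.
  by exists `|lnc (f i z)| => w; exact: zP.
have [D DP] := choice HD.
pose SD := \sum_i D i.
rewrite -subr_le0; apply: (@natR_unbounded _ (ln 2 + 2 * SD)) => N.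
pose k i := Num.floor (N%:R * al i).
have kP i : `|N%:R * al i - (k i)%:~R| <= 1.
  have := floor_itv (N%:R * al i); rewrite -/(k i) intrD => /andP[h1 h2].
  by rewrite ler_norml; apply/andP; split; lra.
pose F w := \prod_i (f i w) ^ (k i).
have Fw w : qn (w - x) <= r -> F w != 0 /\ `|N%:R * logsum al f w - lnc (F w)| <= SD.
  move=> wr; have [|h1 h2] := @lnc_prod n (fun i => f i w ^ k i).
    by move=> i; apply: expfz_neq0; exact: (df i w wr).2.
  split => //; rewrite /F h2 /logsum mulr_sumr -sumrB.
  apply: le_trans (ler_norm_sum _ _ _) _; apply: ler_sum => i _.
  rewrite lncXz ?(df i w wr).2 // mulrA -mulrBl normrM -[leRHS]mul1r.
  by apply: ler_pM => //; exact: DP.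
have cF w : qn (w - x) <= r -> cdiff F w.
  move=> wr; apply: cdiff_prod => i; apply: cdiffXz; [exact: (df i w wr).2|exact: (df i w wr).1].
have [Fx0 hx] := Fw x xx.
have Fle : normc (F x) <= 2 * expR (N%:R * B + SD).
  apply: (@square_bound2 R F x r) => //; first by apply: cdiff_cont; exact: cF.
    by move=> w wr _; exact: cF.
  move=> w wr; have [] := Fw w; first by rewrite wr.
  move=> Fw0; rewrite ler_norml => /andP[h1 h2].
  have hB : N%:R * logsum al f w <= N%:R * B by rewrite ler_wpM2l // HB.
  rewrite -[normc (F w)]lnK ?posrE ?normc_gt0 // ler_expR -/(lnc _).
  lra.
have h3 : lnc (F x) <= ln 2 + (N%:R * B + SD).
  rewrite -[N%:R * B + SD]expRK -lnM ?posrE ?expR_gt0 //.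
  by rewrite ler_ln // ?posrE ?normc_gt0 // mulr_gt0 // expR_gt0.
rewrite mulrBr; move: hx; rewrite ler_norml => /andP[h1 h2].
lra.
Qed.

Lemma normc_sqr (z : K) : normc z ^+ 2 = complex.Re z ^+ 2 + complex.Im z ^+ 2.
Proof. by case: z => a b /=; rewrite sqr_sqrtr // addr_ge0 ?sqr_ge0. Qed.

(** Strict convexity of the modulus, from |u + v|^2 + |u - v|^2 = 2 |u|^2 + 2 |v|^2. *)
Lemma parallelogram_eq (u v : K) : normc u <= normc v ->
  2 * normc v <= normc (u + v) -> u = v.
Proof.
move=> uv h.
have h2 : 4 * normc v ^+ 2 <= normc (u + v) ^+ 2.
  rewrite (_ : 4 * _ = (2 * normc v) ^+ 2); last by ring.
  by rewrite ler_pXn2r // nnegrE ?mulr_ge0 ?normc_ge0.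
have h1 : normc u ^+ 2 <= normc v ^+ 2 by rewrite ler_pXn2r // nnegrE normc_ge0.
move: h1 h2; rewrite !normc_sqr; case: u v {uv h} => [a b] [c d] /= h1 h2.
have h3 : (a - c) ^+ 2 + (b - d) ^+ 2 <= 0 by nra.
have ac : (a - c) ^+ 2 = 0.
  by apply/eqP; rewrite eq_le sqr_ge0 andbT; apply: le_trans h3; rewrite lerDl sqr_ge0.
have bd : (b - d) ^+ 2 = 0.
  by apply/eqP; rewrite eq_le sqr_ge0 andbT; apply: le_trans h3; rewrite lerDr sqr_ge0.
move/eqP: ac; move/eqP: bd; rewrite !sqrf_eq0 !subr_eq0 => /eqP-> /eqP->//.
Qed.

Lemma nbhs_square (x : C) (U : set C) : nbhs x U ->
  exists2 r, 0 < r & forall w : K, qn (w - (x : K)) <= r -> U w.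
Proof.
move=> /nbhs_cplx[e e0 eU]; exists (e / 3); first by rewrite divr_gt0.
move=> w wr; apply: eU; apply: le_lt_trans (normc_le_qn _) _; lra.
Qed.

(** [square_max_logsum] gives no strict inequality, so a point where the maximum is attained is no
    contradiction by itself. A maximum point x farthest from some p is chosen, and a small multiple
    of ln |q| that singles out x is added. The set [V] and the radius [rho] express the boundary
    conditions at the finite boundary and at infinity. *)
Lemma max_principle n al (f : 'I_n -> K -> K) (D : set C) B :
  open D -> (forall i w, D w -> cdiff (f i) w /\ f i w != 0) ->
  (exists V : set C, [/\ open V, ~` D `<=` V &
     forall w, V w -> D w -> logsum al f w <= B]) ->
  (exists rho : R, forall w, D w -> rho < normc w -> logsum al f w <= B) ->
  forall w, D w -> logsum al f w <= B.
Proof.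
move=> oD df [V [oV DV HV]] [rho Hrho] z1 Dz1; rewrite leNgt; apply/negP => hz1.
pose h := logsum al f.
have ch (z : K) : D z -> @contr C h z.
  by move=> Dz; apply: cont_logsum => i; exact: df.
pose A0 : set C := [set w | ~ V w /\ normc w <= rho].
have A0D w : A0 w -> D w by move=> [Vw _]; apply: contrapT => /DV.
have cnormc (z : C) : @contr C (fun w : K => normc w) z.
  by apply: cont_normc; exact: contid.
have clA0 : closed A0.
  by apply: closedI; [exact: open_closedC|apply: closed_le_cont => z; exact: cnormc].
have A0rho w : A0 w -> normc w <= rho by case.
have cA0 : compact A0 by exact: closed_bounded_compact clA0 A0rho.
have outA0 w : D w -> ~ A0 w -> h w <= B.
  move=> Dw /not_andP[|/negP]; first by move=> /contrapT Vw; exact: HV.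
  by rewrite -ltNge; exact: Hrho.
have A0z1 : A0 z1 by apply: contrapT => /(outA0 _ Dz1); rewrite leNgt hz1.
have [x0 A0x0 x0P] := EVTc_max cA0 (ex_intro _ _ A0z1) (fun z Az => ch z (A0D z Az)).
pose M := h x0; have BM : B < M by apply: lt_le_trans hz1 _; exact: x0P.
have hM w : D w -> h w <= M.
  move=> Dw; have [/x0P//|nA] := pselect (A0 w).
  by apply: le_trans (outA0 _ Dw nA) _; exact: ltW.
pose A1 : set C := [set w | A0 w /\ M <= h w].
have A1P w : D w -> M <= h w -> A1 w.
  move=> Dw Mw; split => //; apply: contrapT => /(outA0 _ Dw) hB.
  by have := lt_le_trans BM (le_trans Mw hB); rewrite ltxx.
have cA1 : compact A1.
  apply: (subclosed_compact _ cA0); last by move=> w [].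
  rewrite -openC openE => w /not_andP[nA|/negP]; rewrite /interior.
    have : nbhs w (~` A0) by apply: open_nbhs_nbhs; split => //; exact: closed_openC.
    by apply: filterS => v nAv [].
  rewrite -ltNge => hw; have [Aw|nA] := pselect (A0 w); last first.
    have : nbhs w (~` A0) by apply: open_nbhs_nbhs; split => //; exact: closed_openC.
    by apply: filterS => v nAv [].
  have /contRe := ch w (A0D _ Aw).
  have e0 : 0 < M - h w by rewrite subr_gt0.
  move=> /(_ _ e0); apply: filterS => v; rewrite ltr_norml => /andP[_ h2] [_].
  by rewrite leNgt => /negP; apply; lra.
pose p : K := (`|rho| + 1)%:C.
have pA0 : ~ A0 p.
  by move=> [_]; rewrite normc_real; have := ler_norm rho; have := ler_norm (`|rho| + 1); lra.
have [x A1x xP] : exists2 x : K, A1 x & forall w : K, A1 w -> normc (w - p) <= normc (x - p).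
  apply: (EVTc_max (g := fun w => normc (w - p)) cA1); first by exists x0.
  by move=> z _; apply: cont_normc; exact: contBid.
have [A0x hx] := A1x; have Dx := A0D _ A0x.
have xp : x != p by apply/eqP => xp; apply: pA0; rewrite -xp.
have hxM : h x = M by apply/eqP; rewrite eq_le hM.
(* q w = (w - p) + (x - p). Maximum points satisfy |w - p| <= |x - p|, so |q w| < |q x| at all of
   them except x; q x is nonzero because p lies outside [A0]. *)
pose q w : K := w + (x - 2 * p).
have qx : q x = 2 * (x - p) by rewrite /q; ring.
have two0 : 2 != 0 :> K by rewrite pnatr_eq0.
have qx0 : q x != 0 by rewrite qx mulf_neq0 // subr_eq0.
have dq w : cdiff q w by apply: cdiffD; [exact: cdiff_id|exact: cdiff_cst].
have n2 : normc (2 : K) = 2.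
  by rewrite (_ : 2 = (2 : R)%:C) ?normc_real ?ger0_norm // rmorph_nat.
have [r r0 rP] : exists2 r, 0 < r & forall w, qn (w - x) <= r -> D w /\ q w != 0.
  apply: (@nbhs_square x [set w | D w /\ q w != 0]).
  have h1 : nbhs (x : C) D by apply: open_nbhs_nbhs.
  have h2 := near_neq0 (cdiff_cont (dq x)) qx0.
  by apply: filterS2 h1 h2.
pose b : set C := [set w : K | qn (w - x) = r].
have bP w : b w -> D w /\ q w != 0 by move=> bw; apply: rP; rewrite bw.
have b0 : b (x + r%:C).
  by rewrite /b /= addrC addrA addNr add0r /qn /= normr0 gtr0_norm // max_l // ltW.
have cb : compact b by exact: compact_bsquare.
(* On b', where ln |q| does not drop, h stays below M by a fixed d; on the rest of the boundary ln
   |q| drops while h <= M. *)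
pose b' : set C := [set w | b w /\ lnc (q x) <= lnc (q w)].
have clq (w : K) : b w -> @contr C (fun w => lnc (q w)) w.
  by move=> bw; apply: cont_lnc; [exact: cdiff_cont|exact: (bP _ bw).2].
have b'M w : b' w -> h w < M.
  move=> [bw qw]; have [Dw qw0] := bP _ bw; rewrite lt_neqAle hM // andbT; apply/eqP => hw.
  have A1w : A1 w by apply: A1P; rewrite // hw.
  have : normc (q x) <= normc (q w) by rewrite -ler_ln ?posrE ?normc_gt0.
  rewrite qx normcMM n2 (_ : q w = (w - p) + (x - p)); last by rewrite /q; ring.
  move=> /(parallelogram_eq (xP _ A1w)) /addIr wx.
  by move: bw r0; rewrite wx /b /= subrr /qn /= normr0 maxxx => <-; rewrite ltxx.
have [d d0 dP] : exists2 d, 0 < d & forall w, b' w -> h w <= M - d.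
  have [b'0|b'0] := pselect (b' !=set0); last first.
    by exists 1 => // w b'w; exfalso; apply: b'0; exists w.
  have cb' : compact b'.
    apply: (subclosed_compact _ cb); last by move=> w [].
    rewrite -openC openE => w /not_andP[nA|/negP]; rewrite /interior.
      have : nbhs w (~` b).
        apply: open_nbhs_nbhs; split => //; apply: closed_openC.
        by apply: closed_eq_cont => z; exact: cont_qn.
      by apply: filterS => v nAv [].
    rewrite -ltNge => hw; have [Aw|nA] := pselect (b w); last first.
      have : nbhs w (~` b).
        apply: open_nbhs_nbhs; split => //; apply: closed_openC.
        by apply: closed_eq_cont => z; exact: cont_qn.
      by apply: filterS => v nAv [].
    have /contRe := clq w Aw.
    have e0 : 0 < lnc (q x) - lnc (q w) by rewrite subr_gt0.
    move=> /(_ _ e0); apply: filterS => v; rewrite ltr_norml => /andP[_ h2] [_].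
    by rewrite leNgt => /negP; apply; lra.
  have [z b'z zP] := EVTc_max cb' b'0 (fun z bz => ch z (bP z bz.1).1).
  exists (M - h z); first by rewrite subr_gt0 b'M.
  by move=> w /zP hw; lra.
have [L LP] : exists L, forall w, b w -> lnc (q w) <= L.
  have [z _ zP] := EVTc_max cb (ex_intro _ _ b0) (fun z bz => clq z bz).
  by exists (lnc (q z)).
(* Small enough that the gain eta (L - ln |q x|) on b' stays below d; the summand 1 keeps the
   denominator positive. *)
pose eta := d / (2 * (`|L - lnc (q x)| + 1)).
have eta0 : 0 < eta by rewrite divr_gt0 // mulr_gt0 // ltr_wpDl.
have etaL : eta * (L - lnc (q x)) < d.
  apply: le_lt_trans (_ : eta * `|L - lnc (q x)| < _).
    by apply: ler_wpM2l; [exact: ltW|exact: ler_norm].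
  rewrite /eta mulrAC ltr_pdivrMr ?mulr_gt0 ?ltr_wpDl // ltr_pM2l //.
  by have := normr_ge0 (L - lnc (q x)) => hh; lra.
pose f' (i : 'I_n.+1) := if unlift ord0 i is Some j then f j else q.
pose al' (i : 'I_n.+1) := if unlift ord0 i is Some j then al j else eta.
have lsE w : logsum al' f' w = eta * lnc (q w) + h w.
  rewrite /logsum big_ord_recl /al' /f' unlift_none; congr (_ + _).
  by apply: eq_bigr => i _; rewrite liftK.
have df' i w : qn (w - x) <= r -> cdiff (f' i) w /\ f' i w != 0.
  move=> /rP[Dw qw]; rewrite /f'; case: unliftP => [j _|_]; first exact: df.
  by split.
have cG (z : K) : b z -> @contr C (fun w => eta * lnc (q w) + h w) z.
  move=> bz; apply: contRD; last by apply: ch; exact: (bP _ bz).1.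
  by apply: contRM; [exact: cst_continuous|exact: clq].
have [z bz zP] := EVTc_max cb (ex_intro _ _ b0) cG.
have := @square_max_logsum _ al' f' x r (eta * lnc (q z) + h z) r0 df'.
rewrite lsE hxM => HM.
have {}HM : eta * lnc (q x) + M <= eta * lnc (q z) + h z.
  by apply: HM => w /zP; rewrite lsE.
suff : eta * lnc (q z) + h z < eta * lnc (q x) + M by rewrite ltNge HM.
have [b'z|nb'] := pselect (b' z).
  have h1 := dP _ b'z; have h2 : eta * lnc (q z) <= eta * L by apply: ler_wpM2l; [exact: ltW|exact: LP].
  by move: etaL; rewrite mulrBr; lra.
have hz := hM z (bP _ bz).1.
have : lnc (q z) < lnc (q x) by rewrite ltNge; apply/negP => hh; apply: nb'.
by rewrite -(ltr_pM2l eta0); lra.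
Qed.

(** With m the minimum of |F - F x| on the boundary, an omitted v within m / 3 of F x would make 1 /
    (F - v) exceed 3 / m at x but stay at most 3 / (2 m) on the boundary, against the factor 2 of
    [square_bound2]. Asking only for continuity at x lets it apply to 1 / f (1 / w) at 0. *)
Lemma open_mapping_square (F : K -> K) (x : K) r : 0 < r -> @contc R C F x ->
  (forall w, qn (w - x) <= r -> w != x -> cdiff F w) ->
  (forall w, qn (w - x) = r -> F w != F x) ->
  exists2 d, 0 < d &
    forall v, normc (v - F x) < d -> exists2 w, qn (w - x) <= r & F w = v.
Proof.
move=> r0 cF dF Fx; pose b : set C := [set w : K | qn (w - x) = r].
have b0 : b (x + r%:C).
  by rewrite /b /= addrC addrA addNr add0r /qn /= normr0 gtr0_norm // max_l // ltW.
have bx w : b w -> w != x.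
  by move=> bw; apply/eqP => wx; move: bw r0; rewrite wx /b /= subrr /qn /= normr0 maxxx => <-; rewrite ltxx.
have [|z bz zP] := @EVTc_min _ (fun w => normc (F w - F x)) (@compact_bsquare x r) (ex_intro _ _ b0).
  move=> z bz; apply: cont_normc; apply: contB; last exact: contcst.
  by apply: cdiff_cont; apply: dF; [rewrite bz|exact: bx].
pose m := normc (F z - F x); have m0 : 0 < m by rewrite normc_gt0 subr_eq0 Fx.
exists (m / 3); first by rewrite divr_gt0.
move=> v vd; apply: contrapT => H.
have Fv w : qn (w - x) <= r -> F w - v != 0.
  by move=> wr; rewrite subr_eq0; apply/eqP => Fwv; apply: H; exists w.
have xx : qn (x - x) <= r by rewrite subrr /qn /= normr0 maxxx ltW.
have : normc (F x - v)^-1 <= 2 * (2 * m / 3)^-1.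
  apply: (@square_bound2 R (fun w => (F w - v)^-1) x r _ r0).
  - by apply: contV; [exact: Fv|apply: contB; [exact: cF|exact: contcst]].
  - move=> w wr wx; apply: (@cdiffV R (fun w => F w - v)); first exact: Fv.
    by apply: cdiffB; [exact: dF|exact: cdiff_cst].
  - move=> w wr; rewrite normcVV lef_pV2 ?posrE ?normc_gt0 ?Fv ?wr //; last by rewrite divr_gt0 // mulr_gt0.
    have := zP w wr; rewrite -/m => h1.
    have := normcD (F w - v) (v - F x); rewrite addrA subrK => h2.
    lra.
have vx0 : 0 < normc (F x - v) by rewrite normc_gt0 Fv.
rewrite normcVV -[2]invrK -invfM lef_pV2 ?posrE //; last by rewrite mulr_gt0 ?invr_gt0 // divr_gt0 // mulr_gt0.
by rewrite normcB => h; move: vd; lra.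
Qed.

Lemma open_mapping (F : K -> K) (x : K) (U : set C) : nbhs (x : C) U ->
  (forall w, U w -> cdiff F w) -> (forall w, U w -> F w = F x -> w = x) ->
  nbhs (F x : C) (F @` U).
Proof.
move=> /[dup] Ux /nbhs_square[r r0 rU] dF iF.
have [||d d0 dP] := @open_mapping_square F x r r0 (cdiff_cont (dF x (nbhs_singleton Ux))).
- by move=> w wr _; apply: dF; exact: rU.
- move=> w wr; apply/eqP => Fwx; have := iF w (rU w (ltac:(by rewrite wr))) Fwx.
  by move=> wx; move: wr r0; rewrite wx subrr /qn /= normr0 maxxx => <-; rewrite ltxx.
apply/nbhs_cplx; exists d => // v /dP[w wr <-]; exists w => //; exact: rU.
Qed.

(** * Functions of constant modulus *)

Definition cstat (f : K -> K) (x : K) :=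
  exists2 k : K -> K, @contc R C k x & k x = 0 /\ forall z, f z - f x = k z * (z - x).

Lemma cstat_segment (f : K -> K) (a b : K) :
  (forall t : R, 0 <= t <= 1 -> cstat f (a + t%:C * (b - a))) -> f a = f b.
Proof.
(* The mean value theorem is a real statement; u = 1 and u = -i recover the real and the imaginary
   part. *)
move=> H; suff HR (u : K) : complex.Re (u * f a) = complex.Re (u * f b).
  apply: complex_ext; first by have := HR 1; rewrite !mul1r.
  by have := HR (- 'i); case: (f a) (f b) => [p q] [p' q'] /=; rewrite ?oppr0 ?mul0r ?sub0r ?mulN1r ?opprK.
pose l (t : R) := a + t%:C * (b - a).
have cl (t : R) : @contc R R l t.
  apply: contD; first exact: contcst.
  apply: contM; last exact: contcst.
  by apply: (@cont_complex R R (fun t => t) (fun=> 0)); [by move=> U|exact: cst_continuous].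
pose g (t : R) : R := complex.Re (u * f (l t)).
have cf (t : R) : 0 <= t <= 1 -> @contc R C f (l t).
  by move=> /H[k ck [_ kE]]; apply: cdiff_cont; exists k.
have cg (t : R) : 0 <= t <= 1 -> {for t, continuous g}.
  move=> /cf ct; apply: cont_Re; apply: contM; first exact: contcst.
  exact: contc_comp (cl t) ct.
have dg (t : R) : 0 <= t <= 1 -> is_derive t 1 g 0.
  move=> /H[k ck [k0 kE]].
  have Hq : (fun h : R => h^-1 *: ((g \o shift t) (h *: 1) - g t)) @ 0^' --> (0 : R).
    apply/cvgrPdist_lt => e e0.
    have c1 : @contc R R (fun s => k (l (t + s))) 0.
      have c2 : @contc R R (fun s => l (t + s)) 0.
        apply: contD; first exact: contcst.
        apply: contM; last exact: contcst.
        apply: (@cont_complex R R (fun s => t + s) (fun=> 0)); last exact: cst_continuous.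
        by apply: contRD; [exact: cst_continuous|by move=> U].
      by apply: (contc_comp c2); rewrite addr0; exact: ck.
    have c3 : @contc R R (fun s => u * (k (l (t + s)) * (b - a))) 0.
      apply: contM; first exact: contcst.
      by apply: contM; [exact: c1|exact: contcst].
    have E0 : u * (k (l (t + 0)) * (b - a)) = 0 by rewrite addr0 k0 mul0r mulr0.
    have := (@contT_eps R R _ _).1 c3 _ e0.
    rewrite E0 near_withinE; apply: filterS => s hs s0.
    rewrite sub0r normrN.
    have -> : s^-1 *: ((g \o shift t) (s *: 1) - g t) = complex.Re (u * (k (l (t + s)) * (b - a))).
      rewrite /= /g /GRing.scale /= mulr1 [s + t]addrC -ReB -mulrBr kE.
      have -> : l (t + s) - (a + t%:C * (b - a)) = s%:C * (b - a).
        by rewrite /l rmorphD; ring.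
      move: (k (l (t + s))) => w.
      rewrite (_ : u * (w * (s%:C * (b - a))) = s%:C * (u * (w * (b - a)))); last by ring.
      by move: (u * _) => -[p q] /=; field.
    by apply: le_lt_trans (normc_Re _) _; rewrite -[_ * (_ * _)]subr0.
  by apply: DeriveDef; [apply/cvg_ex; exists 0|exact/cvg_lim].
have [||c _] := @MVT_segment R g (fun=> 0) 0 1 ler01.
- by move=> x; rewrite in_itv /= => /andP[h1 h2]; apply: dg; rewrite !ltW.
- apply: continuous_in_subspaceT => x /set_mem; rewrite /= in_itv /=; exact: cg.
by rewrite mul0r => /eqP; rewrite subr_eq0 /g /l mul0r addr0 mul1r addrC subrK => /eqP->.
Unshelve. all: by end_near. Qed.

(* If |f| is constant near x then f x * k x has no real part in any direction,
   where k is the slope function of f. *)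
Lemma cst_normc_cstat (f : K -> K) (x : K) : cdiff f x -> f x != 0 ->
  (\forall z \near (x : C), normc (f z) = normc (f x)) -> cstat f x.
Proof.
move=> [k ck kE] fx0 /nbhs_cplx[e e0 He]; exists k => //; split => //.
have [//|k0] := eqVneq (k x) 0; exfalso.
pose u := f x * (k x)^-1.
pose b := normc u.
have b0 : 0 < b by rewrite normc_gt0 mulf_neq0 // invr_eq0.
(* along z = x + s * u, f z = f x * (1 + s * k z / k x) *)
have c1 : @contc R R (fun s : R => k (x + s%:C * u) / k x) 0.
  apply: contM; last exact: contcst.
  apply: (@contc_comp R R (fun s : R => x + s%:C * u)); last by rewrite mul0r addr0.
  apply: contD; first exact: contcst.
  apply: contM; last exact: contcst.
  by apply: (@cont_complex R R (fun t => t) (fun=> 0)); [by move=> U|exact: cst_continuous].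
have h20 : 0 < 2^-1 :> R by rewrite invr_gt0.
have := (@contT_eps R R _ _).1 c1 _ h20; rewrite mul0r addr0 divff // => /nbhs_ballP[d /= d0 dP].
pose s := Num.min (d / 2) (e / (2 * b)).
have s0 : 0 < s by rewrite lt_min !divr_gt0 // mulr_gt0.
have sd : s < d by rewrite gt_min; apply/orP; left; lra.
have se : s * b < e.
  apply: le_lt_trans (_ : e / (2 * b) * b < e).
    by rewrite ler_pM2r // ge_min lexx orbT.
  have -> : e / (2 * b) * b = e / 2 by field; rewrite gt_eqF.
  lra.
have := dP s; rewrite /ball /= sub0r normrN gtr0_norm // => /(_ sd) hk.
have : normc (f (x + s%:C * u)) = normc (f x).
  by apply: He; rewrite addrC addKr normcMM normc_real gtr0_norm.
have -> : f (x + s%:C * u) = f x * (1 + s%:C * (k (x + s%:C * u) / k x)).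
  rewrite -[f (_ + _)](subrK (f x)) kE [x + _ - x]addrAC subrr add0r /u.
  by field.
rewrite normcMM => /(congr1 (fun y => y / normc (f x))).
rewrite divff ?gt_eqF ?normc_gt0 // mulrAC divff ?gt_eqF ?normc_gt0 // mul1r => h1.
have := normc_Re (1 + s%:C * (k (x + s%:C * u) / k x)).
rewrite h1; move: hk; set q := k _ / k x => hk.
have hq : 2^-1 < complex.Re q.
  have := normc_Re (q - 1); rewrite ReB /= => hh.
  have := le_lt_trans hh hk; rewrite ltr_norml => /andP[? _]; lra.
rewrite (_ : complex.Re _ = 1 + s * complex.Re q); last by case: (q) => ? ? /=; ring.
by rewrite ler_norml => /andP[_]; have := mulr_gt0 s0 (lt_trans h20 hq); lra.
Qed.

Lemma cst_normc_near (f : K -> K) (x : K) : f x != 0 ->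
  (\forall z \near (x : C), cdiff f z /\ normc (f z) = normc (f x)) ->
  \forall z \near (x : C), f z = f x.
Proof.
move=> fx0 /nbhs_cplx[e e0 He]; apply/nbhs_cplx; exists e => // z zx.
apply/esym/cstat_segment => t /andP[t0 t1].
have near_ok w : normc (w - x) < e -> cstat f w.
  move=> wx; have [dw nw] := He w wx.
  have fw0 : f w != 0 by rewrite -normc_gt0 nw normc_gt0.
  apply: cst_normc_cstat => //; apply/nbhs_cplx.
  exists (e - normc (w - x)); first by rewrite subr_gt0.
  move=> v vw; rewrite nw; apply: (He v _).2.
  by rewrite -(subrK w v) -addrA (le_lt_trans (normcD _ _)) // -ltrBrDr.
apply: near_ok; rewrite addrC addKr normcMM normc_real ger0_norm //.
by apply: le_lt_trans zx; rewrite ler_piMl // normc_ge0.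
Qed.

End MaximumPrinciple.

(** * Complex powers along a loop *)

Section ComplexPower.
Variable R : realType.
Local Notation C := (cplx R).
Local Notation K := R[i].
Local Notation normc := ComplexField.Normc.normc.

Lemma contr_comp (T : topologicalType) (f : T -> R) (g : R -> R) (x : T) :
  contr f x -> {for f x, continuous g} -> contr (fun z => g (f z)) x.
Proof. by move=> cf cg; exact: (@continuous_comp _ _ _ f g x cf cg). Qed.

Lemma slopeR (f : R -> R) (x d : R) : is_derive x 1 f d ->
  exists s : R -> R, [/\ {for x, continuous s}, s x = d &
    forall y, f y - f x = s y * (y - x)].
Proof.
move=> [dfx dE].
exists (fun y => if y == x then d else (f y - f x) / (y - x)); split.
- have Hq : (fun h : R => h^-1 *: ((f \o shift x) (h *: 1) - f x)) @ 0^' --> d.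
    by rewrite -dE; exact: dfx.
  apply/contRe => e e0; rewrite eqxx.
  move/cvgrPdist_lt/(_ _ e0) : Hq; rewrite near_withinE => /nbhs_ballP[r /= r0 rP].
  apply/nbhs_ballP; exists r => // y; rewrite /ball /= => yx.
  have [_|yx0] := eqVneq y x; first by rewrite subrr normr0.
  have := rP (y - x); rewrite /ball /= sub0r normrN distrC subr_eq0 => /(_ yx yx0).
  by rewrite /GRing.scale /= mulr1 subrK distrC mulrC.
- by rewrite eqxx.
- move=> y; have [->|yx] := eqVneq y x; first by rewrite !subrr mulr0.
  by rewrite divfK // subr_eq0.
Qed.

(** * The complex exponential and its inverse *)

Definition cis (t : R) : K := cos t +i* sin t.

Lemma cisD s t : cis (s + t) = cis s * cis t.
Proof. by rewrite /cis cosD sinD; apply: complex_ext => /=; ring. Qed.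

Lemma cis0 : cis 0 = 1.
Proof. by rewrite /cis cos0 sin0. Qed.

Lemma normc_cis t : normc (cis t) = 1.
Proof. by rewrite /cis /= cos2Dsin2 sqrtr1. Qed.

Lemma cis_neq0 t : cis t != 0.
Proof. by rewrite -normc_gt0 normc_cis. Qed.

Lemma cisN t : cis (- t) = (cis t)^-1.
Proof.
apply: (@mulIf _ (cis t)); first exact: cis_neq0.
by rewrite -cisD addNr cis0 mulVf // cis_neq0.
Qed.

Lemma cont_cis (t : R) : @contc R R cis t.
Proof. by apply: (@cont_complex R R (@cos R) (@sin R)); [exact: continuous_cos|exact: continuous_sin]. Qed.

Lemma cont_cisM (al t : R) : @contc R R (fun s => cis (al * s)) t.
Proof.
apply: (@cont_complex R R (fun s => cos (al * s)) (fun s => sin (al * s))).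
  apply: (@continuous_comp _ _ _ (fun s : R => al * s) (@cos R)); last exact: continuous_cos.
  by apply: contRM; [exact: cst_continuous|by move=> U].
apply: (@continuous_comp _ _ _ (fun s : R => al * s) (@sin R)); last exact: continuous_sin.
by apply: contRM; [exact: cst_continuous|by move=> U].
Qed.

Definition cexp (z : K) : K := (expR (complex.Re z))%:C * cis (complex.Im z).

Lemma cexpD z w : cexp (z + w) = cexp z * cexp w.
Proof.
case: z w => [a b] [c d]; rewrite /cexp /= expRD cisD rmorphM; ring.
Qed.

Lemma cexp0 : cexp 0 = 1.
Proof. by rewrite /cexp /= expR0 cis0 mulr1. Qed.

Lemma cexp_neq0 z : cexp z != 0.
Proof.
rewrite mulf_neq0 ?cis_neq0 // -normc_gt0 normc_real normr_gt0.
by rewrite gt_eqF // expR_gt0.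
Qed.

Lemma lnc_cexp z : lnc (cexp z) = complex.Re z.
Proof. by rewrite /lnc normcMM normc_cis mulr1 normc_real gtr0_norm ?expR_gt0 // expRK. Qed.

Lemma cexp_slope0 : exists2 k : K -> K, @contc R C k 0 &
  k 0 = 1 /\ forall z, cexp z - 1 = k z * z.
Proof.
have [E [compact_preimage E0 EE]] := slopeR (@is_derive_expR R 0).
have [c [cc c0 cE']] := slopeR (@is_derive_cos R 0).
have [S [cS S0 SE]] := slopeR (@is_derive_sin R 0).
rewrite expR0 in E0; rewrite sin0 oppr0 in c0; rewrite cos0 in S0.
exists (fun z => if z == 0 then 1 else (cexp z - 1) / z); last first.
  rewrite eqxx; split=> // z; have [->|z0] := eqVneq z 0; first by rewrite cexp0 subrr mulr0.
  by rewrite divfK.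
have cRe : @contr R C (fun z : K => complex.Re z) 0 by apply: cont_Re; exact: contid.
have cIm : @contr R C (fun z : K => complex.Im z) 0 by apply: cont_Im; exact: contid.
(* With E, c, S the slopes of exp, cos, sin at 0, [phi] dominates |(cexp z - 1) / z - 1|, because
   |Re z| and |Im z| are at most |z|; it is continuous at 0 with value 0. *)
pose phi (z : K) := let a := complex.Re z in let b := complex.Im z in
  (`|E a - 1| + `|c b + a * E a * c b|) + `|S b - 1 + a * E a * S b|.
have cEa : @contr R C (fun z : K => E (complex.Re z)) 0.
  by apply: (@continuous_comp _ _ _ (fun z : C => complex.Re z) E).
have cca : @contr R C (fun z : K => c (complex.Im z)) 0.
  by apply: (@continuous_comp _ _ _ (fun z : C => complex.Im z) c).
have cSa : @contr R C (fun z : K => S (complex.Im z)) 0.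
  by apply: (@continuous_comp _ _ _ (fun z : C => complex.Im z) S).
have cabs (g : K -> R) : @contr R C g 0 -> @contr R C (fun z => `|g z|) 0.
  by move=> cg; apply: (contr_comp (g := fun y : R => `|y|) cg); exact: norm_continuous.
have cphi : @contr R C phi 0.
  apply: contRD; first apply: contRD.
  - by apply: cabs; apply: contRD; [exact: cEa|exact: cst_continuous].
  - apply: cabs; apply: contRD; first exact: cca.
    by apply: contRM; [apply: contRM; [exact: cRe|exact: cEa]|exact: cca].
  - apply: cabs; apply: contRD.
      by apply: contRD; [exact: cSa|exact: cst_continuous].
    by apply: contRM; [apply: contRM; [exact: cRe|exact: cEa]|exact: cSa].
have phi0 : phi 0 = 0.
  by rewrite /phi /= E0 c0 S0 !subrr mul0r mul0r !addr0 mul0r addr0 normr0 !addr0.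
have hphi z : z != 0 -> normc ((cexp z - 1) / z - 1) <= phi z.
  move=> z0; have -> : (cexp z - 1) / z - 1 = (cexp z - 1 - z) / z by field.
  rewrite normcMM normcVV ler_pdivrMr ?normc_gt0 //.
  have ReIm : cexp z - 1 - z = (complex.Re z * (E (complex.Re z) - 1) + complex.Im z * (c (complex.Im z) + complex.Re z * E (complex.Re z) * c (complex.Im z)))
     +i* (complex.Im z * (S (complex.Im z) - 1 + complex.Re z * E (complex.Re z) * S (complex.Im z))).
    case: z {z0} => a b; apply: complex_ext; rewrite /cexp /cis /=.
      have := EE a; have := cE' b; rewrite !subr0 expR0 cos0 => h1 h2.
      have -> : expR a = 1 + E a * a by rewrite -h2; ring.
      have -> : cos b = 1 + c b * b by rewrite -h1; ring.
      by ring.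
    have := EE a; have := SE b; rewrite !subr0 expR0 sin0 => h1 h2.
    have -> : expR a = 1 + E a * a by rewrite -h2; ring.
    have -> : sin b = S b * b by rewrite -h1; ring.
    by ring.
  rewrite ReIm (le_trans (normc_bd _)) //= /phi mulrDl lerD //.
    rewrite (le_trans (ler_normD _ _)) // mulrDl !normrM.
    by apply: lerD; rewrite mulrC; apply: ler_wpM2l => //; [exact: normc_Re|exact: normc_Im].
  by rewrite normrM mulrC; apply: ler_wpM2l => //; exact: normc_Im.
apply/(@contT_eps R C) => e e0; move/contRe: cphi => /(_ _ e0); rewrite phi0.
apply: filterS => z; rewrite subr0 eqxx => hz.
have [_|z0] := eqVneq z 0; first by rewrite subrr ComplexField.Normc.normc0.
by apply: le_lt_trans (hphi z z0) _; apply: le_lt_trans hz; exact: ler_norm.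
Qed.

Lemma cexp_slope (a : K) : exists2 k : K -> K, @contc R C k a &
  k a = cexp a /\ forall z, cexp z - cexp a = k z * (z - a).
Proof.
have [k ck [k0 kE]] := cexp_slope0.
exists (fun z => cexp a * k (z - a)).
  apply: contM; first exact: contcst.
  apply: (@contc_comp R C (fun z : K => z - a) k); first exact: contBid.
  by rewrite subrr; exact: ck.
rewrite subrr k0 mulr1; split => // z.
by rewrite -mulrA -kE mulrBr -cexpD mulr1 [a + _]addrC subrK.
Qed.

Lemma cdiff_cexp (a : K) : cdiff (@cexp) a.
Proof. by have [k ck [_ kE]] := cexp_slope a; exists k. Qed.

(* A logarithm on the right half-plane only. *)
Definition clog (z : K) : K := lnc z +i* atan (complex.Im z / complex.Re z).

Lemma clogK z : 0 < complex.Re z -> cexp (clog z) = z.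
Proof.
move=> z0; rewrite /cexp /clog /=.
set t := _ / _; have t1 : 0 < 1 + t ^+ 2 by rewrite ltr_pwDl // sqr_ge0.
have s0 : 0 < Num.sqrt (1 + t ^+ 2) by rewrite sqrtr_gt0.
have zn0 : z != 0 by apply/eqP => zE; move: z0; rewrite zE ltxx.
have st : sin (atan t) = t * cos (atan t).
  have c0 : cos (atan t) != 0 by rewrite cos_atan invr_neq0 // gt_eqF.
  by rewrite -{2}(atanK t) /tan divfK.
have nz : normc z = complex.Re z * Num.sqrt (1 + t ^+ 2).
  have <- : Num.sqrt (complex.Re z ^+ 2) = complex.Re z by rewrite sqrtr_sqr gtr0_norm.
  rewrite -sqrtrM ?sqr_ge0 //; case: z z0 @t {t1 s0 zn0 st} => a b /= a0 ; congr Num.sqrt.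
  by field; rewrite gt_eqF.
rewrite /lnc lnK ?posrE ?normc_gt0 // /cis st cos_atan nz.
apply: complex_ext => /=; rewrite !mul0r ?addr0 ?subr0.
  by rewrite -mulrA divff ?mulr1 // gt_eqF.
rewrite -[X in X = _]/(_ * (_ / _)) mulrCA -[in X in _ * X]mulrA divff ?gt_eqF // mulr1 /t.
by rewrite divfK // gt_eqF.
Qed.

Lemma cont_clog (z : K) : 0 < complex.Re z -> @contc R C clog z.
Proof.
move=> z0; have zn0 : z != 0 by apply/eqP => zE; move: z0; rewrite zE ltxx.
apply: (@cont_complex R C (@lnc R) (fun z : K => atan (complex.Im z / complex.Re z))).
  by apply: (@cont_lnc R C (fun z => z)); [exact: contid|exact: zn0].
apply: (@contr_comp C (fun z : K => complex.Im z / complex.Re z)); last exact: continuous_atan.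
apply: contRM; first by apply: cont_Im; exact: contid.
apply: (@continuousV R C (fun w : K => complex.Re w) (z : C)); first by rewrite gt_eqF.
by apply: cont_Re; exact: contid.
Qed.

Lemma cdiff_clog (z : K) : 0 < complex.Re z -> cdiff clog z.
Proof.
move=> z0; have [k ck [k0 kE]] := cexp_slope (clog z).
have Rp : \forall w \near (z : C), 0 < complex.Re w.
  have /contRe : @contr R C (fun z : K => complex.Re z) z by apply: cont_Re; exact: contid.
  move=> /(_ _ z0); apply: filterS => w; rewrite ltr_norml => /andP[h _]; lra.
apply: (@cdiff_near R (fun w => if 0 < complex.Re w then clog w else clog w)).
  by apply: filterS Rp => w ->.
exists (fun w => if 0 < complex.Re w then (k (clog w))^-1 else (clog w - clog z) / (w - z)).
  apply: (@contc_near R C (fun w => (k (clog w))^-1)); first by apply: filterS Rp => w ->.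
  apply: contV; first by rewrite k0 cexp_neq0.
  by apply: (contc_comp (cont_clog z0)); exact: ck.
move=> w; rewrite z0; case: ifPn => [w0|w0]; last first.
  rewrite divfK // subr_eq0; apply/eqP => wz; move: w0; by rewrite wz z0.
have := kE (clog w); rewrite !clogK // => h.
have [kw|kw] := eqVneq (k (clog w)) 0; last by rewrite h mulKf.
by move/eqP: h; rewrite kw mul0r subr_eq0 => /eqP->; rewrite !subrr mulr0.
Qed.

Definition cpow (al : R) (z : K) : K := cexp (al%:C * clog z).

Lemma cdiff_cpow al z : 0 < complex.Re z -> cdiff (cpow al) z.
Proof.
move=> z0; apply: (@cdiff_comp R (fun z => al%:C * clog z) (@cexp)); last exact: cdiff_cexp.
by apply: cdiffM; [exact: cdiff_cst|exact: cdiff_clog].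
Qed.

Lemma cpow_neq0 al z : cpow al z != 0.
Proof. exact: cexp_neq0. Qed.

Lemma lnc_cpow al z : lnc (cpow al z) = al * lnc z.
Proof. by rewrite /cpow lnc_cexp /clog /=; ring. Qed.

Lemma cpow_cis al t : - (pi / 2) < t < pi / 2 -> cpow al (cis t) = cis (al * t).
Proof.
move=> tp; rewrite /cpow /clog /lnc normc_cis ln1 /= -/(tan t).
rewrite tanK; last by rewrite in_itv.
by rewrite /cexp /= !mul0r subr0 mulr0 expR0 addr0 mul1r.
Qed.

(** Connectedness of the line. [T] is a bare type because the lemma serves complex values, truth
    values and root counts alike. *)
Lemma locally_cst_R (T : Type) (G : R -> T) :
  (forall t, \forall s \near t, G s = G t) -> forall s t, G s = G t.
Proof.
move=> H s t; have cT : connected [set: R].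
  by apply/connected_intervalP => x y _ _ z _.
have oG (b : T) : open [set u | G u = b].
  rewrite openE => u /= <-; exact: H.
have cG : closed [set u | G u = G t].
  rewrite -openC (_ : ~` _ = \bigcup_(b in [set b | b <> G t]) [set u | G u = b]).
    by apply: bigcup_open => b _; exact: oG.
  by apply/seteqP; split => [u /= ?|u [b /= bt ->]]; [exists (G u)|].
have E : [set u | G u = G t] = [set: R].
  apply: cT; first by exists t.
    by exists [set u | G u = G t]; [exact: oG|rewrite setTI].
  by exists [set u | G u = G t] => //; rewrite setTI.
by have : [set: R] s by []; rewrite -E.
Qed.

(** For the fractional part y of x, cos (2 pi y) = 1 - 2 sin (pi y)^2, and sin (pi y) > 0 when 0 < y
    < 1. *)
Lemma cos_2pi_int (x : R) : cos (2 * pi * x) = 1 -> x \is a Num.int.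
Proof.
move=> cx; pose k := Num.floor x; pose y := x - k%:~R.
have /andP[k1 k2] := floor_itv x; rewrite intrD -/k in k1 k2.
have per (j : int) (t : R) : cos (t - 2 * pi * j%:~R) = cos t /\ sin (t - 2 * pi * j%:~R) = sin t.
  have pn (n : nat) (u : R) : cos (u + 2 * pi * n%:R) = cos u /\ sin (u + 2 * pi * n%:R) = sin u.
    elim: n u => [|n IH] u; first by rewrite mulr0 addr0.
    have -> : u + 2 * pi * n.+1%:R = (u + 2 * pi * n%:R) + pi *+ 2 by rewrite -[n.+1%:R]natr1 mulr2n; ring.
    have [h1 h2] := IH u.
    by rewrite (cosD _ (pi *+ 2)) (sinD _ (pi *+ 2)) cos2pi sin2pi !mulr1 !mulr0 subr0 addr0.
  case: j => n.
    by have [h1 h2] := pn n (t - 2 * pi * n%:R); rewrite subrK in h1 h2.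
  by rewrite NegzE mulrNz mulrN opprK; exact: pn.
have cy : cos (2 * pi * y) = 1 by rewrite /y mulrBr; rewrite (per k _).1.
have y0 : 0 <= y by rewrite subr_ge0.
have y1 : y < 1 by rewrite ltrBlDr addrC.
have [y00|yp] := eqVneq y 0.
  by apply/intrP; exists k; apply/eqP; rewrite -subr_eq0 -/y y00.
exfalso; have p0 := pi_gt0 R.
have yp0 : 0 < y by rewrite lt_def yp.
have : 0 < sin (pi * y).
  by apply: sin_gt0_pi; apply/andP; split; nra.
have e : (pi * y) *+ 2 = 2 * pi * y by rewrite -mulr_natl mulrA.
have := cos_mulr2n (pi * y); rewrite e cy cos2sin2 => h hs.
have : sin (pi * y) ^+ 2 = 0 by rewrite mulr2n in h; lra.
by move/eqP; rewrite sqrf_eq0 => /eqP s0; rewrite s0 ltxx in hs.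
Qed.

(* F ~ (phi - a1)^al (phi - a2)^be along a loop around a1 on which phi runs
   through a circle that leaves a2 outside. *)
Lemma exponent_int (al be rho C0 : R) (a1 a2 : K) (z : R -> K) (phi F : K -> K) :
  0 < rho -> rho < normc (a1 - a2) ->
  (forall t, @contc R R z t) -> (forall t, phi (z t) = a1 + rho%:C * cis t) ->
  z (2 * pi) = z 0 ->
  (forall t, \forall w \near (z t : C), [/\ cdiff phi w, cdiff F w, phi w != a1,
     phi w != a2 & F w != 0 /\ lnc (F w) = al * lnc (phi w - a1) + be * lnc (phi w - a2) + C0]) ->
  al \is a Num.int.
Proof.
move=> rho0 rhod cz phiz zper Hn.
have a12 : a1 - a2 != 0 by rewrite -normc_gt0 (lt_trans rho0).
have rn0 : rho%:C != 0 :> K by rewrite -normc_gt0 normc_real normr_gt0 gt_eqF.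
(* Since rho < |a1 - a2|, q stays in the right half-plane along the loop, where its power has the
   single branch [cpow be]. *)
pose q w := (phi w - a2) / (a1 - a2).
have qz t : 0 < complex.Re (q (z t)).
  have -> : q (z t) = 1 + rho%:C * cis t / (a1 - a2) by rewrite /q phiz; field.
  set v := _ / _; have : normc v < 1.
    by rewrite normcMM normcMM normc_cis mulr1 normc_real gtr0_norm // normcVV ltr_pdivrMr ?mul1r ?normc_gt0.
  move=> /(le_lt_trans (normc_Re v)); rewrite ltr_norml => /andP[h _].
  by case: (v) h => ? ? /= h; lra.
pose b t := cpow be (q (z t)).
(* rho^al cis (al t) continues (phi - a1)^al along the loop. Up to a constant factor, G is F over
   this continuation and the power of q, hence constant; its values at 0 and 2 pi give cis (- 2 pi
   al) = 1. *)
pose G t := F (z t) * cis (- al * t) / b t.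
have cstG : forall s t, G s = G t.
  apply: locally_cst_R => t0.
  (* Division by rho cis t0 brings phi - a1 close to 1, into the domain of [cpow al]; the formula
     for [lnc (F w)] then makes |H| constant near z t0. *)
  pose H w := F w / (cpow al ((phi w - a1) / (rho%:C * cis t0)) * cpow be (q w)).
  have rc0 : rho%:C * cis t0 != 0 by rewrite mulf_neq0 // cis_neq0.
  have p1 : (phi (z t0) - a1) / (rho%:C * cis t0) = 1 by rewrite phiz [a1 + _]addrC addrK divff.
  have cphi : @contc R C phi (z t0) by apply: cdiff_cont; have [] := nbhs_singleton (Hn t0).
  have ReP (g : K -> K) w : @contc R C g w -> 0 < complex.Re (g w) -> \forall v \near (w : C), 0 < complex.Re (g v).
    move=> cg g0; have /contRe : @contr R C (fun v => complex.Re (g v)) w by apply: cont_Re.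
    move=> /(_ _ g0); apply: filterS => v; rewrite ltr_norml => /andP[h _]; lra.
  have n1 : \forall w \near (z t0 : C), 0 < complex.Re ((phi w - a1) / (rho%:C * cis t0)).
    apply: (ReP (fun w => (phi w - a1) / (rho%:C * cis t0))); last by rewrite p1 /=.
    by apply: contM; [apply: contB; [exact: cphi|exact: contcst]|exact: contcst].
  have n2 : \forall w \near (z t0 : C), 0 < complex.Re (q w).
    apply: (ReP q); last exact: qz.
    by apply: contM; [apply: contB; [exact: cphi|exact: contcst]|exact: contcst].
  have Hcst : \forall w \near (z t0 : C), H w = H (z t0).
    have [_ _ _ _ [F0 _]] := nbhs_singleton (Hn t0).
    apply: cst_normc_near; first by rewrite mulf_neq0 // invr_neq0 // mulf_neq0 // cpow_neq0.
    have HE w : [/\ cdiff phi w, cdiff F w, phi w != a1,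
     phi w != a2 & F w != 0 /\ lnc (F w) = al * lnc (phi w - a1) + be * lnc (phi w - a2) + C0] ->
       lnc (H w) = C0 + al * ln rho + be * lnc (a1 - a2).
      move=> [_ _ w1 w2 [Fw FE]]; rewrite /H.
      have X1 : cpow al ((phi w - a1) / (rho%:C * cis t0)) * cpow be (q w) != 0 by rewrite mulf_neq0 // cpow_neq0.
      rewrite lncM ?invr_neq0 // lncV // lncM ?cpow_neq0 // !lnc_cpow.
      have -> : lnc (q w) = lnc (phi w - a2) - lnc (a1 - a2).
        by rewrite /q lncM ?invr_neq0 // ?subr_eq0 // lncV.
      have -> : lnc ((phi w - a1) / (rho%:C * cis t0)) = lnc (phi w - a1) - ln rho.
        rewrite lncM ?invr_neq0 // ?subr_eq0 // lncV // lncM ?cis_neq0 //.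
        by rewrite /lnc normc_cis ln1 addr0 normc_real gtr0_norm.
      by rewrite FE; ring.
    have HE0 := HE _ (nbhs_singleton (Hn t0)).
    move: (Hn t0) n1 n2; apply: filterS3 => w Hw h1 h2; split; last first.
      have [_ _ _ _ [Fw _]] := Hw.
      have X0 v : F v != 0 -> H v != 0 by move=> Fv; rewrite mulf_neq0 // invr_neq0 // mulf_neq0 // cpow_neq0.
      have := HE _ Hw; rewrite -HE0 /lnc => /ln_inj; apply; rewrite posrE normc_gt0; exact: X0.
    have [dp dF _ _ _] := Hw; apply: cdiffM; first exact: dF.
    apply: (@cdiffV R (fun w => cpow al ((phi w - a1) / (rho%:C * cis t0)) * cpow be (q w))).
      by rewrite mulf_neq0 // cpow_neq0.
    apply: cdiffM.
      apply: (@cdiff_comp R (fun w => (phi w - a1) / (rho%:C * cis t0)) (cpow al)); last exact: cdiff_cpow.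
      by apply: cdiffM; [apply: cdiffB; [exact: dp|exact: cdiff_cst]|exact: cdiff_cst].
    apply: (@cdiff_comp R q (cpow be)); last exact: cdiff_cpow.
    by apply: cdiffM; [apply: cdiffB; [exact: dp|exact: cdiff_cst]|exact: cdiff_cst].
  have Hz : \forall t \near t0, H (z t) = H (z t0) := cz t0 _ Hcst.
  have Hp : \forall t \near t0, - (pi / 2) < t - t0 < pi / 2.
    have p20 : 0 < pi / 2 :> R by rewrite divr_gt0 // pi_gt0.
    apply/nbhs_ballP; exists (pi / 2) => // t; rewrite /ball /= distrC ltr_norml //.
  have p20 : 0 < pi / 2 :> R by rewrite divr_gt0 // pi_gt0.
  have HG t : - (pi / 2) < t - t0 < pi / 2 -> H (z t) = G t * cis (al * t0).
    move=> tt; rewrite /H /G phiz [a1 + _]addrC addrK.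
    have -> : rho%:C * cis t / (rho%:C * cis t0) = cis (t - t0).
      by rewrite cisD cisN; field; rewrite rn0 cis_neq0.
    rewrite cpow_cis // -/(b t).
    have -> : cis (- al * t) = (cis (al * (t - t0)))^-1 / cis (al * t0).
      by rewrite -!cisN -cisD; congr cis; ring.
    by field; rewrite !cis_neq0 cpow_neq0.
  move: Hz Hp; apply: filterS2 => t Hz Hp; move: Hz; rewrite !HG // ?subrr; last first.
    by rewrite oppr_lt0 p20.
  by move/mulIf; apply; exact: cis_neq0.
have := cstG (2 * pi) 0; rewrite /G /b zper mulr0 cis0 mulr1 => h.
have [_ _ _ _ [F0 _]] := nbhs_singleton (Hn 0).
have : cis (- al * (2 * pi)) = 1.
  move: h => /(congr1 (fun x => x * cpow be (q (z 0)))); rewrite !divfK ?cpow_neq0 // => /(canRL (mulKf F0)) ->.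
  by rewrite mulVf.
move=> /(congr1 (fun z => complex.Re z)); rewrite /= mulNr cosN mulrC.
exact: cos_2pi_int.
Qed.

End ComplexPower.

(** * Continuity of roots *)

Section RootContinuity.
Variable R : realType.
Local Notation C := (cplx R).
Local Notation K := R[i].
Local Notation normc := ComplexField.Normc.normc.

Definition prodr (s : seq K) : {poly K} := \prod_(z <- s) ('X - z%:P).

Lemma normc_sum n (f : 'I_n -> K) : normc (\sum_i f i) <= \sum_i normc (f i).
Proof.
elim: n f => [|n IH] f; first by rewrite !big_ord0 ComplexField.Normc.normc0.
by rewrite !big_ord_recl (le_trans (normcD _ _)) // lerD2l.
Qed.

(** Otherwise the product of the distances from r to [ss] is at least eta^n, whereas p.[r] = 0 and
    the closeness of the coefficients make it smaller. *)
Lemma near_root (p : {poly K}) (ss : seq K) (r : K) (d eta : R) : 0 < eta ->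
  size p = (size ss).+1 -> p.[r] = 0 ->
  (forall i, normc ((prodr ss)`_i - p`_i) <= d) ->
  d * \sum_(i < (size ss).+1) normc r ^+ i < eta ^+ size ss ->
  exists2 s, s \in ss & normc (s - r) < eta.
Proof.
move=> eta0 sp pr Hd small; apply: contrapT => H.
have far s : s \in ss -> eta <= normc (r - s).
  by move=> sss; rewrite leNgt; apply/negP => h; apply: H; exists s => //; rewrite normcB.
have h1 : eta ^+ size ss <= normc (prodr ss).[r].
  rewrite /prodr horner_prod; elim: {sp Hd small H} ss far => [|s ss IH] far.
    by rewrite big_nil expr0 ComplexField.Normc.normc1.
  rewrite big_cons /= exprS normcMM hornerXsubC.
  apply: ler_pM; [exact: ltW|exact: exprn_ge0 (ltW eta0)|by apply: far; rewrite inE eqxx|].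
  by apply: IH => t tss; apply: far; rewrite inE tss orbT.
have : normc (prodr ss).[r] <= d * \sum_(i < (size ss).+1) normc r ^+ i.
  have -> : (prodr ss).[r] = ((prodr ss) - p).[r] by rewrite hornerD hornerN pr subr0.
  rewrite (@horner_coef_wide _ (size ss).+1); last first.
    by rewrite (leq_trans (size_polyD _ _)) // size_polyN sp geq_max size_prod_XsubC !leqnn.
  rewrite mulr_sumr; apply: le_trans (normc_sum _) _; apply: ler_sum => i _.
  by rewrite normcMM normcX ler_wpM2r ?exprn_ge0 ?normc_ge0 // coefB.
by move=> h2; have := le_lt_trans (le_trans h1 h2) small; rewrite ltxx.
Qed.

(* Synthetic division by 'X - s, from the top coefficient down. *)
Lemma coef_quot (e : {poly K}) (s : K) (n : nat) (G B : R) : 0 <= B ->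
  normc s <= B -> (size e <= n)%N ->
  (forall i, normc ((('X - s%:P) * e)`_i) <= G) ->
  forall i, normc (e`_i) <= G * \sum_(j < n) B ^+ j.
Proof.
move=> B0 sB en HG i; have G0 : 0 <= G by apply: le_trans (HG 0%N); exact: normc_ge0.
have step k : normc (e`_(n - k)) <= G * \sum_(j < k) B ^+ j.
  elim: k => [|k IH].
    by rewrite subn0 nth_default // ComplexField.Normc.normc0 big_ord0 mulr0.
  have [nk|kn] := leqP n k.
    have -> : (n - k.+1 = n - k)%N by lia.
    apply: le_trans IH _; rewrite ler_wpM2l // big_ord_recr /= lerDl exprn_ge0 //.
  have := HG (n - k)%N; have -> : (n - k = (n - k.+1).+1)%N by lia.
  rewrite mulrBl coefB coefXM coefCM /= => h.
  have -> : e`_(n - k.+1) = (e`_(n - k.+1) - s * e`_((n - k.+1).+1)) + s * e`_((n - k.+1).+1) by rewrite subrK.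
  apply: le_trans (normcD _ _) _.
  rewrite big_ord_recl expr0 mulrDr mulr1; apply: lerD; first exact: h.
  rewrite normcMM; have -> : ((n - k.+1).+1 = n - k)%N by lia.
  rewrite (eq_bigr (fun i : 'I_k => B * B ^+ i)); last by move=> j _; rewrite -exprS.
  rewrite -mulr_sumr mulrCA; apply: ler_pM => //; exact: normc_ge0.
have [ni|i_n] := leqP n i.
  by rewrite nth_default ?(leq_trans en) // ComplexField.Normc.normc0 mulr_ge0 // sumr_ge0 // => j _; exact: exprn_ge0.
have -> : i = (n - (n - i))%N by lia.
apply: le_trans (step _) _; rewrite ler_wpM2l //.
have -> : (n = (n - i) + i)%N by lia.
move: (n - i)%N => m; rewrite addnK big_split_ord /= lerDl sumr_ge0 // => j _; exact: exprn_ge0.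
Qed.

Definition inset (V : set C) : pred K := fun z => `[< V z >].

(** Induction on the roots: a nearby root s is matched to r and both factors are divided out,
    [coef_quot] keeping the quotients close. Only a lower bound can hold, since roots on the
    boundary of an open set may move into it. *)
Lemma count_lsc (V : set C) (rs : seq K) : open V ->
  exists2 d : R, 0 < d & forall ss, size ss = size rs ->
    (forall i, normc ((prodr ss)`_i - (prodr rs)`_i) <= d) ->
    (count (inset V) rs <= count (inset V) ss)%N.
Proof.
move=> oV; elim: rs => [|r rs [d1 d10 IH]]; first by exists 1.
pose n := (size rs).+1; pose B := normc r + 1.
have B0 : 0 <= B by rewrite addr_ge0 ?normc_ge0.
pose T := \sum_(j < n) B ^+ j + 1.
have T0 : 0 < T by rewrite ltr_wpDl // sumr_ge0 // => j _; exact: exprn_ge0.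
have [M M0 MP] : exists2 M : R, 0 < M & forall i, normc ((prodr rs)`_i) <= M.
  exists (\sum_(i < n) normc ((prodr rs)`_i) + 1).
    by rewrite ltr_wpDl // sumr_ge0 // => j _; exact: normc_ge0.
  move=> i; have S0 : 0 <= \sum_(i < n) normc ((prodr rs)`_i).
    by rewrite sumr_ge0 // => j _; exact: normc_ge0.
  have [i_n|ni] := ltnP i n; last first.
    by rewrite nth_default ?size_prod_XsubC // ComplexField.Normc.normc0 addr_ge0.
  rewrite (bigD1 (Ordinal i_n)) //= -addrA lerDl addr_ge0 // sumr_ge0 // => j _.
  exact: normc_ge0.
have [eta [eta0 eta1 etaM etaV]] : exists eta : R, [/\ 0 < eta, eta <= 1, 2 * (eta * M * T) <= d1 &
     V r -> forall s, normc (s - r) < eta -> V s].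
  have [e0 e00 e0V] : exists2 e : R, 0 < e & V r -> forall s, normc (s - r) < e -> V s.
    have [Vr|Vr] := pselect (V r); last by exists 1.
    have /nbhs_cplx[e e0 He] : nbhs (r : C) V by apply: open_nbhs_nbhs.
    by exists e.
  exists (Num.min (Num.min e0 1) (d1 / (2 * M * T))); split.
  - by rewrite !lt_min e00 ltr01 divr_gt0 // !mulr_gt0.
  - by rewrite !ge_min lexx orbT.
  - set q := Num.min _ _; have : q <= d1 / (2 * M * T) by rewrite /q ge_min lexx orbT.
    by rewrite ler_pdivlMr ?mulr_gt0 // => h; apply: le_trans h; rewrite le_eqVlt; apply/orP; left; apply/eqP; ring.
  - by move=> Vr s hs; apply: e0V => //; apply: lt_le_trans hs _; rewrite !ge_min lexx.
pose Sr := \sum_(i < n.+1) normc r ^+ i + 1.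
have Sr0 : 0 < Sr by rewrite ltr_wpDl // sumr_ge0 // => j _; rewrite exprn_ge0 // normc_ge0.
(* The first bound gives d T <= d1 / 2, and the bound on eta M T supplies the other half; the second
   makes [near_root] apply with eta. *)
pose d := Num.min (d1 / (2 * T)) (eta ^+ n / (2 * Sr)).
have d0 : 0 < d by rewrite lt_min !divr_gt0 ?mulr_gt0 // exprn_gt0.
exists d => // ss sss Hd.
have [|||s sin sr] := @near_root (prodr (r :: rs)) ss r d eta eta0 _ _ Hd.
- by rewrite size_prod_XsubC sss.
- by rewrite /prodr big_cons hornerM hornerXsubC subrr mul0r.
- rewrite sss /= -/n; apply: le_lt_trans (_ : eta ^+ n / (2 * Sr) * Sr < _).
    apply: ler_pM; [exact: ltW|by rewrite sumr_ge0 // => j _; rewrite exprn_ge0 // normc_ge0|by rewrite ge_min lexx orbT|by rewrite /Sr lerDl].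
  have -> : eta ^+ n / (2 * Sr) * Sr = eta ^+ n / 2 by field; rewrite gt_eqF.
  by rewrite ltr_pdivrMr // ltr_pMr ?exprn_gt0 // ltr1n.
have perm := perm_to_rem sin; have szr : size (rem s ss) = size rs by rewrite size_rem // sss.
rewrite (permP perm) /=; apply: leq_add.
  rewrite /inset; case: asboolP => // Vr; rewrite (asboolT (etaV Vr s sr)) //.
apply: IH => // i.
pose e := prodr (rem s ss) - prodr rs.
have eE : ('X - s%:P) * e = (prodr ss - prodr (r :: rs)) + (s - r)%:P * prodr rs.
  have -> : prodr ss = ('X - s%:P) * prodr (rem s ss) by rewrite /prodr (perm_big _ perm) big_cons.
  by rewrite {2}/prodr big_cons -/(prodr rs) /e polyCB; ring.
have := @coef_quot e s n (d + eta * M) B B0 _ _ _ i.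
rewrite coefB; move=> H; apply: le_trans (H _ _ _) _.
- rewrite -[s](subrK r) addrC (le_trans (normcD _ _)) // lerD2l (le_trans (ltW sr)) //.
- by rewrite (leq_trans (size_polyD _ _)) // size_polyN !size_prod_XsubC szr maxnn.
- move=> j; rewrite eE coefD coefB coefCM (le_trans (normcD _ _)) // lerD //.
  by rewrite normcMM; apply: ler_pM; rewrite ?normc_ge0 // ltW.
have h1 : d * T <= d1 / 2.
  apply: le_trans (_ : d1 / (2 * T) * T <= _).
    by apply: ler_wpM2r; [exact: ltW|rewrite ge_min lexx].
  by rewrite le_eqVlt; apply/orP; left; apply/eqP; field; rewrite gt_eqF.
apply: le_trans (_ : (d + eta * M) * T <= _).
  by rewrite ler_wpM2l ?addr_ge0 ?mulr_ge0 ?ltW // /T ltrDl.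
by rewrite mulrDl; lra.
Qed.

(** The roots of p - v listed with multiplicity; counting in this list replaces an argument
    principle. *)
Definition fib (p : {poly K}) (v : K) : seq K :=
  sval (closed_field_poly_normal (p - v%:P)).

(** * Fibres of a polynomial *)

Section Fibers.
Variables (p : {poly K}) (n : nat).
Hypothesis (sp : size p = n.+2).

Lemma size_subC v : size (p - v%:P) = n.+2.
Proof. by rewrite size_polyDl // size_polyN sp (leq_ltn_trans (size_polyC_leq1 _)). Qed.

Lemma lead_neq0 : p`_n.+1 != 0.
Proof. by have := lead_coef_eq0 p; rewrite lead_coefE sp /= => ->; rewrite -size_poly_eq0 sp. Qed.

Lemma fibE v : p - v%:P = p`_n.+1 *: prodr (fib p v).
Proof.
rewrite {1}(svalP (closed_field_poly_normal (p - v%:P))) -/(fib p v); congr (_ *: _).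
by rewrite lead_coefE size_subC /= coefB coefC /= subr0.
Qed.

Lemma size_fib v : size (fib p v) = n.+1.
Proof.
have := size_subC v; rewrite fibE size_scale ?lead_neq0 // size_prod_XsubC.
by move=> [].
Qed.

Lemma mem_fib v z : (z \in fib p v) = (p.[z] == v).
Proof.
rewrite -root_prod_XsubC -/(prodr _) -(rootZ _ _ lead_neq0) -fibE.
by rewrite rootE hornerD hornerN hornerC subr_eq0.
Qed.

Lemma mup_fib v z : mup z (p - v%:P) = count_mem z (fib p v).
Proof.
rewrite fibE -mul_polyC mupMr ?mu_prod_XsubC //.
by rewrite rootC lead_neq0.
Qed.

Lemma deriv_fib v z : z \in fib p v ->
  (p^`().[z] == 0) = (z \in rem z (fib p v)).
Proof.
move=> zin; have perm := perm_to_rem zin.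
have -> : p^`() = (p - v%:P)^`() by rewrite derivB derivC subr0.
rewrite fibE derivZ hornerZ mulf_eq0 (negbTE lead_neq0) /=.
rewrite /prodr (perm_big _ perm) big_cons derivM derivXsubC mul1r.
rewrite hornerD hornerM hornerXsubC subrr mul0r addr0 -root_prod_XsubC.
by rewrite rootE.
Qed.

Lemma uniq_no_rem (T : eqType) (s : seq T) :
  (forall z, z \in s -> z \notin rem z s) -> uniq s.
Proof.
elim: s => [//|x s IH] H /=; have := H x; rewrite inE eqxx /= eqxx => /(_ isT) xs.
rewrite xs /=; apply: IH => z zs.
have := H z; rewrite inE zs orbT /= => /(_ isT).
have xz : (x == z) = false by apply/eqP => xz; rewrite xz zs in xs.
by rewrite xz inE eq_sym xz.
Qed.

Lemma uniq_fib v : (forall z, p.[z] = v -> p^`().[z] != 0) -> uniq (fib p v).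
Proof.
move=> H; apply: uniq_no_rem => z zin; rewrite -deriv_fib //; apply: H.
by apply/eqP; rewrite -mem_fib.
Qed.

Lemma fib_lsc (V : set C) (v0 : K) : open V ->
  \forall v \near (v0 : C), (count (inset V) (fib p v0) <= count (inset V) (fib p v))%N.
Proof.
move=> oV; have [d d0 dP] := count_lsc (fib p v0) oV.
apply/nbhs_cplx; exists (d * normc (p`_n.+1)); first by rewrite mulr_gt0 ?normc_gt0 ?lead_neq0.
move=> v vd; apply: dP => [|i]; first by rewrite !size_fib.
have prE u : prodr (fib p u) = (p`_n.+1)^-1 *: (p - u%:P).
  by rewrite fibE scalerA mulVf ?lead_neq0 // scale1r.
rewrite !prE !coefZ !coefB !coefC -mulrBr normcMM normcVV mulrC ler_pdivrMr ?normc_gt0 ?lead_neq0 //.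
case: ifP => _; last by rewrite subrr ComplexField.Normc.normc0 mulr_ge0 ?ltW // normc_gt0 lead_neq0.
have -> : p`_i - v - (p`_i - v0) = v0 - v by ring.
by rewrite normcB ltW.
Qed.

(** Near v0 neither count can decrease, and at v0 their sum is already the degree. *)
Lemma fib_locally_cst (V1 V2 : set C) (v0 : K) : open V1 -> open V2 ->
  V1 `&` V2 = set0 -> (forall z, p.[z] = v0 -> V1 z \/ V2 z) ->
  \forall v \near (v0 : C), count (inset V1) (fib p v) = count (inset V1) (fib p v0).
Proof.
move=> o1 o2 V12 cov; have := fib_lsc v0 o2; have := fib_lsc v0 o1.
apply: filterS2 => v h1 h2; apply/eqP; rewrite eqn_leq h1 andbT.
have dis s : (count (inset V1) s + count (inset V2) s = count (predU (inset V1) (inset V2)) s)%N.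
  rewrite -count_predUI [X in (_ + X)%N](_ : _ = 0%N) ?addn0 //.
  apply/eqP; rewrite -leqn0 leqNgt -has_count; apply/hasPn => z _ /=.
  apply/negP => /andP[/asboolP z1 /asboolP z2].
  by have : (V1 `&` V2) z by []; rewrite V12.
have tot : count (predU (inset V1) (inset V2)) (fib p v0) = n.+1.
  rewrite -(size_fib v0); apply/eqP; rewrite -all_count; apply/allP => z.
  rewrite mem_fib => /eqP /cov[] h; apply/orP; [left|right]; exact/asboolP.
have le : (count (predU (inset V1) (inset V2)) (fib p v) <= n.+1)%N.
  by rewrite -(size_fib v) count_size.
move: (dis (fib p v)) (dis (fib p v0)); rewrite tot; lia.
Qed.

Lemma avoid_seq (s : seq K) (v0 : K) (e : R) : 0 < e ->
  exists2 v, normc (v - v0) < e & v \notin s.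
Proof.
move=> e0; apply: contrapT => H.
pose g (k : nat) : K := v0 + (e / k.+2%:R)%:C.
have gs k : g k \in s.
  apply: contrapT => /negP gk; apply: H; exists (g k) => //.
  rewrite /g addrC addKr normc_real gtr0_norm; last by rewrite divr_gt0 // ltr0n.
  by rewrite ltr_pdivrMr ?ltr0n // ltr_pMr // ltr1n.
have gi : injective g.
  move=> i j /addrI /complexI /(mulfI (lt0r_neq0 e0)) /invr_inj /eqP.
  by rewrite eqr_nat => /eqP[].
have u : uniq (map g (iota 0 (size s).+1)) by rewrite map_inj_uniq // iota_uniq.
have /(uniq_leq_size u) : {subset map g (iota 0 (size s).+1) <= s}.
  by move=> _ /mapP[k _ ->].
by rewrite size_map size_iota ltnn.
Qed.

Lemma count2P (T : eqType) (a : pred T) (s : seq T) : uniq s -> (1 < count a s)%N ->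
  exists x y, [/\ x != y, a x, a y, x \in s & y \in s].
Proof.
move=> us; rewrite -size_filter; have := filter_uniq a us.
case E : [seq x <- s | a x] => [//|x [//|y t]] /= /andP[]; rewrite inE negb_or => /andP[xy _] _ _.
have := mem_filter a x s; rewrite E !inE eqxx /= => /esym/andP[ax xs].
have := mem_filter a y s; rewrite E !inE eqxx orbT /= => /esym/andP[ay ys].
by exists x, y.
Qed.

(** The double root over p.[z] persists as at least two roots near z over every nearby v; for v not
    a critical value these are distinct. *)
Lemma critical_not_inj (z : K) (U : set C) : nbhs (z : C) U -> p^`().[z] = 0 ->
  exists x y, [/\ x != y, U x, U y & p.[x] = p.[y]].
Proof.
move=> /nbhs_cplx[e e0 eU] pz0; pose V : set C := [set w : K | normc (w - z) < e].
have oV : open V.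
  rewrite openE => w /= wz; apply/nbhs_cplx; exists (e - normc (w - z)).
    by rewrite subr_gt0.
  move=> v vw; rewrite /V /= -(subrK w v) -addrA (le_lt_trans (normcD _ _)) //.
  by rewrite -ltrBrDr.
have zin : z \in fib p p.[z] by rewrite mem_fib.
have Vz : inset V z by apply/asboolP; rewrite /V /= subrr ComplexField.Normc.normc0.
have c2 : (1 < count (inset V) (fib p p.[z]))%N.
  have := deriv_fib zin; rewrite pz0 eqxx => /esym zr.
  by rewrite (permP (perm_to_rem zin)) /= (permP (perm_to_rem zr)) /= Vz.
have /nbhs_cplx[d d0 dP] := fib_lsc p.[z] oV.
have [v vz vn] := avoid_seq [seq p.[x] | x <- sval (closed_field_poly_normal p^`())] p.[z] d0.
have uv : uniq (fib p v).
  apply: uniq_fib => x pxv; apply/eqP => px0; move/negP: vn; apply.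
  apply/mapP; exists x => //; set s := sval _.
  have p'0 : p^`() != 0.
    apply/eqP => h0; have := coef_deriv p n; rewrite h0 coef0 => /esym/eqP.
    by rewrite mulrn_eq0 /= (negbTE lead_neq0).
  have := svalP (closed_field_poly_normal p^`()); rewrite -/s => h.
  by rewrite -root_prod_XsubC -(rootZ _ _ (_ : lead_coef p^`() != 0)) ?lead_coef_eq0 // -h; apply/eqP.
have [x [y [xy /asboolP Vx /asboolP Vy]]] := count2P uv (leq_trans c2 (dP v vz)).
rewrite !mem_fib => /eqP px /eqP py.
by exists x, y; rewrite px py; split => //; apply: eU.
Qed.

(** The n other roots over p.[z] lie off a closed disc around z, and at least n roots stay off it
    over nearby values; of the n + 1 roots only one can remain in the disc. *)
Lemma noncritical_inj (z : K) : p^`().[z] != 0 ->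
  exists2 U : set C, nbhs (z : C) U & forall x y, U x -> U y -> p.[x] = p.[y] -> x = y.
Proof.
move=> pz; have zin : z \in fib p p.[z] by rewrite mem_fib.
have zr : z \notin rem z (fib p p.[z]) by rewrite -deriv_fib.
have [eta eta0 etaP] : exists2 eta : R, 0 < eta & forall w, w \in rem z (fib p p.[z]) -> eta < normc (w - z).
  elim: (rem z _) zr => [|w s IH]; first by exists 1.
  rewrite inE negb_or => /andP[zw zs]; have [eta eta0 H] := IH zs.
  have h : 0 < normc (w - z) by rewrite normc_gt0 subr_eq0 eq_sym.
  exists (Num.min eta (normc (w - z) / 2)); first by rewrite lt_min eta0 divr_gt0.
  move=> v; rewrite inE => /orP[/eqP->|/H]; first by rewrite gt_min; apply/orP; right; lra.
  by rewrite gt_min => ->.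
pose V : set C := [set w : K | eta < normc (w - z)].
have oV : open V.
  rewrite openE => w /= wz; apply/nbhs_cplx; exists (normc (w - z) - eta).
    by rewrite subr_gt0.
  move=> v vw; rewrite /V /=; have := normcD (w - v) (v - z); rewrite addrA subrK (normcB w v) => h.
  lra.
have c1 : count (inset V) (fib p p.[z]) = n.
  rewrite (permP (perm_to_rem zin)) /= (_ : inset V z = false) ?add0n; last first.
    by apply/asboolP; rewrite /V /= subrr ComplexField.Normc.normc0 => /ltW; rewrite leNgt eta0.
  have -> : n = size (rem z (fib p p.[z])) by rewrite size_rem // size_fib.
  by apply/eqP; rewrite -all_count; apply/allP => w /etaP h; apply/asboolP.
have cnt := fib_lsc p.[z] oV.
have cp : @contc R C (fun w : K => p.[w]) z by apply: cdiff_cont; exact: cdiff_poly.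
have N1 : nbhs (z : C) [set w : C | (count (inset V) (fib p p.[z]) <= count (inset V) (fib p p.[w]))%N] by exact: cp _ cnt.
have N2 : nbhs (z : C) [set w : K | normc (w - z) < eta] by apply/nbhs_cplx; exists eta.
exists ([set w : C | (count (inset V) (fib p p.[z]) <= count (inset V) (fib p p.[w]))%N] `&` [set w : K | normc (w - z) < eta]).
  exact: filterI.
move=> x y [/= hx xz] [_ /= yz] pxy; apply/eqP; apply: contraT => xy.
move: hx; rewrite c1 => hx.
have xin : x \in fib p p.[x] by rewrite mem_fib.
have yin : y \in rem x (fib p p.[x]).
  have yf : y \in fib p p.[x] by rewrite mem_fib pxy.
  by move: yf; rewrite (perm_mem (perm_to_rem xin)) inE eq_sym (negbTE xy).
move: hx; rewrite (permP (perm_to_rem xin)) /= (permP (perm_to_rem yin)) /=.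
have nV w : normc (w - z) < eta -> inset V w = false.
  by move=> wz; apply/asboolP; rewrite /V /=; apply/negP; rewrite -leNgt ltW.
rewrite !nV // !add0n => hx.
have szr : size (rem x (fib p p.[x])) = n by rewrite size_rem // size_fib.
have n0 : (0 < n)%N by rewrite -szr; case: (rem x _) yin.
have := leq_trans hx (count_size _ _); rewrite size_rem // szr; lia.
Qed.

End Fibers.

End RootContinuity.

(** * Conformal maps near infinity and near the boundary *)

Section ConformalMaps.
Variable R : realType.
Local Notation C := (cplx R).
Local Notation K := R[i].
Local Notation Chat := (sphere R).
Local Notation normc := ComplexField.Normc.normc.

Lemma closed_ball_normc (r : R) : closed ([set z : K | normc z <= r] : set C).
Proof. by apply: closed_le_cont => z; apply: cont_normc; exact: contid. Qed.

Lemma compact_ball_normc (r : R) : compact ([set z : K | normc z <= r] : set C).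
Proof. by apply: (@closed_bounded_compact R _ r) => //; exact: closed_ball_normc. Qed.

Lemma compact_bounded_normc (A : set C) : compact A ->
  exists r : R, forall z : K, A z -> normc z <= r.
Proof.
move=> cA; have [A0|A0] := pselect (A !=set0); last first.
  by exists 0 => z Az; exfalso; apply: A0; exists z.
have [|z _ zP] := @EVTc_max R A (fun w => normc w) cA A0.
  by move=> z _; apply: cont_normc; exact: contid.
by exists (normc z).
Qed.

Lemma nbhs_None (U : set Chat) : nbhs (None : Chat) U ->
  exists r : R, forall z : K, r < normc z -> U (Some (z : C)).
Proof.
move=> [W [cW _] WU]; have [r rP] := compact_bounded_normc cW.
exists r => z rz; apply: WU; left; exists z => // /rP; by rewrite leNgt rz.
Qed.

Lemma nbhs_None_ball (r : R) :
  nbhs (None : Chat) [set x : Chat | if x is Some z then r < normc (z : K) else True].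
Proof.
exists [set z : K | normc z <= r].
  by split; [exact: compact_ball_normc|exact: closed_ball_normc].
by move=> x [[z /= /negP h <-]|/= ->//]; move: h; rewrite -ltNge.
Qed.

Lemma nbhs_Some_ball (w : K) (r : R) : 0 < r ->
  nbhs (Some (w : C) : Chat) [set x : Chat | if x is Some z then normc ((z : K) - w) < r else False].
Proof. by move=> r0; apply/(@nbhs_cplx R w); exists r. Qed.

(* The value is 0 where f is infinite. *)
Definition fin (f : Chat -> Chat) (z : K) : K := odflt 0 (f (Some (z : C))).

(** The expansion at infinity speaks only of finite points. A finite value at infinity would, by
    continuity, keep f bounded near infinity, against the growth of l z. *)
Lemma conformal_None (A B : set C) (f : Chat -> Chat) (l : K) (g : K -> K) (r M : R) :
  conformal_map (sphere_compl A) (sphere_compl B) f -> l != 0 ->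
  (forall z : K, r < normc z -> f (Some (z : C)) = Some (g z : C) /\ normc (g z - l * z) <= M) ->
  f None = None.
Proof.
move=> [_ cdf] l0 H; have [|cf _] := cdf None; first by move=> [].
case E : (f None) => [w|//]; exfalso.
have := cf _; rewrite E => /(_ _ (nbhs_Some_ball w ltr01)) /nbhs_None[r' r'P].
pose t := `|r| + `|r'| + (normc (w : K) + 2 + `|M|) / normc l + 1.
have ln : 0 < normc l by rewrite normc_gt0.
have q0 : 0 <= (normc (w : K) + 2 + `|M|) / normc l.
  by rewrite divr_ge0 ?addr_ge0 ?normc_ge0.
have t0 : 0 < t by rewrite ltr_wpDl // !addr_ge0.
have nt : normc t%:C = t by rewrite normc_real gtr0_norm.
have [rr rr'] := (ler_norm r, ler_norm r').
have [r0 r'0] := (normr_ge0 r, normr_ge0 r').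
have [|fE gM] := H t%:C; first by rewrite nt /t; lra.
have := r'P t%:C; rewrite nt /= fE => /(_ _) h.
have {}h : normc (g t%:C - w) < 1 by apply: h; rewrite /t; lra.
have h1 : normc (l * t%:C) <= normc (w : K) + 1 + `|M|.
  have -> : l * t%:C = w + (g t%:C - w) - (g t%:C - l * t%:C) by ring.
  apply: le_trans (normcD _ _) _; rewrite normcN lerD //; last by rewrite (le_trans gM) // ler_norm.
  by apply: le_trans (normcD _ _) _; rewrite lerD2l ltW.
have : normc (w : K) + 2 + `|M| <= normc (l * t%:C).
  rewrite normcMM nt mulrC -ler_pdivrMr // /t; lra.
by move=> h2; have := le_trans h2 h1; lra.
Qed.

(** * Conformal maps that fix infinity *)

Section Finite.
Variables (A B : set C) (f : Chat -> Chat).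
Hypothesis cf : conformal_map (sphere_compl A) (sphere_compl B) f.
Hypothesis f_inf : f None = None.
Hypothesis cA : compact A.

Lemma sphere_compl_Some (D : set C) (z : K) : sphere_compl D (Some (z : C)) <-> ~ D z.
Proof.
split=> [h Dz|h [w Dw [wz]]]; first by apply: h; exists z.
by apply: h; rewrite -wz.
Qed.

Lemma sphere_compl_None (D : set C) : sphere_compl D (None : Chat).
Proof. by move=> []. Qed.

Lemma finE z : ~ A z -> f (Some (z : C)) = Some (fin f z : C).
Proof.
move=> Az; rewrite /fin; case E : (f (Some (z : C))) => [//|].
have [[_ inj _] _] := cf; have := inj (Some (z : C)) None.
rewrite E f_inf => /(_ _ _ erefl) h; suff : Some (z : C) = None :> Chat by [].
apply: h; apply/mem_set; first exact/sphere_compl_Some.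
exact: sphere_compl_None.
Qed.

Lemma fin_out z : ~ A z -> ~ B (fin f z).
Proof.
move=> Az; have [[hom _ _] _] := cf.
by have := hom (Some (z : C)) ((sphere_compl_Some _ _).2 Az); rewrite finE // => /sphere_compl_Some.
Qed.

Lemma fin_inj x y : ~ A x -> ~ A y -> fin f x = fin f y -> x = y.
Proof.
move=> Ax Ay xy; have [[_ inj _] _] := cf.
have := inj (Some (x : C)) (Some (y : C)) (mem_set ((sphere_compl_Some _ _).2 Ax)) (mem_set ((sphere_compl_Some _ _).2 Ay)).
by rewrite !finE // xy => /(_ erefl)[].
Qed.

Lemma fin_surj w : ~ B w -> exists2 z, ~ A z & fin f z = w.
Proof.
move=> Bw; have [[_ _ surj] _] := cf.
have [[z|] Az] := surj (Some (w : C)) ((sphere_compl_Some _ _).2 Bw); last by rewrite f_inf.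
move/sphere_compl_Some : Az => Az; rewrite finE // => -[h].
by exists z.
Qed.

Lemma fin_cdiff z : ~ A z -> cdiff (fin f) z.
Proof.
move=> Az; have [_ H] := cf; have [_] := H _ ((sphere_compl_Some _ _).2 Az).
by rewrite finE // => h; apply: derivable_cdiff; exact: h.
Qed.

Lemma closed_of_compact : closed A.
Proof. by apply: compact_closed => //; exact: norm_hausdorff. Qed.

Lemma near_out z : ~ A z -> nbhs (z : C) (~` A).
Proof. by move=> Az; apply: open_nbhs_nbhs; split => //; apply: closed_openC; exact: closed_of_compact. Qed.

Lemma fin_open z (U : set C) : ~ A z -> nbhs (z : C) U ->
  nbhs (fin f z : C) (fin f @` (U `&` ~` A)).
Proof.
move=> Az Uz; apply: open_mapping.
- by apply: filterI => //; exact: near_out.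
- by move=> w [_ Aw]; exact: fin_cdiff.
- by move=> w [_ Aw]; exact: fin_inj.
Qed.

Lemma fin_growth (M : R) : exists r : R, forall z : K, ~ A z -> r < normc z -> M < normc (fin f z).
Proof.
have [_ H] := cf; have [cN _] := H _ (@sphere_compl_None A).
have := cN _; rewrite f_inf => /(_ _ (nbhs_None_ball M)) /nbhs_None[r rP].
by exists r => z Az /rP /=; rewrite finE.
Qed.

(** By the open mapping property at 0 of F w = 1 / f (1 / w), which is continuous there by
    [fin_growth]. This is continuity of the inverse map at infinity. *)
Lemma fin_escape (r : R) : exists M : R, forall z : K, ~ A z -> M < normc (fin f z) -> r < normc z.
Proof.
have [rA rAP] := compact_bounded_normc cA.
have [r1 r1P] := fin_growth 0.
pose r2 := `|r| + `|rA| + `|r1| + 1.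
have r20 : 0 < r2 by rewrite ltr_wpDl // !addr_ge0.
have [lr lrA lr1] := And3 (ler_norm r) (ler_norm rA) (ler_norm r1).
have [gr grA gr1] := And3 (normr_ge0 r) (normr_ge0 rA) (normr_ge0 r1).
pose q := (2 * r2)^-1; have q0 : 0 < q by rewrite invr_gt0 mulr_gt0.
pose F (w : K) : K := if w == 0 then 0 else (fin f w^-1)^-1.
have big w : qn (w - 0) <= q -> w != 0 -> [/\ ~ A w^-1, fin f w^-1 != 0 & r2 <= normc w^-1].
  rewrite subr0 => wq w0; have wr2 : r2 <= normc w^-1.
    rewrite normcVV -[r2]invrK lef_pV2 ?posrE ?invr_gt0 ?normc_gt0 //.
    apply: le_trans (normc_le_qn w) _.
    apply: le_trans (_ : 2 * q <= _); first by rewrite ler_pM2l.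
    by rewrite /q invfM mulrA divff ?mul1r.
  have Aw : ~ A w^-1 by move=> /rAP; move: wr2; rewrite /r2; lra.
  split => //; rewrite -normc_gt0; apply: r1P => //; move: wr2; rewrite /r2; lra.
have [|||d d0 dP] := @open_mapping_square R F 0 q q0.
- apply/cont_eps => e e0; have [r3 r3P] := fin_growth e^-1.
  pose r4 := `|r3| + r2.
  have r40 : 0 < r4 by rewrite ltr_wpDl.
  exists r4^-1; first by rewrite invr_gt0.
  move=> w; rewrite subr0 => wr; rewrite {2}/F eqxx subr0 /F.
  case: eqVneq => [_|w0]; first by rewrite ComplexField.Normc.normc0.
  have wr4 : r4 < normc w^-1.
    by rewrite normcVV -[r4]invrK ltf_pV2 ?posrE ?invr_gt0 ?normc_gt0.
  have := ler_norm r3; have := normr_ge0 r3 => h1 h2.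
  have Aw : ~ A w^-1 by move=> /rAP; move: wr4; rewrite /r4 /r2; lra.
  have h : e^-1 < normc (fin f w^-1) by apply: r3P => //; move: wr4; rewrite /r4; lra.
  rewrite normcVV -[e]invrK ltf_pV2 ?posrE ?invr_gt0 //.
  by apply: lt_trans h; rewrite invr_gt0.
- move=> w wq w0; have [Aw fw _] := big w wq w0.
  apply: (@cdiff_near R (fun w => (fin f w^-1)^-1)).
    have := near_neq0 (@contid R w) w0; apply: filterS => v v0.
    by rewrite /F (negbTE v0).
  apply: (@cdiffV R (fun w => fin f w^-1)) => //.
  apply: (@cdiff_comp R GRing.inv (fin f)); last exact: fin_cdiff.
  by apply: (@cdiffV R (fun w => w)); [exact: w0|exact: cdiff_id].
- move=> w wq; have w0 : w != 0.
    by apply/eqP => w0; move: wq q0; rewrite w0 subrr /qn /= normr0 maxxx => <-; rewrite ltxx.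
  have [_ fw _] := big w (ltac:(by rewrite wq)) w0.
  by rewrite /F (negbTE w0) eqxx invr_neq0.
exists (d^-1) => z Az hz; have fz0 : fin f z != 0 by rewrite -normc_gt0; apply: lt_trans hz; rewrite invr_gt0.
have [|w wq] := dP (fin f z)^-1.
  by rewrite /F eqxx subr0 normcVV -[d]invrK ltf_pV2 ?posrE ?invr_gt0 ?normc_gt0.
rewrite /F; case: eqVneq => [_ /esym/eqP|w0 /invr_inj]; first by rewrite invr_eq0 (negbTE fz0).
have [Aw _ wr2] := big w wq w0.
by move=> /(fin_inj Aw Az) <-; move: wr2; rewrite /r2; lra.
Qed.

(** While z tends to A, the values f z cannot cluster at some f z0 outside B, because f is open at
    z0 and injective. This provides the neighbourhoods that [max_principle] asks for. *)
Lemma fin_proper (W : set C) : open W -> B `<=` W ->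
  exists V : set C, [/\ open V, A `<=` V & forall z, V z -> ~ A z -> W (fin f z)].
Proof.
move=> oW BW; pose T : set C := [set z : K | ~ A z /\ ~ W (fin f z)].
exists (~` closure T); split; first by apply: closed_openC; exact: closed_closure.
  move=> e Ae; rewrite /= => eT.
  have [rA rAP] := compact_bounded_normc cA.
  have [M MP] := fin_escape (rA + 1).
  pose K' : set C := ~` W `&` [set w : K | normc w <= M].
  have cK' : compact K'.
    apply: (@closed_bounded_compact R _ M); last by move=> w [].
    by apply: closedI; [exact: open_closedC|exact: closed_ball_normc].
  (* The values of f at points of T approaching e; [fin_escape] keeps them bounded, so they cluster
     in the compact K'. *)
  pose G : set_system C := filter_from (nbhs (e : C)) (fun U => fin f @` (U `&` T)).
  have PG : ProperFilter G.
    apply: filter_from_proper; last first.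
      by move=> U /eT[t [Tt Ut]]; exists (fin f t); exists t.
    apply: filter_from_filter; first by exists setT; exact: filterT.
    move=> U V Ue Ve; exists (U `&` V); first exact: filterI.
    by move=> _ [t [[Ut Vt] Tt] <-]; split; exists t.
  have GK' : G K'.
    exists [set z : K | normc (z - e) < 1]; first by apply/nbhs_cplx; exists 1.
    move=> _ [t [te [At Wt]] <-]; split => //=; rewrite leNgt; apply/negP => /(MP _ At).
    have h1 := rAP _ Ae; have := normcD (t - e) e; rewrite subrK => h2.
    by move: te => /= h3; lra.
  have [w [[Ww _] cw]] := cK' G PG GK'.
  have Bw : ~ B w by move=> /BW.
  have [z0 Az0 zw] := fin_surj Bw.
  have z0e : z0 != e by apply/eqP => h; apply: Az0; rewrite h.
  pose r := normc (z0 - e) / 2; have r0 : 0 < r by rewrite divr_gt0 // normc_gt0 subr_eq0.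
  have N1 : nbhs (z0 : C) [set z : K | normc (z - z0) < r] by apply/nbhs_cplx; exists r.
  have N2 : nbhs (e : C) [set z : K | normc (z - e) < r] by apply/nbhs_cplx; exists r.
  have G2 : G (fin f @` ([set z : K | normc (z - e) < r] `&` T)) by exists [set z : K | normc (z - e) < r].
  have N3 := fin_open Az0 N1; rewrite zw in N3.
  have [v [[t [te [At _]] tv] [u [uz Au] uv]]] := cw _ _ G2 N3.
  have tu : t = u by apply: fin_inj => //; rewrite tv uv.
  move: te uz; rewrite /= tu => h1 h2.
  have := normcD (z0 - u) (u - e); rewrite addrA subrK (normcB z0 u) => h3.
  by move: h1 h2 h3; rewrite /r; lra.
move=> z /= zT Az; apply: contrapT => Wz; apply: zT; apply: subset_closure.
by split.
Qed.

End Finite.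

End ConformalMaps.

(** * Lemniscates with two foci *)

Section Lemniscate.
Variable R : realType.
Local Notation C := (cplx R).
Local Notation K := R[i].
Local Notation normc := ComplexField.Normc.normc.

Lemma connected_split (T : topologicalType) (A U V : set T) : connected A ->
  open U -> open V -> U `&` V = set0 -> A `<=` U `|` V ->
  A `&` U !=set0 -> A `<=` U.
Proof.
move=> cA oU oV UV AUV AU; have E : A `&` U = A.
  apply: cA => //; first by exists U.
  exists (~` V); first exact: open_closedC.
  apply/seteqP; split => x [Ax Ux]; split => //.
    by move=> Vx; have : (U `&` V) x by []; rewrite UV.
  by have [] := AUV x Ax.
by rewrite -E; exact: subIsetr.
Qed.

Lemma polar (z : K) : exists t, z = (normc z)%:C * cis t.
Proof.
have [->|z0] := eqVneq z 0; first by exists 0; rewrite ComplexField.Normc.normc0 mul0r.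
have n0 : 0 < normc z by rewrite normc_gt0.
pose x := complex.Re z / normc z; pose y := complex.Im z / normc z.
have xy : x ^+ 2 + y ^+ 2 = 1.
  by rewrite /x /y !expr_div_n -mulrDl -normc_sqr divff // expf_neq0 // gt_eqF.
have x1 : -1 <= x <= 1.
  by apply/andP; split; have := sqr_ge0 y; nra.
have [_ cx] := acos_def x1.
have sx := sin_acos x1.
have zE u v : u = x -> v = y -> z = (normc z)%:C * (u +i* v).
  move=> -> ->; apply: complex_ext; rewrite /x /y; case: (z) n0 => p q /=; set n := Num.sqrt _ => n0.
    by rewrite mul0r subr0 mulrC divfK // gt_eqF.
  by rewrite mul0r addr0 mulrC divfK // gt_eqF.
have y2 : Num.sqrt (1 - x ^+ 2) = `|y| by rewrite -xy addrC addKr sqrtr_sqr.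
have [y0|y0] := leP 0 y.
  by exists (acos x); apply: zE => //; rewrite sx y2 ger0_norm.
exists (- acos x); apply: zE; first by rewrite cosN.
by rewrite sinN sx y2 ltr0_norm // opprK.
Qed.

Lemma cont_powR (T : topologicalType) (f : T -> R) (m : R) (x : T) : 0 < m ->
  (forall y, 0 <= f y) -> contr f x -> contr (fun y => f y `^ m) x.
Proof.
move=> m0 f0 cf; have [fx|fx] := eqVneq (f x) 0; last first.
  have fxp : 0 < f x by rewrite lt_def fx f0.
  have Hn : \forall y \near x, 0 < f y.
    move/contRe : cf => /(_ _ fxp); apply: filterS => y; rewrite ltr_norml => /andP[h _]; lra.
  apply/contRe => e e0.
  have : contr (fun y => expR (m * ln (f y))) x.
    apply: (contr_comp (f := fun y => m * ln (f y))); last exact: continuous_expR.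
    apply: contRM; first exact: cst_continuous.
    by apply: (contr_comp cf); exact: continuous_ln.
  move/contRe => /(_ _ e0); move: Hn; apply: filterS2 => y yp.
  by rewrite /powR !gt_eqF.
apply/contRe => e e0; rewrite fx powR0 ?gt_eqF //.
have d0 : 0 < e `^ m^-1 by exact: powR_gt0.
move/contRe : cf => /(_ _ d0); apply: filterS => y; rewrite fx !subr0.
rewrite !ger0_norm ?powR_ge0 // => h.
have := gt0_ltr_powR m0 (_ : f y \in Num.nneg) (_ : e `^ m^-1 \in Num.nneg) h.
rewrite -powRrM mulVf ?gt_eqF // powRr1 ?ltW //; apply; rewrite nnegrE //.
exact: powR_ge0.
Qed.

Lemma ln_le_subr1 (x : R) : 0 < x -> ln x <= x - 1.
Proof. by move=> x0; have := expR_ge1Dx (ln x); rewrite lnK ?posrE //; lra. Qed.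

Lemma le_powRM (r x r' x' m m' : R) : 0 < r -> 0 < x -> 0 < r' -> 0 < x' ->
  (r `^ m * x `^ m' <= r' `^ m * x' `^ m') =
  (m * ln r + m' * ln x <= m * ln r' + m' * ln x').
Proof.
move=> r0 x0 r'0 x'0; rewrite -!ln_powR -!lnM ?posrE ?powR_gt0 //.
by rewrite ler_ln // posrE mulr_gt0 // powR_gt0.
Qed.

(** * Sublevel sets around the two centres *)

Section TwoCenters.
Variables (a1 a2 : K) (m1 m2 c : R).
Hypotheses (a12 : a1 != a2) (m10 : 0 < m1) (m20 : 0 < m2) (m12 : m1 + m2 = 1).

Definition Ul (w : K) : R := normc (w - a1) `^ m1 * normc (w - a2) `^ m2.
Definition ul (w : K) : R := m1 * lnc (w - a1) + m2 * lnc (w - a2).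
Let d := normc (a1 - a2).
(* The value of Ul at its critical point m2 a1 + m1 a2, which lies on both
   circles |w - a_i| = m_i d. *)
Definition ustar : R := (m1 * d) `^ m1 * (m2 * d) `^ m2.

Lemma d_gt0 : 0 < d.
Proof. by rewrite normc_gt0 subr_eq0. Qed.

Lemma Ul_ge0 w : 0 <= Ul w.
Proof. by rewrite mulr_ge0 // powR_ge0. Qed.

Lemma Ul1 : Ul a1 = 0.
Proof. by rewrite /Ul subrr ComplexField.Normc.normc0 powR0 ?mul0r // gt_eqF. Qed.

Lemma Ul2 : Ul a2 = 0.
Proof. by rewrite /Ul subrr ComplexField.Normc.normc0 [_ `^ m2]powR0 ?mulr0 // gt_eqF. Qed.

Lemma Ul_exp w : w != a1 -> w != a2 -> Ul w = expR (ul w).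
Proof.
move=> w1 w2; rewrite /Ul /powR !gt_eqF ?normc_gt0 ?subr_eq0 //.
by rewrite -expRD.
Qed.

Lemma Ul_gt0 w : 0 < Ul w -> w != a1 /\ w != a2.
Proof.
by move=> h; split; apply/eqP => wa; move: h; rewrite wa ?Ul1 ?Ul2 ltxx.
Qed.

Lemma cont_Ul w : @contr R C Ul w.
Proof.
by apply: contRM; apply: cont_powR => //; try (by move=> y; exact: normc_ge0);
   apply: cont_normc; exact: contBid.
Qed.

Lemma ustar_gt0 : 0 < ustar.
Proof. by rewrite mulr_gt0 // powR_gt0 // mulr_gt0 // d_gt0. Qed.

Lemma ustar_le w : m1 * d <= normc (w - a1) -> m2 * d <= normc (w - a2) -> ustar <= Ul w.
Proof.
have dp := ltW d_gt0.
move=> h1 h2; rewrite /ustar /Ul; apply: ler_pM; rewrite ?powR_ge0 //.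
  by apply: (ge0_ler_powR (ltW m10)); rewrite ?nnegrE ?normc_ge0 // mulr_ge0 // ltW.
by apply: (ge0_ler_powR (ltW m20)); rewrite ?nnegrE ?normc_ge0 // mulr_ge0 // ltW.
Qed.

Lemma circle_far w : normc (w - a1) <= m1 * d -> m2 * d <= normc (w - a2).
Proof.
move=> h; have := normcD (a1 - w) (w - a2); rewrite addrA subrK -/d (normcB a1) => h2.
have : d = m1 * d + m2 * d by rewrite -mulrDl m12 mul1r.
lra.
Qed.

Lemma circle_ustar w : normc (w - a1) = m1 * d -> ustar <= Ul w.
Proof. by move=> h; apply: ustar_le; [rewrite h|apply: circle_far; rewrite h]. Qed.

(** Outside both discs each factor of [Ul] is at least its value at the critical point. The discs
    are disjoint as m1 + m2 = 1, so they separate the two parts of every sublevel set below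
    [ustar]. *)
Lemma Ul_lt_ustar w : Ul w < ustar -> normc (w - a1) < m1 * d \/ normc (w - a2) < m2 * d.
Proof.
move=> h; have [h1|h1] := ltP (normc (w - a1)) (m1 * d); first by left.
have [h2|h2] := ltP (normc (w - a2)) (m2 * d); first by right.
by move: h; rewrite ltNge ustar_le.
Qed.

(* Weighted AM-GM *)
Lemma segment_ustar (t : R) : 0 <= t <= 1 -> Ul (a1 + t%:C * (a2 - a1)) <= ustar.
Proof.
move=> /andP[t0 t1].
have n1 : normc (a1 + t%:C * (a2 - a1) - a1) = t * d.
  by rewrite addrC addKr normcMM normc_real ger0_norm // normcB.
have n2 : normc (a1 + t%:C * (a2 - a1) - a2) = (1 - t) * d.
  have -> : a1 + t%:C * (a2 - a1) - a2 = (1 - t)%:C * (a1 - a2) by rewrite rmorphB rmorph1; ring.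
  by rewrite normcMM normc_real ger0_norm // subr_ge0.
rewrite /Ul n1 n2; have [->|tn0] := eqVneq t 0.
  by rewrite mul0r powR0 ?gt_eqF // mul0r ltW // ustar_gt0.
have [->|tn1] := eqVneq t 1.
  by rewrite subrr mul0r [0 `^ m2]powR0 ?gt_eqF // mulr0 ltW // ustar_gt0.
have tp : 0 < t by rewrite lt_def tn0.
have tq : 0 < 1 - t by rewrite subr_gt0 lt_def eq_sym tn1.
have dp := d_gt0.
have pM (x y m : R) : 0 < x -> 0 < y -> (x * y) `^ m = x `^ m * y `^ m.
  by move=> x0 y0; rewrite powRM // ltW.
rewrite /ustar !pM //.
rewrite mulrACA [leRHS]mulrACA ler_pM2r ?mulr_gt0 ?powR_gt0 //.
have p1 : 0 < t / m1 by rewrite divr_gt0.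
have p2 : 0 < (1 - t) / m2 by rewrite divr_gt0.
rewrite le_powRM //.
have l1 : ln t = ln (t / m1) + ln m1 by rewrite -lnM ?posrE // divfK // gt_eqF.
have l2 : ln (1 - t) = ln ((1 - t) / m2) + ln m2 by rewrite -lnM ?posrE // divfK // gt_eqF.
have h1 : m1 * ln (t / m1) <= t - m1.
  have -> : t - m1 = m1 * (t / m1 - 1) by field; rewrite gt_eqF.
  by rewrite ler_pM2l // ln_le_subr1.
have h2 : m2 * ln ((1 - t) / m2) <= 1 - t - m2.
  have -> : 1 - t - m2 = m2 * ((1 - t) / m2 - 1) by field; rewrite gt_eqF.
  by rewrite ler_pM2l // ln_le_subr1.
by rewrite l1 l2 !mulrDr; move: m12; lra.
Qed.

(** If [ustar] were at most c, the segment from a1 to a2 would lie in L and join the two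
    components. *)
Lemma c_lt_ustar (L : set C) : L = [set w : K | Ul w <= c] -> 0 <= c ->
  connected_component L (a1 : C) `&` connected_component L (a2 : C) = set0 -> c < ustar.
Proof.
move=> LE c0 dis; rewrite ltNge; apply/negP => uc.
pose S : set C := (fun t : R => a1 + t%:C * (a2 - a1)) @` `[0, 1].
have cS : connected S.
  apply: (@connected_continuous_connected R C); first exact: segment_connected.
  apply: continuous_in_subspaceT => t _.
  apply: (@contD R R); first exact: (@contcst R R).
  apply: (@contM R R); last exact: (@contcst R R).
  by apply: (@cont_complex R R (fun t => t) (fun=> 0)); [by move=> U|exact: cst_continuous].
have S1 : S a1 by exists 0; rewrite /= ?in_itv /= ?lexx ?ler01 // mul0r addr0.
have S2 : S a2 by exists 1; rewrite /= ?in_itv /= ?lexx ?ler01 // mul1r addrC subrK.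
have SL : S `<=` L.
  move=> w [t /=]; rewrite in_itv /= => t01 <-; rewrite LE /=.
  by apply: le_trans uc; exact: segment_ustar.
have : (connected_component L (a1 : C) `&` connected_component L (a2 : C)) a1.
  by split; [apply: connected_component_refl; exact: SL|apply: (connected_component_max S2 SL cS)].
by rewrite dis.
Qed.

Lemma ray_far (t r : R) : 0 <= r -> d - r <= normc (a1 + r%:C * cis t - a2).
Proof.
move=> r0; have := normcD (a1 + r%:C * cis t - a2) (- (r%:C * cis t)).
rewrite normcN normcMM normc_cis mulr1 normc_real ger0_norm //.
have -> : a1 + r%:C * cis t - a2 - r%:C * cis t = a1 - a2 by ring.
rewrite -/d; lra.
Qed.

(** The radial derivative of ln Ul is at least m1 / r - m2 / (d - r), which is nonnegative up to r =
    m1 d; the inequality ln x <= x - 1 takes the place of differentiation. *)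
Lemma ray_mono (t r r' : R) : 0 < r -> r <= r' -> r' <= m1 * d ->
  Ul (a1 + r%:C * cis t) <= Ul (a1 + r'%:C * cis t).
Proof.
move=> r0 rr r'd; have r'0 := lt_le_trans r0 rr.
have dp := d_gt0; have dE : d = m1 * d + m2 * d by rewrite -mulrDl m12 mul1r.
have md : 0 < m2 * d by rewrite mulr_gt0.
have n (s : R) : 0 < s -> normc (a1 + s%:C * cis t - a1) = s.
  by move=> s0; rewrite addrC addKr normcMM normc_cis mulr1 normc_real gtr0_norm.
rewrite /Ul !n //.
set x := normc (a1 + r%:C * cis t - a2); set y := normc (a1 + r'%:C * cis t - a2).
have y0 : d - r' <= y by apply: ray_far; exact: ltW.
have x0 : d - r <= x by apply: ray_far; exact: ltW.
have yp : 0 < y by apply: lt_le_trans y0; lra.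
have xp : 0 < x by apply: lt_le_trans x0; lra.
have xy : x <= y + (r' - r).
  rewrite /x (_ : a1 + r%:C * cis t - a2 = (a1 + r'%:C * cis t - a2) + (r - r')%:C * cis t); last first.
    by rewrite rmorphB; ring.
  apply: le_trans (normcD _ _) _; rewrite lerD2l normcMM normc_cis mulr1 normc_real distrC ger0_norm //.
  by rewrite subr_ge0.
rewrite le_powRM //.
have h1 : ln x <= ln y + (r' - r) / y.
  have -> : ln x = ln y + ln (x / y) by rewrite -lnM ?posrE ?divr_gt0 // mulrC divfK // gt_eqF.
  rewrite lerD2l; apply: le_trans (ln_le_subr1 _) _; first by rewrite divr_gt0.
  rewrite lerBlDr -[1](@divff _ y) ?gt_eqF // -mulrDl ler_pM2r ?invr_gt0 //; lra.
have h2 : ln r <= ln r' - (r' - r) / r'.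
  have -> : ln r = ln r' + ln (r / r') by rewrite -lnM ?posrE ?divr_gt0 // mulrC divfK // gt_eqF.
  rewrite lerD2l; apply: le_trans (ln_le_subr1 _) _; first by rewrite divr_gt0.
  by rewrite mulrBl divff ?gt_eqF //; lra.
have h3 : m2 * ((r' - r) / y) <= m1 * ((r' - r) / r').
  rewrite mulrCA [leRHS]mulrCA; apply: ler_wpM2l; first by rewrite subr_ge0.
  rewrite ler_pdivrMr // mulrAC ler_pdivlMr //.
  apply: le_trans (_ : m1 * (d - r') <= _); last by rewrite ler_pM2l.
  have e : r' = m1 * r' + m2 * r' by rewrite -mulrDl m12 mul1r.
  nra.
have h4 : m1 * ln r <= m1 * (ln r' - (r' - r) / r') by rewrite ler_pM2l.
have h5 : m2 * ln x <= m2 * (ln y + (r' - r) / y) by rewrite ler_pM2l.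
rewrite mulrBr in h4; rewrite mulrDr in h5; lra.
Qed.

Definition halo (b : R) : set C := [set w : K | normc (w - a1) < m1 * d /\ c < Ul w < b].

Lemma cont_ray t (r : R) : @contc R R (fun r => a1 + r%:C * cis t) r.
Proof.
apply: contD; first exact: contcst.
apply: contM; last exact: contcst.
by apply: (@cont_complex R R (fun t => t) (fun=> 0)); [by move=> U|exact: cst_continuous].
Qed.

Lemma cont_circle (r t : R) : @contc R R (fun t => a1 + r%:C * cis t) t.
Proof.
apply: contD; first exact: contcst.
by apply: contM; [exact: contcst|exact: cont_cis].
Qed.

Lemma normc_ray (r t : R) : 0 <= r -> normc (a1 + r%:C * cis t - a1) = r.
Proof. by move=> r0; rewrite addrC addKr normcMM normc_cis mulr1 normc_real ger0_norm. Qed.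

Lemma halo_ray (b t : R) : 0 <= c -> c < b -> b <= ustar ->
  exists r, [/\ 0 < r, r < m1 * d & c < Ul (a1 + r%:C * cis t) < b].
Proof.
move=> c0 cb bu; have dp := d_gt0; pose g r := Ul (a1 + r%:C * cis t).
have cg (r : R) : {for r, continuous g}.
  apply: (@continuous_comp R C R (fun r => a1 + r%:C * cis t) Ul); first exact: cont_ray.
  exact: cont_Ul.
have g0 : g 0 = 0 by rewrite /g mul0r addr0 Ul1.
have md : 0 < m1 * d by rewrite mulr_gt0.
have g1 : ustar <= g (m1 * d) by apply: circle_ustar; rewrite normc_ray // ltW.
have [||r] := @IVT R g 0 (m1 * d) ((c + b) / 2) (ltW md).
- by apply: continuous_in_subspaceT => x _; exact: cg.
- have g1p : 0 <= g (m1 * d) by apply: le_trans g1; exact: ltW ustar_gt0.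
  rewrite g0 (min_idPl g1p) (max_idPr g1p).
  by apply/andP; split; lra.
rewrite in_itv /= => /andP[r0 r1] gr; exists r; split.
- by rewrite lt_def r0 andbT; apply/eqP => rE; move: gr; rewrite rE g0; lra.
- by rewrite lt_def r1 andbT; apply/eqP => rE; move: g1; rewrite rE gr; lra.
- by rewrite -/(g r) gr; apply/andP; split; lra.
Qed.

(* Radially star-shaped around a1: every ray meets it in an interval. *)
Lemma halo_connected (b : R) : 0 <= c -> c < b -> b <= ustar -> connected (halo b).
Proof.
move=> c0 cb bu; rewrite /connected => B [w0 Bw0].
move=> [U oU BU] [F cF BF].
pose S t : set C := [set a1 + r%:C * cis t | r in [set r : R | [/\ 0 < r, r < m1 * d & c < Ul (a1 + r%:C * cis t) < b]]].
have SA t : S t `<=` halo b.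
  move=> w [r [r0 r1 r2] <-]; split => //; by rewrite normc_ray // ltW.
have Sconn t : connected (S t).
  apply: (@connected_continuous_connected R C); last first.
    by apply: continuous_in_subspaceT => r _; exact: cont_ray.
  apply/connected_intervalP => x y /= [x0 x1 /andP[x2 x3]] [y0 y1 /andP[y2 y3]] z /andP[xz zy].
  split; [exact: lt_le_trans xz|exact: le_lt_trans y1|apply/andP; split].
    by apply: lt_le_trans x2 _; apply: ray_mono => //; rewrite (le_trans zy) // ltW.
  by apply: le_lt_trans y3; apply: ray_mono => //; [exact: lt_le_trans xz|exact: ltW].
have SB t : S t `&` B !=set0 -> S t `<=` B.
  move=> SBt; have : S t `&` B = S t.
    apply: Sconn => //.
      exists U => //; rewrite BU setIA; congr (_ `&` _); apply/seteqP; split => [w []//|w Sw].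
      by split => //; exact: SA Sw.
    exists F => //; rewrite BF setIA; congr (_ `&` _); apply/seteqP; split => [w []//|w Sw].
    by split => //; exact: SA Sw.
  by move=> <-; exact: subIsetr.
(* A relatively open and closed B contains every radial piece that it meets; whether it does so is
   locally constant in the angle, hence the same for all angles. *)
pose G t := `[< S t `<=` B >].
have cstG : forall s t, G s = G t.
  apply: locally_cst_R => t; have [r [r0 r1 r2]] := halo_ray t c0 cb bu.
  have Swt : S t (a1 + r%:C * cis t) by exists r.
  have nearA : \forall s \near t, S s (a1 + r%:C * cis s).
    have cU : {for t, continuous (fun s => Ul (a1 + r%:C * cis s))}.
      apply: (@continuous_comp R C R (fun s => a1 + r%:C * cis s) Ul); first exact: cont_circle.
      exact: cont_Ul.
    have e0 : 0 < Num.min (Ul (a1 + r%:C * cis t) - c) (b - Ul (a1 + r%:C * cis t)).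
      by move: r2 => /andP[? ?]; rewrite lt_min !subr_gt0; apply/andP.
    move/contRe : cU => /(_ _ e0); apply: filterS => s.
    rewrite lt_min => /andP[]; rewrite !ltr_norml => /andP[h1 _] /andP[_ h2].
    by exists r => //; split => //; apply/andP; split; lra.
  have cc := @cont_circle r t.
  rewrite /G; case: (asboolP (S t `<=` B)) => [SBt|SBt].
    have : U (a1 + r%:C * cis t) by have := SBt _ Swt; rewrite BU => -[].
    move=> Uw; have NU : nbhs (a1 + r%:C * cis t : C) U by apply: open_nbhs_nbhs.
    have := cc _ NU; move: nearA; apply: filterS2 => s Ss Us.
    apply/asboolP; apply: SB; exists (a1 + r%:C * cis s); split => //.
    by rewrite BU; split => //; exact: SA Ss.
  have Fw : ~ F (a1 + r%:C * cis t).
    move=> Fw; apply: SBt; apply: SB; exists (a1 + r%:C * cis t); split => //.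
    by rewrite BF; split => //; exact: SA Swt.
  have NF : nbhs (a1 + r%:C * cis t : C) (~` F).
    by apply: open_nbhs_nbhs; split => //; exact: closed_openC.
  have := cc _ NF; move: nearA; apply: filterS2 => s Ss Fs.
  by apply/asboolP => h; apply: Fs; have := h _ Ss; rewrite BF => -[].
have pol w : halo b w -> exists2 t, S t w & True.
  move=> [w1 w2]; have [t tE] := polar (w - a1).
  have wa : w != a1 by have [] := Ul_gt0 (le_lt_trans c0 (andP w2).1).
  exists t => //; exists (normc (w - a1)); last by rewrite -tE addrC subrK.
  by rewrite /= -tE [a1 + _]addrC subrK; split => //; rewrite normc_gt0 subr_eq0.
apply/seteqP; split; first by rewrite BU; exact: subIsetl.
have Aw0 : halo b w0 by move: Bw0; rewrite BU => -[].
have [t0 St0 _] := pol _ Aw0.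
have Gt0 : G t0 by apply/asboolP; apply: SB; exists w0.
move=> w /pol[t St _]; have : G t by rewrite (cstG t t0).
by move/asboolP; apply.
Qed.

End TwoCenters.

Lemma Ul_swap a1 a2 m1 m2 w : Ul a2 a1 m2 m1 w = Ul a1 a2 m1 m2 w.
Proof. by rewrite /Ul mulrC. Qed.

Lemma ustar_swap a1 a2 m1 m2 : ustar a2 a1 m2 m1 = ustar a1 a2 m1 m2.
Proof. by rewrite /ustar mulrC normcB. Qed.

(** On the ray from a2 pointing away from a1 both distances grow, so [Ul] increases. It joins the
    part of the shell around a2 to infinity without meeting the circle around a1, as
    [loop_not_surrounds] requires. *)
Lemma out_ray (a1 a2 : K) (m1 m2 c b : R) : a1 != a2 -> 0 < m1 -> 0 < m2 ->
  m1 + m2 = 1 -> 0 <= c -> c < b -> b <= ustar a1 a2 m1 m2 ->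
  exists S : set C, [/\ connected S,
    forall w, S w -> c < Ul a1 a2 m1 m2 w /\ m1 * normc (a1 - a2) < normc (w - a1),
    forall M, exists2 w, S w & M < normc w &
    exists w, [/\ S w, normc (w - a2) < m2 * normc (a1 - a2) & Ul a1 a2 m1 m2 w < b]].
Proof.
move=> a12 m10 m20 m12 c0 cb bu; have dp := d_gt0 a12.
have [t tE] := polar (a2 - a1); rewrite normcB in tE.
set d := normc (a1 - a2) in tE dp *.
have n2 s : 0 < s -> normc (a2 + s%:C * cis t - a2) = s.
  by move=> s0; apply: normc_ray; exact: ltW.
have n1 s : 0 < s -> normc (a2 + s%:C * cis t - a1) = d + s.
  move=> s0; have -> : a2 + s%:C * cis t - a1 = (d + s)%:C * cis t by rewrite rmorphD mulrDl -tE; ring.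
  by rewrite normcMM normc_cis mulr1 normc_real gtr0_norm // addr_gt0.
have mono r s : 0 < r -> r <= s -> Ul a1 a2 m1 m2 (a2 + r%:C * cis t) <= Ul a1 a2 m1 m2 (a2 + s%:C * cis t).
  move=> r0 rs; have s0 := lt_le_trans r0 rs.
  rewrite /Ul !n1 // !n2 //; apply: ler_pM; rewrite ?powR_ge0 //.
    by apply: (ge0_ler_powR (ltW m10)); rewrite ?nnegrE ?lerD2l // addr_ge0 // ltW.
  by apply: (ge0_ler_powR (ltW m20)); rewrite ?nnegrE // ltW.
exists [set a2 + s%:C * cis t | s in [set s : R | 0 < s /\ c < Ul a1 a2 m1 m2 (a2 + s%:C * cis t)]]; split.
- apply: (@connected_continuous_connected R C); last first.
    by apply: continuous_in_subspaceT => r _; exact: (@cont_ray a2 t r).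
  apply/connected_intervalP => x y /= [x0 x1] [y0 y1] z /andP[xz zy].
  by split; [exact: lt_le_trans xz|apply: lt_le_trans x1 _; exact: mono].
- move=> _ [s [s0 sc] <-]; split => //; rewrite n1 //.
  have : d = m1 * d + m2 * d by rewrite -mulrDl m12 mul1r.
  have := mulr_gt0 m20 dp; lra.
- move=> M; pose s := `|M| + normc a2 + c + 1.
  have s0 : 0 < s by rewrite ltr_wpDl // !addr_ge0 // normc_ge0.
  exists (a2 + s%:C * cis t).
    exists s => //; split => //; rewrite /Ul n1 // n2 //.
    apply: lt_le_trans (_ : s `^ m1 * s `^ m2 <= _).
      rewrite -powRD ?m12 ?oner_eq0 // powRr1 ?ltW // /s.
      by have := normr_ge0 M; have := normc_ge0 a2; lra.
    rewrite ler_wpM2r ?powR_ge0 //.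
    have [sp ds dds] : [/\ 0 <= s, 0 <= d + s & s <= d + s] by split; lra.
    by apply: (ge0_ler_powR (ltW m10)); rewrite ?nnegrE.
  have := normcD (a2 + s%:C * cis t) (- a2); rewrite n2 // normcN.
  by have := ler_norm M; rewrite /s; lra.
- have a21 : a2 != a1 by rewrite eq_sym.
  have m21 : m2 + m1 = 1 by rewrite addrC.
  have [|r [r0 r1 /andP[r2 r3]]] := @halo_ray a2 a1 m2 m1 c a21 m20 m10 m21 b t c0 cb.
    by rewrite ustar_swap.
  exists (a2 + r%:C * cis t); rewrite n2 //; split.
  + by exists r => //; split => //; rewrite -Ul_swap.
  + by rewrite /d normcB.
  + by rewrite -Ul_swap.
Qed.

End Lemniscate.

(** * Asymptotics at infinity *)

Section Asymptotics.
Variable R : realType.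
Local Notation C := (cplx R).
Local Notation K := R[i].
Local Notation normc := ComplexField.Normc.normc.

Definition asym (F : K -> K) (l : K) (k : nat) :=
  forall e : R, 0 < e -> exists r : R, forall z, r < normc z ->
    normc (F z - l * z ^+ k) <= e * normc z ^+ k.

Lemma large_pow (M e : R) (k : nat) : 0 < e -> (0 < k)%N ->
  exists r : R, forall z : K, r < normc z -> M <= e * normc z ^+ k.
Proof.
move=> e0 k0; exists (Num.max 1 (M / e)) => z; rewrite gt_max => /andP[z1 z2].
have h : M <= e * normc z by rewrite mulrC -ler_pdivrMr // ltW.
apply: le_trans h _; rewrite ler_pM2l //.
by rewrite -{1}[normc z]expr1; apply: ler_weXn2l => //; exact: ltW.
Qed.

Lemma asymD F G l m k : asym F l k -> asym G m k -> asym (fun z => F z + G z) (l + m) k.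
Proof.
move=> aF aG e e0; have e2 : 0 < e / 2 by rewrite divr_gt0.
have [r rP] := aF _ e2; have [s sP] := aG _ e2.
exists (Num.max r s) => z; rewrite gt_max => /andP[/rP h1 /sP h2].
have -> : F z + G z - (l + m) * z ^+ k = (F z - l * z ^+ k) + (G z - m * z ^+ k) by ring.
apply: le_trans (normcD _ _) _; rewrite [e in leRHS](_ : e = e / 2 + e / 2); last by field.
by rewrite mulrDl lerD.
Qed.

Lemma asymZ F l k c : asym F l k -> asym (fun z => c * F z) (c * l) k.
Proof.
move=> aF e e0; have e2 : 0 < e / (normc c + 1) by rewrite divr_gt0 // ltr_wpDl // normc_ge0.
have [r rP] := aF _ e2; exists r => z /rP h.
have -> : c * F z - c * l * z ^+ k = c * (F z - l * z ^+ k) by ring.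
rewrite normcMM; apply: le_trans (_ : normc c * (e / (normc c + 1) * normc z ^+ k) <= _).
  by rewrite ler_wpM2l // normc_ge0.
rewrite mulrA ler_wpM2r ?exprn_ge0 ?normc_ge0 //.
rewrite mulrA ler_pdivrMr ?ltr_wpDl ?normc_ge0 //.
by rewrite mulrC ler_pM2l // lerDl.
Qed.

Lemma asym_bounded F k (M r : R) : (0 < k)%N ->
  (forall z, r < normc z -> normc (F z) <= M) -> asym F 0 k.
Proof.
move=> k0 H e e0; have [s sP] := large_pow M e0 k0.
exists (Num.max r s) => z; rewrite gt_max => /andP[zr zs].
by rewrite mul0r subr0 (le_trans (H _ zr)) // sP.
Qed.

Lemma asym_shift F l k : asym F l k -> asym (fun z => z * F z) l k.+1.
Proof.
move=> aF e e0; have [r rP] := aF _ e0; exists r => z /rP h.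
have -> : z * F z - l * z ^+ k.+1 = z * (F z - l * z ^+ k) by rewrite exprS; ring.
by rewrite normcMM exprS mulrCA ler_wpM2l // normc_ge0.
Qed.

Lemma asym_poly (p : {poly K}) k : (size p <= k.+1)%N -> asym (fun z => p.[z]) p`_k k.
Proof.
elim/poly_ind: p k => [|p c IH] k.
  move=> _ e e0; exists 0 => z _; rewrite horner0 coef0 mul0r subr0 ComplexField.Normc.normc0.
  by rewrite mulr_ge0 ?exprn_ge0 ?normc_ge0 // ltW.
case: k => [|k] sk.
  have sp : p = 0.
    apply/eqP; rewrite -size_poly_eq0; move: sk; rewrite -cons_poly_def size_cons_poly.
    by case: nilP => [->//|]; case: (size p).
  move=> e e0; exists 0 => z _; rewrite hornerMXaddC sp horner0 mul0r add0r coefD mul0r coef0 add0r coefC /= !expr0 !mulr1 subrr ComplexField.Normc.normc0.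
  exact: ltW.
have sp : (size p <= k.+1)%N.
  by move: sk; rewrite -cons_poly_def size_cons_poly; case: nilP => [->//|_].
have := asymD (asym_shift (IH k sp)) (asym_bounded (F := fun=> c) (k := k.+1) (M := normc c) (r := 0) isT (fun z _ => lexx _)).
rewrite addr0 coefD coefMX coefC /= addr0; move=> H e e0; have [r rP] := H e e0.
by exists r => z /rP; rewrite hornerMXaddC mulrC.
Qed.

Lemma asym_perturb (F G : K -> K) l k (M r : R) : (0 < k)%N ->
  (forall z, r < normc z -> normc (G z - F z) <= M) -> asym F l k -> asym G l k.
Proof.
move=> k0 H aF; have := asymD aF (asym_bounded k0 H); rewrite addr0.
move=> h e e0; have [s sP] := h e e0; exists s => z /sP.
by rewrite (_ : F z + (G z - F z) = G z) // addrC subrK.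
Qed.

Lemma asymM F G l m j k : asym F l j -> asym G m k -> asym (fun z => F z * G z) (l * m) (j + k).
Proof.
move=> aF aG e e0.
pose q := normc l + normc m + 1.
have [lp mp] := (normc_ge0 l, normc_ge0 m).
have q0 : 0 < q by rewrite ltr_wpDl // addr_ge0.
pose e' := Num.min 1 (e / q); have e'0 : 0 < e' by rewrite lt_min ltr01 divr_gt0.
have e'1 : e' <= 1 by rewrite ge_min lexx.
have e'q : e' * q <= e.
  apply: le_trans (_ : e / q * q <= _); last by rewrite divfK // gt_eqF.
  by rewrite ler_pM2r // ge_min lexx orbT.
have [r rP] := aF _ e'0; have [s sP] := aG _ e'0.
exists (Num.max r s) => z; rewrite gt_max => /andP[/rP h1 /sP h2].
set x := normc z ^+ j in h1; set y := normc z ^+ k in h2.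
have x0 : 0 <= x by rewrite exprn_ge0 // normc_ge0.
have y0 : 0 <= y by rewrite exprn_ge0 // normc_ge0.
have -> : F z * G z - l * m * z ^+ (j + k) = (F z - l * z ^+ j) * (G z - m * z ^+ k) + (F z - l * z ^+ j) * (m * z ^+ k) + l * z ^+ j * (G z - m * z ^+ k).
  by rewrite exprD; ring.
rewrite exprD -/x -/y.
apply: le_trans (_ : (e' * x) * (e' * y) + (e' * x) * (normc m * y) + normc l * x * (e' * y) <= _).
  apply: le_trans (normcD _ _) _; apply: lerD.
    apply: le_trans (normcD _ _) _; apply: lerD; rewrite normcMM ?ler_pM ?normc_ge0 //.
    by rewrite normcMM normcX.
  by rewrite !normcMM normcX ler_pM ?mulr_ge0 ?normc_ge0.
have xy : 0 <= x * y by rewrite mulr_ge0.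
have -> : e' * x * (e' * y) + e' * x * (normc m * y) + normc l * x * (e' * y) = (e' * (e' + normc m + normc l)) * (x * y) by ring.
apply: ler_wpM2r => //; apply: le_trans e'q; rewrite ler_pM2l // /q; lra.
Qed.

Lemma asym_uniq F l m k : asym F l k -> asym F m k -> l = m.
Proof.
move=> aF aG; apply/eqP; rewrite -subr_eq0 -normc_eq0; apply/eqP.
apply/eqP; rewrite eq_le normc_ge0 andbT; apply/ler_addgt0Pl => e e0; rewrite addr0.
have e2 : 0 < e / 2 by rewrite divr_gt0.
have [r rP] := aF _ e2; have [s sP] := aG _ e2.
pose z : K := (`|r| + `|s| + 1)%:C.
have z0 : 0 < `|r| + `|s| + 1 by rewrite ltr_wpDl // addr_ge0.
have nz : normc z = `|r| + `|s| + 1 by rewrite normc_real gtr0_norm.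
have [lr ls] := (ler_norm r, ler_norm s); have [gr gs] := (normr_ge0 r, normr_ge0 s).
have h1 := rP z (ltac:(rewrite nz; lra)); have h2 := sP z (ltac:(rewrite nz; lra)).
have zk : 0 < normc z ^+ k by rewrite exprn_gt0 // nz.
rewrite -(ler_pM2r zk) -normcX -normcMM normcX.
have -> : (l - m) * z ^+ k = (F z - m * z ^+ k) - (F z - l * z ^+ k) by ring.
apply: le_trans (normcD _ _) _; rewrite normcN.
apply: le_trans (lerD h2 h1) _.
by rewrite -mulrDl ler_pM2r //; lra.
Qed.

Lemma asym_lnc F l k : l != 0 -> asym F l k -> exists r M : R, forall z, r < normc z ->
  F z != 0 /\ `|lnc (F z) - k%:R * ln (normc z)| <= M.
Proof.
move=> l0 aF; have ln0 : 0 < normc l by rewrite normc_gt0.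
have e0 : 0 < normc l / 2 by rewrite divr_gt0.
have [r rP] := aF _ e0; exists (Num.max r 0), (`|ln (normc l / 2)| + `|ln (normc l * 3 / 2)|) => z.
rewrite gt_max => /andP[/rP h z0].
have zk : 0 < normc z ^+ k by rewrite exprn_gt0.
have lo : normc l / 2 * normc z ^+ k <= normc (F z).
  have := normcD (F z) (- (F z - l * z ^+ k)); rewrite normcN opprB addrC subrK normcMM normcX.
  lra.
have hi : normc (F z) <= normc l * 3 / 2 * normc z ^+ k.
  have := normcD (F z - l * z ^+ k) (l * z ^+ k); rewrite subrK normcMM normcX.
  lra.
have Fp : 0 < normc (F z) by apply: lt_le_trans lo; rewrite mulr_gt0.
split; first by rewrite -normc_gt0.
have l3 : 0 < normc l * 3 / 2 by rewrite !mulr_gt0.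
have lnlo : ln (normc l / 2) + k%:R * ln (normc z) <= lnc (F z).
  by rewrite mulr_natl -lnXn // -lnM ?posrE // ler_ln ?posrE // mulr_gt0.
have lnhi : lnc (F z) <= ln (normc l * 3 / 2) + k%:R * ln (normc z).
  by rewrite mulr_natl -lnXn // -lnM ?posrE // ler_ln ?posrE // mulr_gt0.
have := ler_norm (ln (normc l * 3 / 2)); have := ler_norm (- ln (normc l / 2)); rewrite normrN.
have := normr_ge0 (ln (normc l * 3 / 2)); have := normr_ge0 (ln (normc l / 2)).
by rewrite ler_norml => *; apply/andP; split; lra.
Qed.

(** The factor |z| on the left avoids the exponent k - 1 of the usual bound M |w - z| |z|^(k -
    1). *)
Lemma poly_lipschitz (q : {poly K}) k : (size q <= k.+1)%N ->
  exists2 M : R, 0 <= M & forall z w : K, 1 <= normc z -> normc (w - z) <= 1 ->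
    normc q.[w] <= M * normc z ^+ k /\
    normc (q.[z] - q.[w]) * normc z <= M * normc (w - z) * normc z ^+ k.
Proof.
elim/poly_ind: q k => [|p c IH] k sk.
  by exists 0 => // z w _ _; rewrite !horner0 subrr ComplexField.Normc.normc0 !mul0r.
have pc z : (p * 'X + c%:P).[z] = p.[z] * z + c by rewrite hornerMXaddC.
have zk (z : K) j : 1 <= normc z -> 1 <= normc z ^+ j by exact: exprn_ege1.
case: k sk => [|k] sk.
  have -> : p = 0.
    apply/eqP; rewrite -size_poly_eq0; move: sk; rewrite -cons_poly_def size_cons_poly.
    by case: nilP => [->//|]; case: (size p).
  exists (normc c); first exact: normc_ge0.
  move=> z w z1 wz; rewrite !hornerMXaddC !horner0 !mul0r add0r subrr ComplexField.Normc.normc0 mul0r expr0 !mulr1.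
  by rewrite mulr_ge0 ?normc_ge0.
have sp : (size p <= k.+1)%N.
  by move: sk; rewrite -cons_poly_def size_cons_poly; case: nilP => [->//|_].
have [M M0 HM] := IH k sp; exists (2 * M + normc c); first by rewrite addr_ge0 ?mulr_ge0 ?normc_ge0.
move=> z w z1 wz; have [h1 h2] := HM z w z1 wz.
have z0 : 0 <= normc z by exact: normc_ge0.
have wz2 : normc w <= 2 * normc z.
  by have := normcD (w - z) z; rewrite subrK; lra.
have nc := normc_ge0 c.
have y0 : 0 <= normc z ^+ k by rewrite exprn_ge0.
rewrite !pc exprS; split.
  apply: le_trans (normcD _ _) _; rewrite mulrDl lerD //.
    rewrite normcMM; apply: le_trans (_ : M * normc z ^+ k * (2 * normc z) <= _); last by rewrite le_eqVlt; apply/orP; left; apply/eqP; ring.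
    by rewrite ler_pM ?normc_ge0.
  by rewrite ler_peMr // -exprS zk.
have -> : p.[z] * z + c - (p.[w] * w + c) = (p.[z] - p.[w]) * z + p.[w] * (z - w) by ring.
have d0 := normc_ge0 (w - z).
apply: le_trans (_ : (M * normc (w - z) * normc z ^+ k + M * normc z ^+ k * normc (w - z)) * normc z <= _).
  rewrite ler_wpM2r //; apply: le_trans (normcD _ _) _; rewrite !normcMM lerD //.
  by rewrite (normcB z) ler_wpM2r.
rewrite (_ : _ * normc z = 2 * M * (normc (w - z) * (normc z * normc z ^+ k))); last by ring.
rewrite -[leRHS]mulrA; apply: ler_wpM2r; last by rewrite lerDl.
by rewrite !mulr_ge0.
Qed.

End Asymptotics.

(** * The Walsh map of a polynomial preimage *)

Section Core.
Variable R : realType.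
Local Notation C := (cplx R).
Local Notation K := R[i].
Local Notation Chat := (sphere R).
Local Notation normc := ComplexField.Normc.normc.

(** * Topology of the plane *)

Lemma separate_closed (A B : set C) : closed A -> closed B -> A `&` B = set0 ->
  exists G H : set C, [/\ open G, open H, A `<=` G, B `<=` H & G `&` H = set0].
Proof.
(* Each point contributes balls of at most half its distance to the other set, so balls from the two
   sides cannot meet. *)
pose G (A B : set C) : set C := [set z : K | exists2 a : K, A a & exists2 e : R,
  0 < e & normc (z - a) < e /\ forall b : K, B b -> 2 * e <= normc (a - b)].
have oG A' B' : open (G A' B').
  rewrite openE => z [a Aa [e e0 [za aB]]]; apply/nbhs_cplx.
  exists (e - normc ((z : K) - a)); first by rewrite subr_gt0.
  move=> y yz; exists a => //; exists e => //; split => //.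
  have := normcD (y - z) (z - a); rewrite addrA subrK => h; lra.
have sG A' B' : closed B' -> A' `&` B' = set0 -> A' `<=` G A' B'.
  move=> cB AB a Aa; have : nbhs (a : C) (~` B').
    apply: open_nbhs_nbhs; split; first exact: closed_openC.
    by move=> Ba; have : (A' `&` B') a by []; rewrite AB.
  move=> /nbhs_cplx[e e0 He]; exists a => //; exists (e / 2); first by rewrite divr_gt0.
  split; first by rewrite subrr ComplexField.Normc.normc0 divr_gt0.
  move=> b Bb; rewrite leNgt; apply/negP => h.
  by apply: (He b) => //; rewrite normcB; apply: lt_le_trans h _; rewrite mulrC divfK.
move=> cA cB AB; exists (G A B), (G B A); split => //; first exact: sG.
  by apply: sG => //; rewrite setIC.
apply/seteqP; split => // z [[a Aa [e e0 [za aB]]] [b Bb [e' e'0 [zb bA]]]].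
have := normcD (a - z) (z - b); rewrite addrA subrK (normcB a z) => h.
have := aB b Bb; have := bA a Aa; rewrite (normcB b); lra.
Qed.

(** A point of largest real part works: moving it to the right leaves A at once. *)
Lemma boundary_point (A U : set C) : compact A -> A !=set0 -> open U -> A `<=` U ->
  exists2 e : K, A e & forall V : set C, nbhs (e : C) V -> exists z, [/\ V z, U z & ~ A z].
Proof.
move=> cA A0 oU AU.
have [z _|e Ae eP] := @EVTc_max R A (fun z => complex.Re z) cA A0.
  by apply: cont_Re; exact: contid.
exists e => // V Ve; have : nbhs (e : C) (V `&` U).
  by apply: filterI => //; apply: open_nbhs_nbhs; split => //; exact: AU.
move=> /nbhs_cplx[r r0 rP]; exists (e + (r / 2)%:C).
have [|Vz Uz] := rP (e + (r / 2)%:C).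
  by rewrite addrC addKr normc_real gtr0_norm ?divr_gt0 //; lra.
split => // /eP; rewrite raddfD /= gerDl; lra.
Qed.

Lemma le_lim0 (x y z : R) : (forall e, 0 < e -> x <= y + e * z) -> x <= y.
Proof.
move=> H; apply/ler_addgt0Pl => e e0; have z0 : 0 < `|z| + 1 by rewrite ltr_wpDl.
apply: le_trans (H (e / (`|z| + 1)) _) _; first by rewrite divr_gt0.
rewrite addrC lerD2r mulrAC ler_pdivrMr // ler_pM2l //.
by apply: le_trans (ler_norm z) _; rewrite lerDl.
Qed.

Lemma open_disc (a : K) (r : R) : open ([set w : K | normc (w - a) < r] : set C).
Proof.
rewrite openE => w ww; apply/nbhs_cplx; exists (r - normc ((w : K) - a)); first by rewrite subr_gt0.
move=> y yw; have := normcD ((y : K) - w) (w - a); rewrite addrA subrK /= => h; lra.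
Qed.

Lemma open_codisc (a : K) (r : R) : open ([set w : K | r < normc (w - a)] : set C).
Proof.
rewrite openE => w ww; apply/nbhs_cplx; exists (normc ((w : K) - a) - r); first by rewrite subr_gt0.
move=> y yw; have := normcD ((w : K) - y) (y - a).
by rewrite addrA subrK (normcB (w : K) y) /= => h; lra.
Qed.

Lemma bounded_normc (A : set C) (M : R) : (forall z : K, A z -> normc z <= M) -> bounded_set A.
Proof.
move=> H; exists M%:C; split; first by rewrite complex_real.
by move=> x Mx z /H h /=; rewrite normrC; apply: le_trans (ltW Mx); rewrite lecR.
Qed.

Lemma normc_bounded (A : set C) : bounded_set A -> exists M : R, forall z : K, A z -> normc z <= M.
Proof.
move=> [M [Mr H]]; exists (complex.Re M + 1) => z Az; have := H (complex.Re M + 1)%:C.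
have h : M < (complex.Re M + 1)%:C by rewrite -[M in M < _]RRe_real // ltcR ltrDl.
by move=> /(_ h z Az); rewrite /= normrC lecR.
Qed.

Lemma connected_setU1 (T : topologicalType) (A : set T) (e : T) :
  connected A -> closure A e -> connected (A `|` [set e]).
Proof.
move=> cA eA B [x Bx] [U oU BU] [F cF BF].
have [y [Ay By]] : A `&` B !=set0.
  move: (Bx); rewrite {1}BU => -[[Ax|xe] Ux]; first by exists x.
  rewrite xe in Ux; have [y [Ay Uy]] := eA U (open_nbhs_nbhs (conj oU Ux)).
  by exists y; split => //; rewrite BU; split => //; left.
have AB : A `&` B = A.
  apply: cA; first by exists y.
    exists U => //; rewrite BU setIA; congr (_ `&` _).
    by apply/seteqP; split => [z []//|z Az]; split => //; left.
  exists F => //; rewrite BF setIA; congr (_ `&` _).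
  by apply/seteqP; split => [z []//|z Az]; split => //; left.
have AF : A `<=` F by rewrite -AB BF => z [_ []].
rewrite BF; apply/seteqP; split => [z []//|z zT]; split => //.
case: zT => [/AF//|->].
by have := closureS AF eA; rewrite -((closure_id F).1 cF).
Qed.

(** * Comparison of the two Green functions *)

Section Walsh.
Variables (P : {poly K}) (n : nat) (Om : set C) (Phi rho : Chat -> Chat).
Variables (a1 a2 d1 : K) (m1 m2 c : R).
Let E : set C := [set z : K | Om P.[z]].
Let L : set C := [set w : K | Ul a1 a2 m1 m2 w <= c].
Let B1 : set C := [set w : K | `|w| <= 1].
(** The degree of P. In this section n is the degree minus one, so the coefficient of index n is the
    one after the leading coefficient. *)
Let N := n.+1.
Hypothesis sP : size P = n.+2.
Hypothesis cOm : compact Om.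
Hypothesis Om0 : Om !=set0.
Hypothesis cPhi : conformal_map (sphere_compl E) (sphere_compl L) Phi.
Hypothesis Phi_inf : Phi None = None.
Hypothesis crho : conformal_map (sphere_compl Om) (sphere_compl B1) rho.
Hypothesis rho_inf : rho None = None.
Local Notation f := (fin Phi).
Local Notation g := (fin rho).
Hypothesis f_asym : exists r M, forall z, r < normc z -> normc (z * (f z - z)) <= M.
Hypothesis g_asym : exists r M, forall z, r < normc z -> normc (g z - d1 * z) <= M.
Hypothesis d10 : d1 != 0.
Hypothesis a12 : a1 != a2.
Hypotheses (m10 : 0 < m1) (m20 : 0 < m2) (m12 : m1 + m2 = 1) (c0 : 0 <= c).

Lemma asymP : asym (fun z => P.[z]) P`_N N.
Proof. by apply: asym_poly; rewrite sP. Qed.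

Let pN : P`_N != 0 := lead_neq0 sP.

Lemma P_growth (M : R) : exists r : R, forall z : K, r < normc z -> M < normc P.[z].
Proof.
have p2 : 0 < normc (P`_N) / 2 by rewrite divr_gt0 // normc_gt0.
have [r rP] := asymP p2.
have [s sP'] := @large_pow R (M + 1) _ N p2 isT.
exists (Num.max r s) => z; rewrite gt_max => /andP[/rP h1 /sP' h2].
have := normcD P.[z] (- (P.[z] - P`_N * z ^+ N)); rewrite normcN opprB addrC subrK.
rewrite normcMM normcX; lra.
Qed.

Lemma contP z : @contc R C (fun z => P.[z]) z.
Proof. by apply: (@cdiff_cont R (fun z => P.[z])); exact: cdiff_poly. Qed.

Lemma compact_preimage : compact E.
Proof.
have [r rP] := compact_bounded_normc cOm; have [s sP'] := P_growth r.
apply: (@closed_bounded_compact R _ s).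
  apply: (@preimage_closed _ _ (fun z : C => P.[z] : C) Om) => [z _|]; first exact: contP.
  exact: (closed_of_compact cOm).
by move=> z /rP; apply: contraTT; rewrite -!ltNge; exact: sP'.
Qed.

Lemma oD : open (~` E).
Proof. by apply: closed_openC; apply: closed_of_compact; exact: compact_preimage. Qed.

Lemma g_out v : ~ Om v -> 1 < normc (g v).
Proof.
move=> Ov; have := fin_out crho rho_inf Ov; rewrite /B1 /= normrC => h.
by rewrite ltNge; apply/negP => h1; apply: h; rewrite -[1]/(1%:C) lecR.
Qed.

Lemma f_out z : ~ E z -> c < Ul a1 a2 m1 m2 (f z).
Proof. by move=> Ez; have /negP := fin_out cPhi Phi_inf Ez; rewrite -ltNge. Qed.

Lemma f_neq z : ~ E z -> f z != a1 /\ f z != a2.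
Proof. by move=> /f_out h; apply: (Ul_gt0 m10 m20); exact: le_lt_trans h. Qed.

Lemma cdiff_f z : ~ E z -> cdiff f z.
Proof. exact: (fin_cdiff cPhi Phi_inf). Qed.

Lemma cdiff_g v : ~ Om v -> cdiff g v.
Proof. exact: (fin_cdiff crho rho_inf). Qed.

Lemma cdiff_gP z : ~ E z -> cdiff (fun z => g P.[z]) z.
Proof. by move=> Ez; apply: (@cdiff_comp R (fun z => P.[z]) g); [exact: cdiff_poly|exact: cdiff_g]. Qed.

Lemma gP_neq0 z : ~ E z -> g P.[z] != 0.
Proof. by move=> Ez; rewrite -normc_gt0 (lt_trans ltr01) // g_out. Qed.

Lemma f_near : exists r M, forall z, r < normc z -> normc (f z - z) <= M.
Proof.
have [r [M H]] := f_asym; exists (Num.max 1 r), M => z; rewrite gt_max => /andP[z1 zr].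
by apply: le_trans (H z zr); rewrite normcMM ler_peMl ?normc_ge0 // ltW.
Qed.

Lemma asymf a : asym (fun z => f z - a) 1 1.
Proof.
have [r [M H]] := f_near.
apply: (@asym_perturb R (fun z => z) _ 1 1 (M + normc a) r) => //.
  move=> z /H h; rewrite (_ : f z - a - z = (f z - z) - a); last by ring.
  by apply: le_trans (normcD _ _) _; rewrite normcN lerD2r.
move=> e e0; exists 0 => z _; rewrite expr1 mul1r subrr ComplexField.Normc.normc0.
by rewrite mulr_ge0 ?normc_ge0 // ltW.
Qed.

Lemma asymgP : asym (fun z => g P.[z]) (d1 * P`_N) N.
Proof.
have [r [M H]] := g_asym; have [s sP'] := P_growth r.
apply: (@asym_perturb R (fun z => d1 * P.[z]) _ _ N M s) => //.
  by move=> z /sP'; exact: H.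
exact: (asymZ d1 asymP).
Qed.

Lemma open_Ul_lt b : open ([set w : K | Ul a1 a2 m1 m2 w < b] : set C).
Proof.
rewrite openE => w /= wb; have e0 : 0 < b - Ul a1 a2 m1 m2 w by rewrite subr_gt0.
have /contRe/(_ _ e0) := @cont_Ul R a1 a2 m1 m2 m10 m20 w.
by apply: filterS => y; rewrite ltr_norml => /andP[_ h]; rewrite /= ; lra.
Qed.

(* Both sides tend to 0 at E and are asymptotic to N ln |z|; scaling one of them
   by 1 + e turns infinity into a boundary point where the maximum principle for
   the difference applies. The case c = 0 would give a bound by -oo. *)
Lemma c_gt0_green : 0 < c /\ forall z, ~ E z ->
  lnc (g P.[z]) = N%:R * (ul a1 a2 m1 m2 (f z) - ln c).
Proof.
have N0 : 0 < N%:R :> R by rewrite ltr0n.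
pose fs (i : 'I_3) (z : K) : K := if i == 0 :> nat then f z - a1 else if i == 1 :> nat then f z - a2 else g P.[z].
have lsE x y t z : logsum (fun i : 'I_3 => if i == 0 :> nat then x else if i == 1 :> nat then y else t) fs z =
    x * lnc (f z - a1) + y * lnc (f z - a2) + t * lnc (g P.[z]).
  by rewrite /logsum !big_ord_recl big_ord0 /= addr0 addrA.
have dfs i w : (~` E) w -> cdiff (fs i) w /\ fs i w != 0.
  move=> Ew; have [w1 w2] := f_neq Ew; rewrite /fs; case: ifP => _.
    rewrite subr_eq0; split => //; apply: (@cdiffB R f (fun=> a1)); [exact: cdiff_f|exact: cdiff_cst].
  case: ifP => _.
    rewrite subr_eq0; split => //; apply: (@cdiffB R f (fun=> a2)); [exact: cdiff_f|exact: cdiff_cst].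
  by split; [exact: cdiff_gP|exact: gP_neq0].
have [r1 [M1 H1]] := asym_lnc (oner_neq0 _) (asymf a1).
have [r2 [M2 H2]] := asym_lnc (oner_neq0 _) (asymf a2).
have [r3 [M3 H3]] := asym_lnc (mulf_neq0 d10 pN) asymgP.
have lnbig (x : R) : exists r : R, forall z : K, r < normc z -> x <= ln (normc z).
  exists (expR x) => z h; rewrite -ler_expR lnK ?ltW // posrE; exact: lt_trans (expR_gt0 x) h.
have inf x y t B : x + y + N%:R * t < 0 -> exists r : R, forall z : K, (~` E) z -> r < normc z ->
   x * lnc (f z - a1) + y * lnc (f z - a2) + t * lnc (g P.[z]) <= B.
  move=> s0; pose s := x + y + N%:R * t.
  have [r rP] := lnbig ((`|x| * M1 + `|y| * M2 + `|t| * M3 - B) / - s).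
  exists (Num.max (Num.max r1 r2) (Num.max r3 r)) => z _.
  rewrite !gt_max => /andP[/andP[/H1[_ h1] /H2[_ h2]] /andP[/H3[_ h3] /rP]].
  rewrite ler_pdivrMr ?oppr_gt0 // mulrN => h.
  set l := ln (normc z) in h1 h2 h3 h.
  have k (u v w M : R) : `|v - w| <= M -> u * v <= u * w + `|u| * M.
    move=> vw; rewrite -lerBlDl -mulrBr; apply: le_trans (ler_norm _) _.
    by rewrite normrM ler_wpM2l.
  have k1 := k x _ _ _ h1; have k2 := k y _ _ _ h2; have k3 := k t _ _ _ h3.
  rewrite /s in h; lra.
have ulE z : N%:R * m1 * lnc (f z - a1) + N%:R * m2 * lnc (f z - a2) = N%:R * ul a1 a2 m1 m2 (f z).
  by rewrite /ul mulrDr !mulrA.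
(* A level c' > c is used because ln c is meaningful only once c = 0 has been excluded. *)
have up c' (e : R) z : 0 < c' -> c < c' -> 0 < e -> ~ E z ->
    N%:R * ul a1 a2 m1 m2 (f z) <= (1 + e) * lnc (g P.[z]) + N%:R * ln c'.
  move=> c'0 cc' e0 Ez.
  have := @max_principle R 3 _ fs (~` E) (N%:R * ln c') oD dfs _ _ z Ez.
  move=> /(_ (fun i : 'I_3 => if i == 0 :> nat then N%:R * m1 else if i == 1 :> nat then N%:R * m2 else - (1 + e))).
  rewrite lsE ulE => h; suff : N%:R * ul a1 a2 m1 m2 (f z) + - (1 + e) * lnc (g P.[z]) <= N%:R * ln c' by lra.
  apply: h.
    have [||V [oV EV VP]] := fin_proper cPhi Phi_inf compact_preimage (W := [set w : K | Ul a1 a2 m1 m2 w < c']).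
    - exact: open_Ul_lt.
    - by move=> w /= h; exact: le_lt_trans cc'.
    exists V; split => //; first by rewrite setCK.
    move=> w Vw Ew; rewrite lsE ulE; have [w1 w2] := f_neq Ew.
    have /= := VP w Vw Ew; rewrite Ul_exp // -{1}[c']lnK // ltr_expR => h1.
    have h2 : 0 <= lnc (g P.[w]) by apply: ln_ge0; rewrite ltW // g_out.
    have : 0 <= (1 + e) * lnc (g P.[w]) by rewrite mulr_ge0 //; lra.
    have : N%:R * ul a1 a2 m1 m2 (f w) <= N%:R * ln c' by rewrite ler_pM2l // ltW.
    lra.
  have [|r rP] := inf (N%:R * m1) (N%:R * m2) (- (1 + e)) (N%:R * ln c').
    rewrite -mulrDr m12 mulr1 mulrN -{1}[N%:R]mulr1 -mulrBr pmulr_rlt0 //; lra.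
  by exists r => w Ew wr; rewrite lsE; exact: rP.
have [z0 Ez0] : exists z0, ~ E z0.
  have [r rP] := compact_bounded_normc compact_preimage; exists (`|r| + 1)%:C => /rP.
  rewrite normc_real ger0_norm ?addr_ge0 //; have := ler_norm r; lra.
have cp : 0 < c.
  rewrite lt_def c0 andbT; apply/eqP => cz.
  (* With e = 1 the bound reads x <= 2 y + N ln c'; the level c' is chosen so that the right-hand
     side is x - 1. *)
  set x := N%:R * ul a1 a2 m1 m2 (f z0); set y := lnc (g P.[z0]).
  have q0 : c < expR ((x - 2 * y - 1) / N%:R) by rewrite cz expR_gt0.
  have := up _ 1 z0 (expR_gt0 _) q0 ltr01 Ez0.
  rewrite expRK [N%:R * (_ / _)]mulrC divfK ?gt_eqF // -/x -/y; lra.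
split => // z Ez; rewrite mulrBr.
have lec (e : R) : 0 < e -> c < c * expR e.
  by move=> e0; rewrite -{1}[c]mulr1 ltr_pM2l // -expR0 ltr_expR.
apply/eqP; rewrite eq_le; apply/andP; split; last first.
  rewrite lerBlDr; apply: (@le_lim0 _ _ (lnc (g P.[z]) + N%:R)) => e e0.
  have := up (c * expR e) e z (mulr_gt0 cp (expR_gt0 _)) (lec e e0) e0 Ez.
  rewrite lnM ?posrE ?expR_gt0 // expRK; lra.
apply: (@le_lim0 _ _ (1 + N%:R * ul a1 a2 m1 m2 (f z) - N%:R * ln c)) => e e0.
(* Reverse comparison: near E, ln |g o P| <= e by properness of g, and ul >= ln c off E, so the
   difference with ul scaled by 1 + e is at most B there. *)
pose B := e - N%:R * (1 + e) * ln c.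
have := @max_principle R 3 _ fs (~` E) B oD dfs _ _ z Ez.
move=> /(_ (fun i : 'I_3 => if i == 0 :> nat then - (1 + e) * (N%:R * m1) else if i == 1 :> nat then - (1 + e) * (N%:R * m2) else 1)).
have ulE' z' : - (1 + e) * (N%:R * m1) * lnc (f z' - a1) + - (1 + e) * (N%:R * m2) * lnc (f z' - a2) = - (1 + e) * (N%:R * ul a1 a2 m1 m2 (f z')).
  by rewrite -ulE; ring.
rewrite lsE ulE' mul1r => h; suff : - (1 + e) * (N%:R * ul a1 a2 m1 m2 (f z)) + lnc (g P.[z]) <= B by rewrite /B; lra.
apply: h.
  have [||V [oV OV VP]] := fin_proper crho rho_inf cOm (W := [set w : K | normc w < expR e]).
  - rewrite openE => w ww; apply/nbhs_cplx; exists (expR e - normc (w : K)); first by rewrite subr_gt0.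
    move=> y yw; have := normcD ((y : K) - w) w; rewrite subrK /= => h'; lra.
  - move=> w; rewrite /B1 /= normrC -[1]/(1%:C) lecR => h'; apply: le_lt_trans h' _.
    by rewrite -expR0 ltr_expR.
  exists ((fun z : C => P.[z] : C) @^-1` V); split.
  - by apply: open_comp => // w _; exact: contP.
  - by rewrite setCK => w; exact: OV.
  move=> w Vw Ew; rewrite lsE ulE' mul1r; have [w1 w2] := f_neq Ew.
  have /= h1 := VP _ Vw Ew.
  have h2 : lnc (g P.[w]) <= e.
    by rewrite -ler_expR lnK ?posrE ?normc_gt0 ?gP_neq0 // ltW.
  have h3 : ln c <= ul a1 a2 m1 m2 (f w).
    by rewrite -ler_expR lnK ?posrE // -Ul_exp // ltW // f_out.
  have h4 : N%:R * (1 + e) * ln c <= N%:R * (1 + e) * ul a1 a2 m1 m2 (f w).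
    by rewrite ler_wpM2l // mulr_ge0 ?ler0n //; lra.
  rewrite /B; lra.
have [|r rP] := inf (- (1 + e) * (N%:R * m1)) (- (1 + e) * (N%:R * m2)) 1 B.
  rewrite -mulrDr -mulrDr m12 !mulr1 mulNr mulrDl mul1r opprD addrAC addNr add0r oppr_lt0 mulr_gt0 //.
by exists r => w Ew wr; rewrite lsE; exact: rP.
Qed.

(** * Inverse Walsh map and integrality of the exponents *)

Hypothesis cu : c < ustar a1 a2 m1 m2.
Let d := normc (a1 - a2).

Lemma out_of_L w : c < Ul a1 a2 m1 m2 w -> exists2 z, ~ E z & f z = w.
Proof. by move=> h; apply: (fin_surj cPhi Phi_inf) => /=; rewrite /L /= leNgt h. Qed.

(* The inverse of the Walsh map; xget returns 0 when w lies in L. *)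
Definition psi (w : K) : K := xget 0 [set z : K | ~ E z /\ f z = w].

Lemma psiP w : c < Ul a1 a2 m1 m2 w -> ~ E (psi w) /\ f (psi w) = w.
Proof.
move=> h; rewrite /psi; case: xgetP => [z _ //|none].
by have [z Ez fz] := out_of_L h; case: (none z).
Qed.

Lemma f_inj x y : ~ E x -> ~ E y -> f x = f y -> x = y.
Proof. exact: (fin_inj cPhi Phi_inf). Qed.

Lemma psi_f z : ~ E z -> psi (f z) = z.
Proof. by move=> Ez; have [h1 h2] := psiP (f_out Ez); exact: f_inj h2. Qed.

Lemma cont_psi w : c < Ul a1 a2 m1 m2 w -> @contc R C psi w.
Proof.
move=> h V Vw; have [Ez fz] := psiP h.
have := fin_open cPhi Phi_inf compact_preimage Ez Vw; rewrite fz; apply: filterS => _ [z [Vz nEz] <-].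
by rewrite /= psi_f.
Qed.

(* Along the preimage of the circle |w - a1| = m1 d, the modulus of the single
   valued rho o P is |f - a1|^(N m1) |f - a2|^(N m2) up to a constant. *)
Lemma exponent_nat : exists al1 al2 : nat,
  [/\ (0 < al1)%N, (0 < al2)%N, (al1 + al2 = N)%N, N%:R * m1 = al1%:R & N%:R * m2 = al2%:R].
Proof.
have N0 : 0 < N%:R :> R by rewrite ltr0n.
have dp : 0 < d by exact: d_gt0.
have md : 0 < m1 * d by rewrite mulr_gt0.
have i1 : N%:R * m1 \is a Num.int.
  have [cp green] := c_gt0_green.
  have out t : c < Ul a1 a2 m1 m2 (a1 + (m1 * d)%:C * cis t).
    apply: lt_le_trans cu _; apply: (circle_ustar a12 m10 m20 m12).
    by rewrite normc_ray // ltW.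
  apply: (@exponent_int R (N%:R * m1) (N%:R * m2) (m1 * d) (- (N%:R * ln c)) a1 a2
    (fun t => psi (a1 + (m1 * d)%:C * cis t)) f (fun z => g P.[z])) => //.
  - rewrite -/d -[ltRHS]mul1r ltr_pM2r //; move: m12 m20; lra.
  - move=> t; apply: (@contc_comp R R (fun t => a1 + (m1 * d)%:C * cis t) psi); first exact: cont_circle.
    exact: cont_psi.
  - by move=> t; have [_ ->] := psiP (out t).
  - by congr (psi (a1 + _ * _)); rewrite /cis mulr_natl cos2pi sin2pi cos0 sin0.
  move=> t; have [Ez _] := psiP (out t); have := near_out compact_preimage Ez; apply: filterS => w Ew.
  have [w1 w2] := f_neq Ew; split => //; [exact: cdiff_f|exact: cdiff_gP|].
  split; first exact: gP_neq0.
  by rewrite green // /ul; ring.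
have n1 : 0 <= N%:R * m1 by rewrite mulr_ge0 // ltW.
have /natrP[al1 E1] : N%:R * m1 \is a Num.nat by rewrite natrEint i1.
have E12 : N%:R * m2 = N%:R - al1%:R by rewrite -E1 (_ : m2 = 1 - m1) ?mulrBr ?mulr1 //; move: m12; lra.
have al1N : (al1 < N)%N by rewrite -(ltr_nat R) -E1 -[ltRHS]mulr1 ltr_pM2l //; move: m12 m20; lra.
exists al1, (N - al1)%N; split => //.
- by rewrite -(ltr_nat R) -E1 mulr_gt0.
- by rewrite subn_gt0.
- by rewrite subnKC // ltnW.
- by rewrite E12 natrB // ltnW.
Qed.

(** * The identity relating P and Q, and the two equations for the centres *)

Section Exponents.
Variables al1 al2 : nat.
Hypotheses (al12 : (al1 + al2 = N)%N) (E1 : N%:R * m1 = al1%:R) (E2 : N%:R * m2 = al2%:R).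

Definition Qp : {poly K} := ('X - a1%:P) ^+ al1 * ('X - a2%:P) ^+ al2.

Lemma QpE w : Qp.[w] = (w - a1) ^+ al1 * (w - a2) ^+ al2.
Proof. by rewrite /Qp hornerM !horner_exp !hornerXsubC. Qed.

Lemma normc_Qp w : normc Qp.[w] = Ul a1 a2 m1 m2 w ^+ N.
Proof.
rewrite QpE normcMM !normcX /Ul exprMn -!powR_mulrn ?powR_ge0 ?normc_ge0 //.
by rewrite -!powRrM -E1 -E2 ![_ * N%:R]mulrC.
Qed.

Lemma Qp_neq0 z : ~ E z -> Qp.[f z] != 0.
Proof. by move=> Ez; have [? ?] := f_neq Ez; rewrite QpE mulf_neq0 // expf_neq0 // subr_eq0. Qed.

Lemma asymQ : asym (fun z => Qp.[f z]) 1 N.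
Proof.
have pw a k : asym (fun z => (f z - a) ^+ k) 1 k.
  elim: k => [|k IH].
    move=> e e0; exists 0 => z _; rewrite expr0 mul1r subrr ComplexField.Normc.normc0.
    by rewrite expr0 mulr1 ltW.
  have := asymM (asymf a) IH; rewrite mulr1 add1n => h.
  by move=> e e0; have [r rP] := h e e0; exists r => z /rP; rewrite -exprS.
have := asymM (pw a1 al1) (pw a2 al2); rewrite mulr1 al12 => h e e0.
by have [r rP] := h e e0; exists r => z /rP; rewrite QpE.
Qed.

(* The quotient H of both sides has constant modulus, so it is locally constant.
   A level set of H with another value is bounded, and on it ln |rho o P| > 0
   would violate the maximum principle, since it tends to 0 at E. *)
Lemma Qp_conj z : ~ E z -> g P.[z] = d1 * P`_N * Qp.[f z].
Proof.
have [cp green] := c_gt0_green.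
pose H z := g P.[z] / Qp.[f z].
have cdH w : ~ E w -> cdiff H w.
  move=> Ew; apply: cdiffM; first exact: cdiff_gP.
  apply: (@cdiffV R (fun z => Qp.[f z])); first exact: Qp_neq0.
  by apply: (@cdiff_comp R f (fun z => Qp.[z])); [exact: cdiff_f|exact: cdiff_poly].
have nH w : ~ E w -> normc (H w) = expR (- (N%:R * ln c)).
  move=> Ew; rewrite normcMM normcVV normc_Qp; have [w1 w2] := f_neq Ew.
  have gp : 0 < normc (g P.[w]) by rewrite normc_gt0 gP_neq0.
  rewrite -[normc (g _)]lnK ?posrE // -[ln _]/(lnc _) green // Ul_exp //.
  by rewrite -expRM_natl -expRN -expRD; congr expR; ring.
have lcH w : ~ E w -> \forall v \near (w : C), H v = H w.
  move=> Ew; apply: cst_normc_near; first by rewrite mulf_neq0 ?gP_neq0 // invr_neq0 // Qp_neq0.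
  have := near_out compact_preimage Ew; apply: filterS => v Ev; split; first exact: cdH.
  by rewrite !nH.
move=> Ez; suff : H z = d1 * P`_N by move=> <-; rewrite divfK // Qp_neq0.
apply/eqP; apply: contrapT => /negP Hz; pose S : set C := [set w : K | ~ E w /\ H w = H z].
have oS : open S.
  rewrite openE => w [Ew Hw]; have := lcH w Ew; have := near_out compact_preimage Ew.
  by apply: filterS2 => v Ev Hv; split => //; rewrite Hv.
have [r rP] : exists r, forall w, S w -> normc w <= r.
  have := asymD (asymZ (H z) asymQ) (asymZ (-1) asymgP).
  rewrite mulr1 mulN1r => /asym_lnc; rewrite subr_eq0 => /(_ Hz)[r [M rP]].
  exists r => w [Ew Hw]; rewrite leNgt; apply/negP => /rP[+ _].
  by rewrite -Hw divfK ?Qp_neq0 // mulN1r subrr eqxx.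
have key (t : R) : 1 < t -> lnc (g P.[z]) <= ln t.
  move=> t1; have t0 := lt_trans ltr01 t1.
  have := @max_principle R 1 (fun=> 1) (fun _ z => g P.[z]) S (ln t) oS.
  have lsE w : logsum (fun _ : 'I_1 => 1) (fun _ z => g P.[z]) w = lnc (g P.[w]).
    by rewrite /logsum big_ord1 mul1r.
  move=> h; rewrite -(lsE z); apply: h => //.
  - by move=> _ w [Ew _]; split; [exact: cdiff_gP|exact: gP_neq0].
  - have [||V [oV OV VP]] := fin_proper crho rho_inf cOm (W := [set w : K | normc w < t]).
    + rewrite openE => w ww; apply/nbhs_cplx; exists (t - normc (w : K)); first by rewrite subr_gt0.
      move=> y yw; have := normcD ((y : K) - w) w; rewrite subrK /= => h'; lra.
    + by move=> w; rewrite /B1 /= normrC -[1]/(1%:C) lecR => h'; apply: le_lt_trans t1.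
    (* The complement of S consists of E and of the other level sets of H; the latter form an open
       set, and near E |g o P| < t. *)
    exists ((fun z : C => P.[z] : C) @^-1` V `|` [set w : K | ~ E w /\ H w <> H z]); split.
    + apply: openU; first by apply: open_comp => // w _; exact: contP.
      rewrite openE => w [Ew Hw]; have := lcH w Ew; have := near_out compact_preimage Ew.
      by apply: filterS2 => v Ev Hv; split => //; rewrite Hv.
    + move=> w Sw; have [Ew|Ew] := pselect (E w); first by left; exact: OV.
      by right; split => // Hw; apply: Sw.
    + move=> w [Vw|[_ Hw]] [Ew Hw']; last by case: Hw.
      by rewrite lsE ler_ln ?posrE ?normc_gt0 ?gP_neq0 // ltW // VP.
  - by exists r => w /rP; rewrite leNgt => /negP h1 h2; case: h1.
have := g_out Ez; set x := normc _ => x1.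
have := key ((1 + x) / 2) (ltac:(lra)); rewrite /lnc -/x ler_ln ?posrE; lra.
Qed.

Lemma size_Qp : size Qp = n.+2.
Proof.
rewrite /Qp size_Mmonic ?monic_exp ?monicXsubC // ?size_exp_XsubC.
  by rewrite addSn addnS /= al12.
by rewrite expf_neq0 // polyXsubC_eq0.
Qed.

(** The logarithmic derivative al1 / (w - a1) + al2 / (w - a2) with denominators cleared, which
    stays valid at the centres. *)
Lemma Qp_deriv w : Qp^`().[w] * ((w - a1) * (w - a2)) =
  Qp.[w] * (al1%:R * (w - a2) + al2%:R * (w - a1)).
Proof.
have dX (a : K) k : (('X - a%:P) ^+ k)^`().[w] * (w - a) = k%:R * (w - a) ^+ k.
  rewrite deriv_exp derivXsubC mul1r hornerMn horner_exp hornerXsubC -mulr_natl -mulrA.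
  by case: k => [|k]; rewrite ?mul0r // -exprSr.
rewrite /Qp derivM hornerD !hornerM mulrDl !horner_exp !hornerXsubC.
rewrite (_ : _ + _ = ((('X - a1%:P) ^+ al1)^`().[w] * (w - a1)) * ((w - a2) ^+ al2 * (w - a2)) +
  ((('X - a2%:P) ^+ al2)^`().[w] * (w - a2)) * ((w - a1) ^+ al1 * (w - a1))); last by ring.
by rewrite !dX; ring.
Qed.

(** Distinct points near zs with the same value of P have the same value of Q o f, and f is
    injective; so Q is not injective near f zs, and f zs is critical for Q. The equation is then
    read off [Qp_deriv]. *)
Lemma critical_center zs : P^`().[zs] = 0 -> ~ E zs ->
  N%:R * f zs = al1%:R * a2 + al2%:R * a1.
Proof.
move=> dP Ez; have [w1 w2] := f_neq Ez.
have dQ : Qp^`().[f zs] = 0.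
  apply/eqP/negPn/negP => /(noncritical_inj size_Qp)[U nU inj].
  have nD : nbhs (zs : C) [set z : K | ~ E z /\ U (f z)].
    have cf := @cdiff_cont R f zs (cdiff_f Ez).
    by have := cf _ nU; have := near_out compact_preimage Ez; apply: filterS2 => z Ez' Uz.
  have [x [y [xy [Ex Ux] [Ey Uy] Pxy]]] := critical_not_inj sP nD dP.
  case/eqP : xy; apply: f_inj => //; apply: inj => //.
  have dp0 : d1 * P`_N != 0 by rewrite mulf_neq0.
  by apply: (mulfI dp0); rewrite -!Qp_conj // Pxy.
have := Qp_deriv (f zs); rewrite dQ mul0r => /esym/eqP.
rewrite mulf_eq0 (negbTE (Qp_neq0 Ez)) /= => /eqP h.
apply/eqP; rewrite -subr_eq0 -h -al12 natrD; apply/eqP; ring.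
Qed.

(** Since f z - z = O(1 / z) and g (P z) - d1 P z is bounded, D = p_N Q - P is O(|z|^(n - 1)), so
    its coefficient of degree n vanishes. For n > 0 the bounded error is of lower order than z^n. *)
Lemma centers_sum : (0 < n)%N -> al1%:R * a1 + al2%:R * a2 = - (P`_n / P`_N).
Proof.
move=> n0; pose D := P`_N *: Qp - P.
have [r1 [M1 H1]] := f_asym; have [r2 [M2 H2]] := g_asym.
have [M3 M30 H3] := @poly_lipschitz R Qp N (ltac:(by rewrite size_Qp)).
have [s sP'] := P_growth r2.
have [rE rEP] := compact_bounded_normc compact_preimage.
have cN : Qp`_n = - (al1%:R * a1 + al2%:R * a2).
  have -> : Qp = prodr (nseq al1 a1 ++ nseq al2 a2).
    by rewrite /prodr big_cat !big_nseq /Qp !iter_mulr_1.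
  have sz : size (nseq al1 a1 ++ nseq al2 a2) = N by rewrite size_cat !size_nseq.
  have := @coefPn_prod_XsubC K (nseq al1 a1 ++ nseq al2 a2); rewrite sz => /(_ isT) ->.
  by rewrite big_cat !big_nseq !iter_addr_0 !mulr_natl.
have D0 : D`_n = 0.
  apply: (@asym_uniq R (fun z => D.[z]) D`_n 0 n).
    apply: asym_poly; apply/leq_sizeP => j; rewrite leq_eqVlt => /orP[/eqP<-|jn].
      have lc : Qp`_N = 1.
        have : Qp \is monic by rewrite /Qp monicMl ?monic_exp ?monicXsubC.
        by move/monicP; rewrite lead_coefE size_Qp.
      by rewrite /D coefB coefZ lc mulr1 subrr.
    by rewrite /D coefB coefZ [Qp`_j]nth_default ?size_Qp // [P`_j]nth_default ?sP // mulr0 subrr.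
  pose M4 := M2 / normc d1.
  have nd : 0 < normc d1 by rewrite normc_gt0.
  have bnd z : Num.max (Num.max r1 s) (Num.max rE (Num.max 1 M1)) < normc z ->
      normc (D.[z]) <= M4 + normc P`_N * (M3 * M1) * normc z ^+ n.-1.
    rewrite !gt_max => /andP[/andP[zr1 zs] /andP[zE /andP[z1 zM1]]].
    have Ez : ~ E z by move=> /rEP; rewrite leNgt zE.
    have z0 : 0 < normc z by exact: lt_trans z1.
    have fz1 : normc z * normc (f z - z) <= M1 by rewrite -normcMM; exact: H1.
    have fz : normc (f z - z) <= 1.
      rewrite -(ler_pM2l z0) mulr1; apply: le_trans fz1 _; exact: ltW.
    have [_ lip] := H3 z (f z) (ltW z1) fz.
    have gz := H2 _ (sP' z zs).
    have -> : D.[z] = d1^-1 * (g P.[z] - d1 * P.[z]) + P`_N * (Qp.[z] - Qp.[f z]).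
      by rewrite Qp_conj // /D hornerD hornerN hornerZ; field.
    apply: le_trans (normcD _ _) _; rewrite !normcMM lerD //.
      by rewrite normcVV /M4 mulrC ler_pM2r ?invr_gt0.
    rewrite -mulrA ler_wpM2l ?normc_ge0 //.
    rewrite -(ler_pM2r z0); apply: le_trans lip _.
    have -> : normc z ^+ N = normc z * normc z ^+ n by rewrite exprS.
    have -> : M3 * M1 * normc z ^+ n.-1 * normc z = M3 * M1 * normc z ^+ n.
      by rewrite -mulrA -exprSr prednK.
    rewrite -mulrA (_ : normc (f z - z) * _ = normc z * normc (f z - z) * normc z ^+ n); last by ring.
    rewrite -[leRHS]mulrA; apply: ler_wpM2l => //.
    by apply: ler_wpM2r => //; rewrite exprn_ge0 // ltW.
  move=> e e0; have e2 : 0 < e / 2 by rewrite divr_gt0.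
  have [q1 q1P] := @large_pow R M4 (e / 2) n e2 n0.
  have [q2 q2P] := @large_pow R (normc P`_N * (M3 * M1)) (e / 2) 1 e2 isT.
  exists (Num.max (Num.max (Num.max r1 s) (Num.max rE (Num.max 1 M1))) (Num.max q1 q2)) => z.
  rewrite gt_max => /andP[/bnd zb]; rewrite gt_max => /andP[/q1P k1 /q2P k2].
  rewrite mul0r subr0; apply: le_trans zb _.
  have : normc P`_N * (M3 * M1) * normc z ^+ n.-1 <= e / 2 * normc z ^+ n.
    have -> : normc z ^+ n = normc z * normc z ^+ n.-1 by rewrite -exprS prednK.
    by rewrite [leRHS]mulrA ler_wpM2r ?exprn_ge0 ?normc_ge0 // -{1}[normc z]expr1.
  by move: k1; lra.
have : P`_n = P`_N * Qp`_n.
  by apply/eqP; rewrite -subr_eq0 -oppr_eq0 opprB -coefZ -coefB D0.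
by rewrite cN => ->; field.
Qed.

Lemma centers_formula zs : (0 < al1)%N -> (0 < al2)%N -> P^`().[zs] = 0 -> ~ E zs ->
  (a2 + P`_n / (N%:R * P`_N)) ^+ N =
    (-1) ^+ al2 * al1%:R ^+ al2 / (d1 * P`_N * al2%:R ^+ al2) * g P.[zs] /\
  a1 = - (1 / al1%:R) * (P`_n / P`_N + al2%:R * a2).
Proof.
move=> al10 al20 dP Ez; have n0 : (0 < n)%N by move: al12 al10 al20; rewrite /N; clear; lia.
have S := centers_sum n0.
have nR k : (0 < k)%N -> k%:R != 0 :> K by rewrite pnatr_eq0 -lt0n.
have [A1 A2 AN] : [/\ al1%:R != 0 :> K, al2%:R != 0 :> K & N%:R != 0 :> K] by split; apply: nR.
have pE : P`_n = - (al1%:R * a1 + al2%:R * a2) * P`_N by rewrite S opprK divfK.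
have NE : N%:R = al1%:R + al2%:R :> K by rewrite -natrD al12.
split; last by rewrite pE; field; rewrite A1 pN.
have wE : f zs = (al1%:R * a2 + al2%:R * a1) / N%:R.
  by rewrite -(critical_center dP Ez) mulrC mulKf.
have A12 : al1%:R + al2%:R != 0 :> K by rewrite -NE.
(* The base on the left and f zs - a1 both equal al1 v for v = (a2 - a1) / N, while f zs - a2 = -
   al2 v, whose power produces the sign. *)
have -> : a2 + P`_n / (N%:R * P`_N) = al1%:R * ((a2 - a1) / N%:R).
  by rewrite pE NE; field; rewrite A12.
rewrite Qp_conj // QpE.
have -> : f zs - a1 = al1%:R * ((a2 - a1) / N%:R) by rewrite wE NE; field.
have -> : f zs - a2 = -1 * (al2%:R * ((a2 - a1) / N%:R)) by rewrite wE NE; field.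
set v := (a2 - a1) / _; rewrite -[X in _ ^+ X = _]al12 exprD [(-1 * _) ^+ _]exprMn.
rewrite [(al2%:R * v) ^+ _]exprMn [(al1%:R * v) ^+ al2]exprMn.
have B2 : al2%:R ^+ al2 != 0 :> K by rewrite expf_neq0.
have s2 : (-1) ^+ al2 * (-1) ^+ al2 = 1 :> K by rewrite -exprMn mulrNN mulr1 expr1n.
move: s2; set q := (-1) ^+ al2; set x := al2%:R ^+ al2 in B2 *.
set y := _ ^+ al1; set t := al1%:R ^+ al2; set u := v ^+ al2 => s2.
transitivity (q * q * (y * (t * u))); first by rewrite s2 mul1r.
by field; rewrite B2 d10 pN.
Qed.

(** * Halos around the components *)

Lemma Ul_near_E b : c < b -> exists V : set C,
  [/\ open V, E `<=` V & forall z, V z -> ~ E z -> Ul a1 a2 m1 m2 (f z) < b].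
Proof.
move=> cb; apply: (fin_proper cPhi Phi_inf compact_preimage (W := [set w : K | Ul a1 a2 m1 m2 w < b])).
  exact: open_Ul_lt.
by move=> w /= h; exact: le_lt_trans cb.
Qed.

Definition halo1 b : set C := [set z : K | [/\ ~ E z, normc (f z - a1) < m1 * d & Ul a1 a2 m1 m2 (f z) < b]].
Definition halo2 b : set C := [set z : K | [/\ ~ E z, normc (f z - a2) < m2 * d & Ul a1 a2 m1 m2 (f z) < b]].

Lemma halo_cover b z : b <= ustar a1 a2 m1 m2 -> ~ E z ->
  Ul a1 a2 m1 m2 (f z) < b -> halo1 b z \/ halo2 b z.
Proof.
move=> bu Ez fb; have [h|h] := Ul_lt_ustar a12 m10 m20 (lt_le_trans fb bu); [left|right]; split => //.
Qed.

Lemma m21 : m2 + m1 = 1. Proof. by rewrite addrC. Qed.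
Lemma a21 : a2 != a1. Proof. by rewrite eq_sym. Qed.

Lemma connected_psi (A : set C) : connected A -> (forall w, A w -> c < Ul a1 a2 m1 m2 w) ->
  connected ((fun w : C => psi w : C) @` A).
Proof.
move=> cA Ac; apply: connected_continuous_connected => //.
apply: continuous_in_subspaceT => w /set_mem/Ac; exact: cont_psi.
Qed.

Lemma connected_halo1 b : c < b -> b <= ustar a1 a2 m1 m2 -> connected (halo1 b).
Proof.
move=> cb bu; rewrite (_ : halo1 b = (fun w : C => psi w : C) @` halo a1 a2 m1 m2 c b).
  apply: connected_psi; first exact: halo_connected.
  by move=> w [_ /andP[]].
apply/seteqP; split => [z [Ez z1 z2]|_ [w [w1 /andP[w2 w3]] <-]].
  by exists (f z); [split => //; rewrite f_out|rewrite psi_f].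
by have [h1 h2] := psiP w2; split => //; rewrite h2.
Qed.

Lemma connected_halo2 b : c < b -> b <= ustar a1 a2 m1 m2 -> connected (halo2 b).
Proof.
move=> cb bu; rewrite (_ : halo2 b = (fun w : C => psi w : C) @` halo a2 a1 m2 m1 c b).
  apply: connected_psi.
    by apply: halo_connected => //; [exact: a21|exact: m21|rewrite ustar_swap].
  by move=> w [_]; rewrite Ul_swap => /andP[].
apply/seteqP; split => [z [Ez z1 z2]|z [w [w1]]].
  by exists (f z); [split; [rewrite (normcB a2 a1)|rewrite Ul_swap f_out]|rewrite psi_f].
rewrite Ul_swap => /andP[w2 w3] <-.
have [h1 h2] := psiP w2; split => //; rewrite h2 //.
by move: w1; rewrite (normcB a2 a1).
Qed.

Lemma disc_disjoint w : normc (w - a1) < m1 * d -> normc (w - a2) < m2 * d -> False.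
Proof. by move=> h1 h2; have := circle_far m12 (ltW h1); rewrite leNgt h2. Qed.

Section Components.
Variables Ea Eb : set C.
Hypotheses (EU : E = Ea `|` Eb) (EI : Ea `&` Eb = set0).
Hypotheses (cEa : compact Ea) (cEb : compact Eb) (Ea0 : Ea !=set0) (Eb0 : Eb !=set0).

(* The halos are connected and fill a neighbourhood of E outside E, and neither
   Ea nor Eb is open. *)
Lemma halo_separation : exists b (Ga Gb : set C), [/\ c < b, b <= ustar a1 a2 m1 m2,
  [/\ open Ga, open Gb, Ea `<=` Ga, Eb `<=` Gb & Ga `&` Gb = set0] &
  (halo1 b `<=` Ga /\ halo2 b `<=` Gb) \/ (halo1 b `<=` Gb /\ halo2 b `<=` Ga)].
Proof.
have [Ga [Gb [oa ob Ea' Eb' GI]]] := separate_closed (closed_of_compact cEa) (closed_of_compact cEb) EI.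
(* Beyond radius r, f lies outside both discs, where Ul >= [ustar]. On the compact set A of
   remaining points off Ga and Gb, Ul o f has a minimum above c. The smaller of the two values is
   b. *)
have [b [cb bu Hb]] : exists b, [/\ c < b, b <= ustar a1 a2 m1 m2 &
    forall z, ~ E z -> Ul a1 a2 m1 m2 (f z) < b -> (Ga `|` Gb) z].
  have [r rP] := fin_growth cPhi Phi_inf (normc a1 + normc a2 + d).
  have far z : ~ E z -> r < normc z -> ustar a1 a2 m1 m2 <= Ul a1 a2 m1 m2 (f z).
    move=> Ez /(rP z Ez) h; have dp : 0 < d by exact: d_gt0.
    have [g1 g2] := (normc_ge0 a1, normc_ge0 a2).
    have k1 : m1 * d <= d by rewrite -[leRHS]mul1r ler_wpM2r ?(ltW dp) //; move: m12 m20; lra.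
    have k2 : m2 * d <= d by rewrite -[leRHS]mul1r ler_wpM2r ?(ltW dp) //; move: m12 m10; lra.
    have := normcD (f z - a1) a1; have := normcD (f z - a2) a2; rewrite !subrK => h1 h2.
    by apply: ustar_le => //; rewrite -/d; lra.
  pose A : set C := ~` (Ga `|` Gb) `&` [set z : K | normc z <= r].
  have EA z : A z -> ~ E z by move=> [h _]; rewrite EU => -[/Ea'|/Eb'] h1; apply: h; [left|right].
  have [A0|A0] := pselect (A !=set0); last first.
    exists (ustar a1 a2 m1 m2); split => // z Ez; rewrite ltNge => h; apply: contrapT => hG.
    have [zr|zr] := leP (normc z) r; first by apply: A0; exists z.
    by move/negP : h; apply; exact: far.
  have cA : compact A.
    apply: (@closed_bounded_compact R A r); last by move=> z [].
    by apply: closedI; [apply: open_closedC; exact: openU|exact: closed_ball_normc].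
  have [|z0 Az0 z0P] := @EVTc_min R A (fun z => Ul a1 a2 m1 m2 (f z)) cA A0.
    move=> z Az; apply: (@continuous_comp C C R (fun z => f z : C) (Ul a1 a2 m1 m2)).
      by apply: (@cdiff_cont R f); apply: cdiff_f; exact: EA.
    exact: cont_Ul.
  exists (Num.min (ustar a1 a2 m1 m2) (Ul a1 a2 m1 m2 (f z0))); split.
  - by rewrite lt_min cu f_out //; exact: EA.
  - by rewrite ge_min lexx.
  move=> z Ez; rewrite lt_min => /andP[h1 h2]; apply: contrapT => hG.
  have [zr|zr] := leP (normc z) r.
    by have := z0P z (conj hG zr); rewrite leNgt h2.
  by have := far z Ez zr; rewrite leNgt h1.
exists b, Ga, Gb; split => //.
have [V [oV EV VP]] := Ul_near_E cb.
have [ea Eea eaP] := boundary_point cEa Ea0 oa Ea'.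
have [eb Eeb ebP] := boundary_point cEb Eb0 ob Eb'.
have nV e : E e -> nbhs (e : C) V by move=> /EV Ve; apply: open_nbhs_nbhs.
have [|za [Vza Gza nza]] := eaP V; first by apply: nV; rewrite EU; left.
have [|zb [Vzb Gzb nzb]] := ebP V; first by apply: nV; rewrite EU; right.
have nGG z : Ga z -> Gb z -> False by move=> h1 h2; have : (Ga `&` Gb) z by []; rewrite GI.
have Eza : ~ E za by rewrite EU => -[//|/Eb' h]; exact: nGG h.
have Ezb : ~ E zb by rewrite EU => -[/Ea' h|//]; exact: nGG Gzb.
have cov1 : halo1 b `<=` Ga `|` Gb by move=> z [Ez _ /(Hb z Ez)].
have cov2 : halo2 b `<=` Ga `|` Gb by move=> z [Ez _ /(Hb z Ez)].
have GI' : Gb `&` Ga = set0 by rewrite setIC.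
have [c1 c2] := (connected_halo1 cb bu, connected_halo2 cb bu).
have s1a z : halo1 b z -> Ga z -> halo1 b `<=` Ga.
  by move=> h1 h2; apply: connected_split c1 oa ob GI cov1 _; exists z.
have s2a z : halo2 b z -> Ga z -> halo2 b `<=` Ga.
  by move=> h1 h2; apply: connected_split c2 oa ob GI cov2 _; exists z.
have s1b z : halo1 b z -> Gb z -> halo1 b `<=` Gb.
  by move=> h1 h2; apply: connected_split c1 ob oa GI' _ _; [rewrite setUC|exists z].
have s2b z : halo2 b z -> Gb z -> halo2 b `<=` Gb.
  by move=> h1 h2; apply: connected_split c2 ob oa GI' _ _; [rewrite setUC|exists z].
(* If za and zb fell into the same halo, it would meet both Ga and Gb, although it lies in only one
   of them. *)
have [ha|ha] := halo_cover bu Eza (VP _ Vza Eza);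
  have [hb|hb] := halo_cover bu Ezb (VP _ Vzb Ezb).
- by have := nGG _ (s1a _ ha Gza _ hb) Gzb.
- by left; split; [exact: s1a Gza|exact: s2b Gzb].
- by right; split; [exact: s1b Gzb|exact: s2a Gza].
- by have := nGG _ (s2a _ ha Gza _ hb) Gzb.
Qed.

(** * Labelling of the components and root counts *)

Section Matched.
Variables (b : R) (Ga Gb : set C).
Hypotheses (cb : c < b) (bu : b <= ustar a1 a2 m1 m2).
Hypotheses (oGa : open Ga) (oGb : open Gb) (EGa : Ea `<=` Ga) (EGb : Eb `<=` Gb).
Hypotheses (GI : Ga `&` Gb = set0) (h1 : halo1 b `<=` Ga) (h2 : halo2 b `<=` Gb).

Lemma G_disjoint z : Ga z -> Gb z -> False.
Proof. by move=> ga gb; have : (Ga `&` Gb) z by []; rewrite GI. Qed.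

(** It passes through the critical point of [Ul], and Ul >= [ustar] > c on it; so it lies outside L
    and separates the two parts of L. *)
Definition circle1 : set C := [set w : K | normc (w - a1) = m1 * d].
Definition loop (t : R) : K := psi (a1 + (m1 * d)%:C * cis (2 * pi * t)).

Lemma md_gt0 : 0 < m1 * d.
Proof. by rewrite mulr_gt0 // d_gt0. Qed.

Lemma circle1_out w : circle1 w -> c < Ul a1 a2 m1 m2 w.
Proof. by move=> h; apply: lt_le_trans cu _; exact: circle_ustar. Qed.

Lemma circle1_cis t : circle1 (a1 + (m1 * d)%:C * cis t).
Proof. by rewrite /circle1 /= normc_ray // ltW // md_gt0. Qed.

Lemma cis_per (t : R) (k : int) : cis (2 * pi * (t + k%:~R)) = cis (2 * pi * t).
Proof.
suff H (s : R) (j : nat) : cis (2 * pi * (s + j%:R)) = cis (2 * pi * s).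
  case: k => k; first exact: H.
  by rewrite NegzE -[in RHS](subrK k.+1%:R t) H mulrNz.
elim: j s => [|j IH] s; first by rewrite addr0.
have -> : 2 * pi * (s + j.+1%:R) = 2 * pi * (s + j%:R) + pi *+ 2 by rewrite -[j.+1%:R]natr1; ring.
by rewrite -IH /cis cosD2pi sinD2pi.
Qed.

Lemma circle1E w : circle1 w -> exists2 t : R, t \in `[0, 1[ & w = a1 + (m1 * d)%:C * cis (2 * pi * t).
Proof.
move=> h; have [s sE] := polar (w - a1); rewrite h in sE.
have pp : 0 < 2 * pi :> R by rewrite mulr_gt0 // pi_gt0.
pose u := s / (2 * pi); pose t := u - (Num.floor u)%:~R; exists t.
  by rewrite in_itv /= subr_ge0 ge_floor /= /t ltrBlDl -intrD1 lt_succ_floor.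
have uE : 2 * pi * u = s by rewrite /u mulrC divfK // gt_eqF.
by rewrite /t -mulrNz cis_per uE -sE addrC subrK.
Qed.

Lemma cont_loop t : @contc R R loop t.
Proof.
apply: (@contc_comp R R (fun t => a1 + (m1 * d)%:C * cis (2 * pi * t)) psi).
  apply: (@contD R R); first exact: contcst.
  by apply: (@contM R R); [exact: contcst|exact: cont_cisM].
by apply: cont_psi; apply: circle1_out; exact: circle1_cis.
Qed.

Lemma loop_jordan : jordan_curve ((fun w : C => psi w : C) @` circle1).
Proof.
have loop01 : loop 0 = loop 1 by rewrite /loop -(cis_per 0 1) add0r.
exists loop; split => //.
- by apply: continuous_in_subspaceT => t _; exact: cont_loop.
- move=> s t; rewrite !in_itv /= => /andP[s0 s1] /andP[t0 t1] /(congr1 f).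
  rewrite /loop; have [_ ->] := psiP (circle1_out (circle1_cis (2 * pi * s))).
  have [_ ->] := psiP (circle1_out (circle1_cis (2 * pi * t))) => /addrI/mulfI.
  have md0 : (m1 * d)%:C != 0 :> K by rewrite -normc_gt0 normc_real normr_gt0 gt_eqF // md_gt0.
  move=> /(_ md0) st; have : cis (2 * pi * (s - t)) = 1.
    by rewrite mulrBr cisD cisN st mulfV // cis_neq0.
  move=> /(congr1 (@complex.Re R)) /= /cos_2pi_int /intrP[k kE].
  have : (-1 < k%:~R :> R) /\ (k%:~R < 1 :> R) by rewrite -kE; split; lra.
  rewrite -[1]/(1%:~R) -mulrNz !ltr_int => -[k1 k2]; have k0 : k = 0 by clear -k1 k2; lia.
  by move: kE; rewrite k0 => /eqP; rewrite subr_eq0 => /eqP.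
- apply/seteqP; split => [_ [w /circle1E[t t01 ->] <-]|_ [t _ <-]].
    by exists t => //; move: t01; rewrite /= !in_itv /= => /andP[-> /ltW].
  by exists (a1 + (m1 * d)%:C * cis (2 * pi * t)) => //; exact: circle1_cis.
Qed.

Lemma loop_out : (fun w : C => psi w : C) @` circle1 `<=` ~` E.
Proof. by move=> _ [w /circle1_out/psiP[h _] <-]. Qed.

Lemma loop_image : Phi @` (Some @` ((fun w : C => psi w : C) @` circle1)) = Some @` circle1.
Proof.
apply/seteqP; split => [_ [_ [_ [w w1 <-] <-] <-]|_ [w w1 <-]].
  have [Ew fw] := psiP (circle1_out w1).
  by exists w => //; rewrite (finE cPhi Phi_inf Ew) fw.
have [Ew fw] := psiP (circle1_out w1); exists (Some (psi w : C)).
  by exists (psi w) => //; exists w.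
by rewrite (finE cPhi Phi_inf Ew) fw.
Qed.

Lemma circle1_surrounds : surrounds circle1 (connected_component L (a1 : C)).
Proof.
pose D : set C := [set w : K | normc (w - a1) < m1 * d].
have oD : open D by exact: open_disc.
have DB : forall w : K, D w -> normc w <= normc a1 + m1 * d.
  by move=> w; rewrite /D /= => h; have := normcD (w - a1) a1; rewrite subrK; lra.
have LD : connected_component L (a1 : C) `<=` D.
  refine (@connected_split _ _ D [set w : K | normc (w - a2) < m2 * d] (@component_connected _ _ _) oD (@open_disc _ _) _ _ _).
  - by apply/seteqP; split => // w [] /= k1 k2; case: (disc_disjoint k1 k2).
  - move=> w /connected_component_sub h.
    exact: (Ul_lt_ustar a12 m10 m20 (le_lt_trans h cu)).
  exists a1; split; first by apply: connected_component_refl; rewrite /L /= Ul1.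
  by rewrite /D /= subrr ComplexField.Normc.normc0 md_gt0.
move=> z Lz; have Dz := LD z Lz.
have zC : ~ circle1 z by rewrite /circle1 /= => h; move: Dz; rewrite /D /= h ltxx.
split => //; apply: (@bounded_normc _ (normc a1 + m1 * d)) => w wz; apply: DB; move: w wz.
refine (@connected_split _ _ D [set w : K | m1 * d < normc (w - a1)] (@component_connected _ _ _) oD (@open_codisc _ _) _ _ _).
- by apply/seteqP; split => // w; rewrite /D /= => -[k1 k2]; lra.
- move=> w /connected_component_sub /= /eqP; rewrite neq_lt => /orP[]; [by left|by right].
- by exists z; split => //; exact: connected_component_refl.
Qed.

(** Off J the plane splits into U and U' according to the side of the circle on which f lies. Ea and
    Eb are added to the side of their halos, which keeps both sets open, and U is bounded because f
    tends to infinity. *)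
Lemma loop_surrounds : surrounds ((fun w : C => psi w : C) @` circle1) Ea.
Proof.
set J := _ @` _; have [V [oV EV VP]] := Ul_near_E cb.
pose U : set C := [set z : K | Ea z \/ ~ E z /\ normc (f z - a1) < m1 * d].
pose U' : set C := [set z : K | Eb z \/ ~ E z /\ m1 * d < normc (f z - a1)].
have contf z : ~ E z -> @contc R C f z by move=> Ez; apply: (@cdiff_cont R f); exact: cdiff_f.
have farb z : halo2 b z -> m1 * d < normc (f z - a1).
  move=> [_ k _]; rewrite ltNge; apply/negP => k'; have := circle_far m12 k'.
  by rewrite leNgt k.
have oU : open U.
  rewrite openE => z [Eaz|[Ez fz]].
    have nG : nbhs (z : C) Ga by apply: open_nbhs_nbhs; split => //; exact: EGa.
    have nV : nbhs (z : C) V by apply: open_nbhs_nbhs; split => //; apply: EV; rewrite EU; left.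
    move: nV nG; apply: filterS2 => y Vy Gy; have [Ey|Ey] := pselect (E y).
      by left; move: Ey; rewrite EU => -[//|/EGb k]; case: (G_disjoint Gy k).
    right; split => //; have [[]//|/h2 k] := halo_cover bu Ey (VP y Vy Ey).
    by case: (G_disjoint Gy k).
  have := contf z Ez _ (open_nbhs_nbhs (conj (@open_disc a1 (m1 * d)) fz)).
  by have := near_out compact_preimage Ez; apply: filterS2 => y Ey fy; right.
have oU' : open U'.
  rewrite openE => z [Ebz|[Ez fz]].
    have nG : nbhs (z : C) Gb by apply: open_nbhs_nbhs; split => //; exact: EGb.
    have nV : nbhs (z : C) V by apply: open_nbhs_nbhs; split => //; apply: EV; rewrite EU; right.
    move: nV nG; apply: filterS2 => y Vy Gy; have [Ey|Ey] := pselect (E y).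
      by left; move: Ey; rewrite EU => -[/EGa k|//]; case: (G_disjoint k Gy).
    right; split => //; have [/h1 k|k] := halo_cover bu Ey (VP y Vy Ey); last exact: farb.
    by case: (G_disjoint k Gy).
  have := contf z Ez _ (open_nbhs_nbhs (conj (@open_codisc a1 (m1 * d)) fz)).
  by have := near_out compact_preimage Ez; apply: filterS2 => y Ey fy; right.
have [r rP] := compact_bounded_normc cEa.
have [s sP'] := fin_growth cPhi Phi_inf (normc a1 + m1 * d).
move=> z Eaz; have Jz : ~ J z by move=> /loop_out; apply; rewrite EU; left.
split => //; apply: (@bounded_normc _ (Num.max r s)) => w wz.
have : U w.
  move: (w : C) wz; refine (@connected_split C _ U U' (@component_connected _ _ _) oU oU' _ _ _).
  - apply/seteqP; split => // v [[k|[k k']] [l|[l l']]].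
    + by have : (Ea `&` Eb) v by []; rewrite EI.
    + by apply: l; rewrite EU; left.
    + by apply: k; rewrite EU; right.
    + by have := lt_trans k' l'; rewrite ltxx.
  - move=> v /connected_component_sub Jv; have [|Ev] := pselect (E v).
      by rewrite {1}EU => -[k|k]; [left; left|right; left].
    have : normc (f v - a1) != m1 * d.
      by apply/eqP => k; apply: Jv; exists (f v) => //; exact: psi_f.
    by rewrite neq_lt => /orP[k|k]; [left|right]; right.
  - by exists z; split; [exact: connected_component_refl|left].
move=> [/rP k|[Ew fw]]; first by rewrite le_max k.
rewrite le_max; apply/orP; right; rewrite leNgt; apply/negP => /(sP' w Ew).
have := normcD (f w - a1) a1; rewrite subrK; lra.
Qed.

(** A connected set off J joins a boundary point e of Eb to infinity: the halo at Eb together with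
    the preimage of the ray from [out_ray]. *)
Lemma loop_not_surrounds : ~ surrounds ((fun w : C => psi w : C) @` circle1) Eb.
Proof.
set J := _ @` _ => HJ; have [V [oV EV VP]] := Ul_near_E cb.
have [e Ebe eP] := boundary_point cEb Eb0 oGb EGb.
have [Je /normc_bounded[M MP]] := HJ e Ebe.
have [S [cS SP Sbig [w0 [Sw0 w01 w02]]]] := out_ray a12 m10 m20 m12 c0 cb bu.
have n2 z : halo2 b z -> ~ J z.
  move=> [Ez k _] [w wC wz]; have [_ fw] := psiP (circle1_out wC).
  have := @circle_far R a1 a2 m1 m2 m12 w; rewrite wC lexx => /(_ isT).
  by move: k; rewrite -wz fw ltNge => /negP k /k.
pose T := halo2 b `|` [set e].
have cT : connected T.
  apply: connected_setU1; first exact: connected_halo2.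
  move=> W We; have [|z [[Wz Vz] Gz Ez]] := eP (W `&` V).
    by apply: filterI => //; apply: open_nbhs_nbhs; split => //; apply: EV; rewrite EU; right.
  exists z; split => //; have nE : ~ E z by rewrite EU => -[/EGa k|//]; case: (G_disjoint k Gz).
  have [/h1 k|//] := halo_cover bu nE (VP z Vz nE).
  by case: (G_disjoint k Gz).
have TJ : T `<=` ~` J by move=> z [/n2//|->].
pose S' := (fun w : C => psi w : C) @` S.
have cS' : connected S' by apply: connected_psi => // w /SP[].
have SJ : S' `<=` ~` J.
  move=> _ [w Sw <-] [v vC vw]; have [k1 k2] := SP w Sw.
  have [_ fv] := psiP (circle1_out vC); have [_ fw] := psiP k1.
  by move: k2; rewrite -fw -vw fv (_ : normc (v - a1) = m1 * d) // ltxx.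
have cTS : connected (T `|` S').
  apply: connectedU => //; exists (psi w0); split; last by exists w0.
  have [k1 k2] := SP _ Sw0; have [k3 k4] := psiP k1.
  by left; split => //; rewrite k4.
have sub : T `|` S' `<=` connected_component (~` J) e.
  apply: connected_component_max => //; first by left; right.
  by move=> z [/TJ|/SJ].
have [M' M'P] := fin_escape cPhi Phi_inf compact_preimage M.
have [w Sw wM] := Sbig M'; have [k1 _] := SP w Sw; have [k3 k4] := psiP k1.
have := M'P _ k3; rewrite k4 => /(_ wM); rewrite ltNge => /negP; apply.
by apply: MP; apply: sub; right; exists w.
Qed.

Lemma small_root v w : normc v < ustar a1 a2 m1 m2 ^+ N -> Qp.[w] = v ->
  normc (w - a1) < m1 * d \/ normc (w - a2) < m2 * d.
Proof.
move=> vu wv; apply: (Ul_lt_ustar a12 m10 m20); move: vu; rewrite -wv normc_Qp.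
by rewrite ltr_pXn2r // nnegrE ?Ul_ge0 // ltW // ustar_gt0.
Qed.

Lemma count_root0 : count (inset [set w : K | normc (w - a1) < m1 * d]) (fib Qp 0) = al1 /\
  count (inset [set w : K | normc (w - a2) < m2 * d]) (fib Qp 0) = al2.
Proof.
have md2 : 0 < m2 * d by rewrite mulr_gt0 // d_gt0.
have self (a : K) r : 0 < r -> normc (a - a) < r by rewrite subrr ComplexField.Normc.normc0.
have mem z : z \in fib Qp 0 -> z = a1 \/ z = a2.
  rewrite (mem_fib size_Qp) QpE mulf_eq0 !expf_eq0 !subr_eq0.
  by move=> /orP[/andP[_ /eqP]|/andP[_ /eqP]]; [left|right].
have muE z : mup z Qp = count_mem z (fib Qp 0) by rewrite -(mup_fib size_Qp) subr0.
have e1 : mup a1 Qp = al1.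
  by rewrite /Qp mupMl ?mup_XsubCX ?eqxx // rootE horner_exp hornerXsubC expf_neq0 // subr_eq0.
have e2 : mup a2 Qp = al2.
  by rewrite /Qp mupMr ?mup_XsubCX ?eqxx // rootE horner_exp hornerXsubC expf_neq0 // subr_eq0 a21.
split; [rewrite -[RHS]e1|rewrite -[RHS]e2]; rewrite muE; apply: eq_in_count => z /mem[] ->;
  rewrite /inset /= ?eqxx ?(negbTE a12) ?(negbTE a21).
- by apply/asboolP; apply: self; exact: md_gt0.
- by apply/asboolP => k; apply: (@disc_disjoint a2) => //; exact: self.
- by apply/asboolP => k; apply: (@disc_disjoint a1) => //; apply: self; exact: md_gt0.
- by apply/asboolP; exact: self.
Qed.

(** Deforming y to 0 through values of modulus below ustar^N keeps all roots of Q - y in the two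
    open discs, so the counts are those of Q itself. *)
Lemma count_root y : normc y < ustar a1 a2 m1 m2 ^+ N ->
  count (inset [set w : K | normc (w - a1) < m1 * d]) (fib Qp y) = al1 /\
  count (inset [set w : K | normc (w - a2) < m2 * d]) (fib Qp y) = al2.
Proof.
move=> yu; have [c1 c2] := count_root0.
set D1 : set C := [set w | _] in c1 *; set D2 : set C := [set w | _] in c2 *.
have D12 : D1 `&` D2 = set0 by apply/seteqP; split => // w [k1 k2]; case: (disc_disjoint k1 k2).
(* A clamped parameter: the path q(s) y is defined on the whole line, as [locally_cst_R] requires,
   and takes the values 0 and y at s = 0 and s = 1. *)
pose q (s : R) : R := Num.min `|s| 1.
have q01 s : 0 <= q s <= 1 by rewrite le_min ge_min normr_ge0 ler01 lexx orbT.
have cq (s : R) : @contc R R (fun s => (q s)%:C * y) s.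
  apply: (@contM R R); last exact: contcst.
  apply: (@cont_complex R R q (fun=> 0)); last exact: cst_continuous.
  apply: (@continuous_min R R (fun s => `|s|) (fun=> 1)); last exact: cst_continuous.
  exact: norm_continuous.
have H (V1 V2 : set C) : open V1 -> open V2 -> V1 `&` V2 = set0 ->
    (forall v w, normc v < ustar a1 a2 m1 m2 ^+ N -> Qp.[w] = v -> V1 w \/ V2 w) ->
    count (inset V1) (fib Qp y) = count (inset V1) (fib Qp 0).
  move=> o1 o2 V12 cov; pose G s := count (inset V1) (fib Qp ((q s)%:C * y)).
  have -> : y = (q 1)%:C * y by rewrite /q normr1 minxx mul1r.
  have -> : 0 = (q 0)%:C * y by rewrite /q normr0 (min_idPl ler01) mul0r.
  rewrite -/(G 1) -/(G 0); apply: locally_cst_R => t.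
  have := @fib_locally_cst R Qp n size_Qp V1 V2 ((q t)%:C * y) o1 o2 V12.
  have qy : normc ((q t)%:C * y) < ustar a1 a2 m1 m2 ^+ N.
    apply: le_lt_trans yu; have /andP[k0 k1] := q01 t.
    by rewrite normcMM normc_real ger0_norm // ler_piMl // normc_ge0.
  move=> /(_ (fun z => cov _ z qy)) k; exact: (cq t _ k).
split; [rewrite -[RHS]c1; apply: (H D1 D2)|rewrite -[RHS]c2; apply: (H D2 D1)] => //; try exact: open_disc.
- exact: small_root.
- by rewrite setIC.
- by move=> v w k1 k2; have [] := small_root k1 k2; [right|left].
Qed.

(* Move om off Om to a noncritical value v: f maps the roots of P - v near Ex
   injectively to roots of Qp - y near a. *)
Lemma count_component (Ex Gx : set C) (a : K) (r : R) (al : nat) (om : K) :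
  open Gx -> Ex `<=` Gx -> Ex `<=` E ->
  (forall z, ~ E z -> Ul a1 a2 m1 m2 (f z) < b -> Gx z -> normc (f z - a) < r) ->
  (forall y, normc y < ustar a1 a2 m1 m2 ^+ N ->
    count (inset [set w : K | normc (w - a) < r]) (fib Qp y) = al) ->
  (forall V, nbhs (om : C) V -> exists v : C, V v /\ ~ Om v) ->
  (count (inset Ex) (fib P om) <= al)%N.
Proof.
move=> oG EG ExE GD cD bd; have [V [oV EV VP]] := Ul_near_E cb.
have oW : open (Gx `&` V) by exact: openI.
have /nbhs_cplx[e e0 eP] := fib_lsc sP om oW.
have nb : nbhs (om : C) [set w : K | normc (w - om) < e] by apply/nbhs_cplx; exists e.
have [v0 [v0e Ov0]] := bd _ nb.
have nv0 : nbhs (v0 : C) ([set w : K | normc (w - om) < e] `&` ~` Om).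
  apply: filterI; last exact: (near_out cOm).
  by apply: open_nbhs_nbhs; split; [exact: open_disc|exact: v0e].
move/nbhs_cplx : nv0 => [e' e'0 e'P].
have [rs rsE] := closed_field_poly_normal P^`().
have [v ve' vs] := avoid_seq [seq P.[z] | z <- rs] v0 e'0.
have [ve Ov] := e'P v ve'.
have uP : uniq (fib P v).
  apply: (uniq_fib sP) => z zv; apply/negP => /eqP dz; case/negP: vs; rewrite -zv.
  apply: map_f; rewrite -root_prod_XsubC; move: dz; rewrite rsE hornerZ => /eqP.
  rewrite mulf_eq0 lead_coef_eq0 => /orP[/eqP P'0|//].
  have := lead_neq0 sP; have := congr1 (fun p : {poly K} => p`_n) P'0.
  rewrite coef_deriv coef0 => /eqP; rewrite mulrn_eq0 /= => /eqP ->.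
  by rewrite eqxx.
have subV : (count (inset Ex) (fib P om) <= count (inset (Gx `&` V)) (fib P v))%N.
  apply: leq_trans (eP v ve); apply: sub_count => z /asboolP Exz; apply/asboolP.
  by split; [exact: EG|apply: EV; exact: ExE].
apply: leq_trans subV _; rewrite -size_filter; set s := [seq z <- _ | _].
have sE z : z \in s -> [/\ ~ E z, P.[z] = v, Gx z & Ul a1 a2 m1 m2 (f z) < b].
  rewrite mem_filter (mem_fib sP) => /andP[/asboolP[Gz Vz] /eqP zv].
  have Ez : ~ E z by rewrite /E /= zv.
  by split => //; exact: VP.
pose y := g v / (d1 * P`_N).
have dp0 : d1 * P`_N != 0 by rewrite mulf_neq0.
have Qy z : z \in s -> Qp.[f z] = y.
  by move=> /sE[Ez zv _ _]; rewrite /y -zv Qp_conj // mulrC mulKf.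
(* A root in s certifies |y| < ustar^N, because f maps it below level b. *)
case: (posnP (size s)) => [-> //|s0].
have yu : normc y < ustar a1 a2 m1 m2 ^+ N.
  have zs : s`_0 \in s by apply: mem_nth.
  have [_ _ _ k] := sE _ zs; rewrite -(Qy _ zs) normc_Qp ltr_pXn2r ?nnegrE ?Ul_ge0 //.
    exact: lt_le_trans bu.
  by rewrite ltW // ustar_gt0.
rewrite -(cD y yu) -size_filter -(size_map f s); apply: uniq_leq_size.
  rewrite map_inj_in_uniq ?filter_uniq // => x z /sE[Ex' _ _ _] /sE[Ez _ _ _].
  exact: f_inj.
move=> _ /mapP[z zs ->]; have [Ez _ Gz k] := sE z zs.
rewrite mem_filter (mem_fib size_Qp) Qy // eqxx andbT.
by apply/asboolP; exact: GD.
Qed.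

Lemma count_fiber (om : K) : Om om ->
  (count (inset Ea) (fib P om) + count (inset Eb) (fib P om) = N)%N.
Proof.
move=> Oom; rewrite -[RHS](size_fib sP om) -(count_predC (inset Ea) (fib P om)).
congr addn; apply: eq_in_count => z; rewrite (mem_fib sP) => /eqP zv.
have : E z by rewrite /E /= zv.
rewrite EU /inset /= => -[k|k].
  rewrite (asboolT k) /=; apply/asboolP => k'.
  by have : (Ea `&` Eb) z by []; rewrite EI.
rewrite (asboolT k); apply/esym/negP => /asboolP k'.
by have : (Ea `&` Eb) z by []; rewrite EI.
Qed.

Lemma count_exponents : exists2 om : K, Om om &
  count (inset Ea) (fib P om) = al1 /\ count (inset Eb) (fib P om) = al2.
Proof.
(* The count is made at a boundary point of Om, because f relates P to Q only over values outside
   Om. *)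
have [om Oom omP] := boundary_point cOm Om0 openT (@subsetT _ Om).
have bd V : nbhs (om : C) V -> exists v : C, V v /\ ~ Om v.
  by move=> /omP[v [Vv _ Ov]]; exists v.
have Eas : Ea `<=` E by rewrite EU => z; left.
have Ebs : Eb `<=` E by rewrite EU => z; right.
exists om => //.
have ka : (count (inset Ea) (fib P om) <= al1)%N.
  apply: (@count_component Ea Ga a1 (m1 * d)) => //; last by move=> y /count_root[].
  move=> z Ez k Gz; have [[]//|/h2 k'] := halo_cover bu Ez k.
  by case: (G_disjoint Gz k').
have kb : (count (inset Eb) (fib P om) <= al2)%N.
  apply: (@count_component Eb Gb a2 (m2 * d)) => //; last by move=> y /count_root[].
  move=> z Ez k Gz; have [/h1 k'|[]//] := halo_cover bu Ez k.
  by case: (G_disjoint k' Gz).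
by have := count_fiber Oom; move: al12 ka kb; clear; lia.
Qed.

End Matched.
End Components.

End Exponents.

End Walsh.
End Core.

(** * Consequences of the definitions *)

Section Data.
Variable R : realType.
Local Notation C := (cplx R).
Local Notation K := R[i].
Local Notation Chat := (sphere R).
Local Notation normc := ComplexField.Normc.normc.

Lemma capacity_ge0 (A : set C) : 0 <= capacity A.
Proof.
rewrite /capacity; set S := [set _ | _ in _].
have [[y Sy]|S0] := pselect (S !=set0).
  apply: fine_ge0; apply: le_trans (ereal_sup_ubound Sy).
  by move: Sy => [mu _ <-]; exact: expeR_ge0.
suff -> : S = set0 by rewrite ereal_sup0.
by apply/seteqP; split => // x Sx; case: S0; exists x.
Qed.

Lemma limit_normc_le (u : nat -> C) (l : C) (B : R) :
  (forall k, normc (u k : K) <= B) -> u @ \oo --> l -> normc (l : K) <= B.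
Proof.
move=> uB ul; rewrite leNgt; apply/negP => lB.
have nl : nbhs l [set y : K | normc (y - l) < normc (l : K) - B].
  by apply/nbhs_cplx; exists (normc (l : K) - B); rewrite // subr_gt0.
have [k _ /(_ k (leqnn k)) /= h] := ul _ nl.
have := normcD (l - u k) (u k : K); rewrite subrK normcB; have := uB k; lra.
Qed.

(** Convergence at one radius s bounds the coefficients by T s^k; for |z| > 2 s the series is
    dominated by a geometric one of ratio 1/2. *)
Lemma laurent_bounded (d : nat -> C) (h : K -> K) (rho : R) :
  (forall z : K, rho < normc z -> series (fun k => d k * (z : C) ^- k : C) @ \oo --> (h z : C)) ->
  exists r M, forall z, r < normc z -> normc (h z) <= M.
Proof.
move=> H; pose s := `|rho| + 1; have s0 : 0 < s by rewrite ltr_wpDl.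
have ns : normc s%:C = s by rewrite normc_real gtr0_norm.
have rs : rho < normc s%:C by rewrite ns /s; have := ler_norm rho; lra.
have [T T0 TP] : exists2 T : R, 0 <= T & forall k, normc (d k : K) <= T * s ^+ k.
  have c0 : (fun k => d k * (s%:C : C) ^- k : C) @ \oo --> (0 : C).
    by apply: cvg_series_cvg_0; apply/cvg_ex; exists (h s%:C); exact: H.
  have n0 : nbhs (0 : C) [set y : K | normc (y - 0) < 1] by apply/nbhs_cplx; exists 1.
  have [m _ mP] := c0 _ n0.
  have nk k : normc (d k : K) = normc (d k * (s%:C : K) ^- k) * s ^+ k.
    by rewrite normcMM normcVV normcX ns divfK // gt_eqF // exprn_gt0.
  exists (1 + \sum_(k < m) normc (d k * (s%:C : K) ^- k)).
    by rewrite addr_ge0 // sumr_ge0 // => i _; exact: normc_ge0.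
  move=> k; rewrite nk ler_wpM2r ?exprn_ge0 // ?(ltW s0) //.
  have [mk|km] := leqP m k.
    have := mP k mk; rewrite /= subr0 => h1; apply: le_trans (ltW h1) _.
    by rewrite lerDl sumr_ge0 // => i _; exact: normc_ge0.
  rewrite (bigD1 (Ordinal km)) //= addrCA lerDl addr_ge0 // sumr_ge0 // => i _.
  exact: normc_ge0.
exists (2 * s), (2 * T) => z zs.
have z0 : 0 < normc z by apply: lt_trans zs; rewrite mulr_gt0.
apply: (@limit_normc_le _ _ _ _ (H z _)); last first.
  by apply: le_lt_trans zs; rewrite /s; have := ler_norm rho; have := normr_ge0 rho; lra.
move=> k; rewrite /series /=.
have : normc (\sum_(0 <= i < k) d i * (z : C) ^- i : K) <= T * \sum_(0 <= i < k) (2^-1 : R) ^+ i.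
  elim: k => [|k IH]; first by rewrite !big_geq // mulr0 ComplexField.Normc.normc0.
  rewrite !big_nat_recr //= mulrDr; apply: le_trans (normcD _ _) _; apply: lerD => //.
  rewrite normcMM normcVV normcX ler_pdivrMr ?exprn_gt0 //.
  apply: le_trans (TP k) _; rewrite -mulrA ler_wpM2l // -exprMn.
  by apply: lerXn2r; rewrite ?nnegrE ?mulr_ge0 ?invr_ge0 // ?ltW //; move: zs; lra.
move=> h1; apply: le_trans h1 _; rewrite [2 * T]mulrC ler_wpM2l // big_mkord.
have : \sum_(i < k) (2^-1 : R) ^+ i = 2 - 2 * 2^-1 ^+ k.
  elim: k => [|k IH]; first by rewrite big_ord0 expr0 mulr1 subrr.
  by rewrite big_ord_recr /= IH exprS; field.
by move=> ->; rewrite gerBl mulr_ge0 // exprn_ge0.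
Qed.

Lemma zeros_in_count (p : {poly K}) n (A : set C) (v : K) : size p = n.+2 ->
  zeros_in A (p - v%:P) = count (inset A) (fib p v).
Proof.
move=> sp; rewrite /zeros_in.
rewrite (eq_fsbigr (fun z => count_mem z (fib p v))); last first.
  by move=> z _; exact: (mup_fib sp).
pose r := [seq z <- undup (fib p v) | inset A z].
have rA z : (z \in r) = (z \in fib p v) && inset A z by rewrite mem_filter mem_undup andbC.
rewrite (fsbigE r) ?filter_uniq ?undup_uniq //; last 2 first.
- by move=> z /=; rewrite rA => /andP[_ /asboolP].
- move=> z Az; rewrite rA /inset (asboolT Az) andbT => h.
  by apply/count_memPn.
rewrite big_filter_cond -[RHS]sum1_count -[RHS](@big_undup_iterop_count _ _ addn).
apply: (@eq_big nat 0%N addn) => z; first by rewrite /inset; case: asboolP => [/mem_set->|].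
by move=> _; rewrite Monoid.iteropE iter_addn_0 mul1n.
Qed.

Lemma two_components (A : set C) (E_ : 'I_2 -> set C) : compact A -> components_are A E_ ->
  [/\ A = E_ ord0 `|` E_ ord_max, E_ ord0 `&` E_ ord_max = set0,
      forall j, compact (E_ j), forall j, E_ j !=set0 & \bigcup_j E_ j = A].
Proof.
move=> cA [injE rE].
have comp j : exists2 x, A x & connected_component A x = E_ j.
  have : range E_ (E_ j) by exists j.
  by rewrite rE => -[x Ax <-]; exists x.
have sub j : E_ j `<=` A by have [x _ <-] := comp j; exact: connected_component_sub.
have cov z : A z -> exists j, E_ j z.
  move=> Az; have : [set connected_component A x | x in A] (connected_component A z) by exists z.
  by rewrite -rE => -[j _ jE]; exists j; rewrite jE; exact: connected_component_refl.
have ord2 (j : 'I_2) : j = ord0 \/ j = ord_max.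
  by case: j => -[|[|//]] h; [left|right]; apply: val_inj.
split.
- apply/seteqP; split => z; last by case; exact: sub.
  by move=> /cov[j]; case: (ord2 j) => ->; [left|right].
- apply/seteqP; split => // z [h0 h1]; have [x0 _ x0E] := comp ord0; have [x1 _ x1E] := comp ord_max.
  have zE j x : connected_component A x = E_ j -> E_ j z -> E_ j = connected_component A z.
    by move=> <- h; apply: same_connected_component.
  suff : ord0 = ord_max :> 'I_2 by [].
  by apply: injE; rewrite (zE _ _ x0E h0) (zE _ _ x1E h1).
- move=> j; apply: (subclosed_compact _ cA (sub j)); have [x _ <-] := comp j.
  by apply: component_closed; exact: closed_of_compact.
- by move=> j; have [x Ax <-] := comp j; exists x; exact: connected_component_refl.
- by apply/seteqP; split => [z [j _ /sub]//|z /cov[j jz]]; exists j.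
Qed.

End Data.

Theorem theorem3p8 (R : realType)
  (Omega : set (cplx R))
  (Omega_compact : compact Omega)
  (Omega_infinite : infinite_set Omega)
  (Omega_sc : simply_connected_domain R (sphere_compl Omega))
  (ROmega : sphere R -> sphere R) (d1 : R[i])
  (ROmegaP : exterior_riemann_map Omega ROmega d1)
  (n : nat) (P : {poly R[i]}) (degP : size P = n.+1)
  (E_ : 'I_2 -> set (cplx R))
  (E_comp : components_are [set z : cplx R | Omega P.[z]] E_)
  (zs : R[i])
  (zs_crit : root P^`() zs)
  (zs_out : ~ Omega P.[zs])
  (n_ : 'I_2 -> nat)
  (n_zeros : forall (j : 'I_2) (omega : cplx R),
     Omega omega -> zeros_in (E_ j) (P - omega%:P) = n_ j)
  (a : 'I_2 -> cplx R) (m : 'I_2 -> R) (Phi : sphere R -> sphere R)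
  (walshE : walsh_data E_ a m Phi) :
  let a1 : R[i] := a ord0 in let a2 : R[i] := a ord_max in
  let n1 := n_ ord0 in let n2 := n_ ord_max in
  exists2 w : R[i], ROmega (Some P.[zs]) = Some w &
    (a2 + P`_n.-1 / (n%:R * P`_n)) ^+ n =
      (-1) ^+ n2 * n1%:R ^+ n2 / (d1 * P`_n * n2%:R ^+ n2) * w
    /\ a1 = - (1 / n1%:R) * (P`_n.-1 / P`_n + n2%:R * a2).
Proof.
move=> a1 a2 n1 n2.
have [z0 Omz0] : [set z : cplx R | Omega P.[z]] !=set0.
  have [_ rE] := E_comp; have : range E_ (E_ ord0) by exists ord0.
  by rewrite rE => -[z Ez _]; exists z.
case: n degP => [|n'] sP.
  (* If P were constant, the nonempty E would be the whole plane and contain zs. *)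
  by exfalso; apply: zs_out; move: Omz0; rewrite (size1_polyC (eq_leq sP)) /= !hornerC.
have Om0 : Omega !=set0 by exists P.[z0].
have cE := compact_preimage sP Omega_compact.
have [EU EI cEj Ej0 bigE] := two_components cE E_comp.
move: walshE; rewrite /walsh_data bigE.
set c := capacity _; set L := lemniscate _ _ _.
move=> [[injA [m0 m1]] cPhi PhiA [LU Ldisj _] label].
have c0 : 0 <= c by exact: capacity_ge0.
have m10 := m0 ord0; have m20 := m0 ord_max.
have m12 : m ord0 + m ord_max = 1 by move: m1; rewrite !big_ord_recl big_ord0 addr0 (_ : lift _ _ = ord_max) //; exact: val_inj.
have a12 : a1 != a2 by apply/eqP => /injA.
have LE : L = [set w : R[i] | Ul a1 a2 (m ord0) (m ord_max) w <= c].
  apply/seteqP; split => w; rewrite /L /lemniscate /Ul /= !big_ord_recl big_ord0 mulr1 (_ : lift _ _ = ord_max) //; exact: val_inj.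
have cPhi' := cPhi; rewrite LE in cPhi'.
have [crho d10 [dk [r0 dkP]]] := ROmegaP.
have d1n : d1 != 0 by rewrite gt_eqF.
have rhoP (z : R[i]) : r0 < ComplexField.Normc.normc z -> ROmega (Some (z : cplx R)) = Some (fin ROmega z : cplx R) /\
    series (fun k => dk k * (z : cplx R) ^- k : cplx R) @ \oo --> (fin ROmega z - d1 * z : cplx R).
  by move=> zr; have [|w fw sw] := dkP z; [rewrite normrC ltcR|rewrite /fin fw].
have [r1 [M1 g_near]] := @laurent_bounded R dk (fun z => fin ROmega z - d1 * z) r0 (fun z h => (rhoP z h).2).
have g_asym : exists r M, forall z : R[i], r < ComplexField.Normc.normc z -> ComplexField.Normc.normc (fin ROmega z - d1 * z) <= M.
  by exists r1, M1.
have rho_inf : ROmega None = None.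
  apply: (@conformal_None R Omega _ ROmega d1 (fin ROmega) (Num.max r0 r1) M1 crho d1n) => z.
  by rewrite gt_max => /andP[/rhoP[h _] /g_near].
have [r2 [M2 PhiA']] := PhiA.
have phiP (z : R[i]) : r2 < ComplexField.Normc.normc z -> Phi (Some (z : cplx R)) = Some (fin Phi z : cplx R) /\
    ComplexField.Normc.normc (z * (fin Phi z - z)) <= M2.
  by move=> zr; have [|w fw] := PhiA' z; [rewrite normrC ltcR|rewrite /fin fw normrC lecR].
have f_asym : exists r M, forall z : R[i], r < ComplexField.Normc.normc z -> ComplexField.Normc.normc (z * (fin Phi z - z)) <= M.
  by exists r2, M2 => z /phiP[].
have Phi_inf : Phi None = None.
  apply: (@conformal_None R _ _ Phi 1 (fin Phi) (Num.max 1 r2) M2 cPhi (oner_neq0 _)) => z.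
  rewrite gt_max => /andP[z1 /phiP[h1 h2]]; split => //; apply: le_trans h2.
  by rewrite mul1r normcMM ler_peMl ?normc_ge0 // ltW.
have L12 : connected_component L (a1 : cplx R) `&` connected_component L (a2 : cplx R) = set0.
  apply: contrapT => /eqP/set0P[w ww].
  by have := Ldisj ord0 ord_max I I (ex_intro _ w ww).
have cu := c_lt_ustar a12 m10 m20 m12 LE c0 L12.
have [al1 [al2 [al10 al20 al12 E1 E2]]] :=
  exponent_nat sP Omega_compact cPhi' Phi_inf crho rho_inf f_asym g_asym d1n a12 m10 m20 m12 c0 cu.
have [b [Ga [Gb [cb bu [oGa oGb EGa EGb GI] sep]]]] :=
  halo_separation sP Omega_compact cPhi' Phi_inf a12 m10 m20 m12 c0 cu EU EI (cEj _) (cEj _) (Ej0 _) (Ej0 _).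
have {sep} [h1 h2] : halo1 P Omega Phi a1 a2 (m ord0) (m ord_max) b `<=` Ga /\
    halo2 P Omega Phi a1 a2 (m ord0) (m ord_max) b `<=` Gb.
  (* If the halo around a1 belonged to E_2, the loop would surround E_2 alone. By the labelling
     clause its image, the circle around a1, would surround only the component of a2; yet it
     surrounds that of a1. *)
  case: sep => // -[h1 h2]; exfalso.
  have UE : [set z : R[i] | Omega P.[z]] = E_ ord_max `|` E_ ord0 by rewrite setUC.
  have IE : E_ ord_max `&` E_ ord0 = set0 by rewrite setIC.
  have IG : Gb `&` Ga = set0 by rewrite setIC.
  have [||J' [PJ _ sJ']] := label ord_max _ (loop_jordan sP Omega_compact cPhi' Phi_inf a12 m10 m20 m12 cu).
  - exact: (loop_out cPhi' Phi_inf a12 m10 m20 m12 cu).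
  - move=> k; split => [sk|->]; last first.
      exact: (loop_surrounds sP Omega_compact cPhi' Phi_inf a12 m10 m20 m12 cu UE IE (cEj _) cb bu oGb oGa EGb EGa IG h1 h2).
    apply: contrapT => kn; have k0 : k = ord0.
      by case: (k) kn => -[|[|//]] i kn; [exact: val_inj|case: kn; exact: val_inj].
    move: sk; rewrite k0.
    exact: (loop_not_surrounds sP Omega_compact cPhi' Phi_inf a12 m10 m20 m12 c0 cu UE (cEj _) (Ej0 _) cb bu oGa EGb EGa IG h1).
  have J'E : J' = circle1 a1 a2 (m ord0).
    move: PJ; rewrite (loop_image cPhi' Phi_inf a12 m10 m20 m12 cu) => SE.
    apply/seteqP; split => w wJ; have : (Some @` J' : set (sphere R)) (Some w) by [exists w|rewrite -SE; exists w].
      by rewrite -SE => -[v vJ [<-]].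
    by move=> [v vJ [<-]].
  have : surrounds J' (connected_component L (a1 : cplx R)).
    by rewrite J'E LE; exact: (circle1_surrounds a12 m10 m20 m12 c0 cu).
  by move=> /(sJ' ord0).
have [om Oom [c1 c2]] : exists2 om : R[i], Omega om &
    count (inset (E_ ord0)) (fib P om) = al1 /\ count (inset (E_ ord_max)) (fib P om) = al2.
  exact: (count_exponents sP Omega_compact Om0 cPhi' Phi_inf crho rho_inf f_asym g_asym d1n a12 m10 m20 m12 c0 al12 E1 E2 EU EI cb bu oGa oGb EGa EGb GI h1 h2).
have n1E : n1 = al1 by rewrite -c1 -(zeros_in_count _ _ sP) n_zeros.
have n2E : n2 = al2 by rewrite -c2 -(zeros_in_count _ _ sP) n_zeros.
have dP : P^`().[zs] = 0 by apply/eqP.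
have [F1 F2] := centers_formula sP Omega_compact cPhi' Phi_inf crho rho_inf f_asym g_asym d1n m10 m20 m12 c0 al12 E1 E2 al10 al20 dP zs_out.
exists (fin ROmega P.[zs]); first exact: (finE crho rho_inf).
by rewrite n1E n2E.
Qed.
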